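(* Let $f\in\mathcal{F}_s$. Suppose there is a constant $\tilde c>0$ such that for every $j=1,\dots,s$ (and all levels $k_j\ge 0$ and all $t_j\in\{0,\dots,b^{k_j}-1\}$) the minimum eigenvalue of $A_j$ satisfies $\lambda_1(A_j)\ge \tilde c\, b^{-2k_j/d}$. Then there exists a constant $c>0$ (not depending on $m$) such that, with $n=b^m$, $$\sigma_{sgn}^2\;\ge\; c\,\frac{(\log n)^{s-1}}{n^{1+2/d}}$$ for all sufficiently large $m$.
   Context: Fix integers $s,d\ge1$ and $b\ge2$. For $j=1,\dots,s$ let $\mathcal{X}^{(j)}\subset\mathbb{R}^d$ be bounded with $\mathrm{vol}(\mathcal{X}^{(j)})=1$, and let $\mathcal{X}^{1:s}=\prod_{j=1}^s\mathcal{X}^{(j)}$. Points are $\boldsymbol{x}=(\boldsymbol{x}_1,\dots,\boldsymbol{x}_s)$ with $\boldsymbol{x}_j=(x_{j1},\dots,x_{jd})\in\mathcal{X}^{(j)}$. Recursive splits. A $b$-fold split of a set $\mathcal X$ of finite positive volume is a family of Borel sets $\mathcal X_0,\dots,\mathcal X_{b-1}$ with union $\mathcal X$, each of volume $\mathrm{vol}(\mathcal X)/b$, with pairwise intersections of volume $0$. A recursive split of $\mathcal X^{(j)}$ in base $b$ consists of cells $\mathcal X_{j,(k,t)}$, $k\ge0$, $0\le t<b^k$, with $\mathcal X_{j,(0,0)}=\mathcal X^{(j)}$, such that for each $(k,t)$ the sets $\mathcal X_{j,(k,t,c)}:=\mathcal X_{j,(k+1,bt+c)}$, $c=0,\dots,b-1$,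 form a $b$-fold split of $\mathcal X_{j,(k,t)}$. One such recursive split is fixed for each $j$. Sphericity condition (standing assumption): there is $C<\infty$ with $\mathrm{diam}(\mathcal X_{j,(k,t)})\le C b^{-k/d}$ for all $j,k,t$. The transformation $\phi_j:[0,1]\to\mathcal X^{(j)}$ sends $u=\sum_{k\ge1}u_kb^{-k}$ (base $b$ digits $u_k$) to the limit point of the nested cells $\mathcal X_{j,(K,t^{(K)})}$, $t^{(K)}=\sum_{k=1}^K u_kb^{K-k}$, as $K\to\infty$. Sobol' extensible (standing assumption on $\mathcal X^{1:s}\subset\mathbb R^{ds}$): a closed set with nonempty interior is Sobol' extensible if it contains a point $\boldsymbol c$ such that for every $\boldsymbol z$ in the set, the closed axis-parallel box with opposite corners $\boldsymbol c$ and $\boldsymbol z$ is contained in the set. Scrambled geometric nets. Points $\boldsymbol a_1,\dots,\boldsymbol a_{b^m}\in[0,1]^s$ form a $(0,m,s)$-net in base $b$ if every box $\prod_{j=1}^s[c_jb^{-k_j},(c_j+1)b^{-k_j})$, with integers $k_j\ge0$, $0\le c_j<b^{k_j}$, of volume $b^{-m}$ contains exactly one of them. Nested uniform scramble: take mutually independent uniform random permutations $\pi_{j\cdot a_1a_2\cdots a_k}$ of $\{0,\dots,b-1\}$, indexed by $1\le j\le s$, $k\ge0$, and digit strings $a_1\cdots a_k$; if $a_{ij}$ has base $b$ digits $a_{ij1},a_{ij2},\dots$ (choosing the expansion ending in zeros if there are two), then $u_{ij}$ has digits $u_{ij,k+1}=\pi_{j\cdot a_{ij1}\cdots a_{ijk}}(a_{ij,k+1})$.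 The scrambled $(0,m,s)$ geometric net is $\boldsymbol x_i=(\phi_1(u_{i1}),\dots,\phi_s(u_{is}))$, $i=1,\dots,n=b^m$. For each $m$ considered such a net is used, and $$\mu=\int_{\mathcal X^{1:s}}f(\boldsymbol x)\,d\boldsymbol x,\qquad \hat\mu=\frac1n\sum_{i=1}^n f(\boldsymbol x_i),\qquad \sigma_{sgn}^2=\mathrm{Var}(\hat\mu).$$ Smooth functions. For $u\subseteq\{1,\dots,s\}$, $\nabla^uf(\boldsymbol x)$ is the $d^{|u|}$-dimensional vector whose coordinates are $\partial^{|u|}f(\boldsymbol x)/\prod_{j\in u}\partial x_{j i_j}$, with $i_j\in\{1,\dots,d\}$ for $j\in u$, in a fixed lexicographic order ($\nabla^\emptyset f=f$). $f$ is smooth if there are finite $B\ge0$ and $\beta\in(0,1]$ such that $\|\nabla^uf(\boldsymbol x)-\nabla^uf(\boldsymbol x^* )\|\le B\|\boldsymbol x-\boldsymbol x^*\|^\beta$ for all $u\subseteq\{1,\dots,s\}$ and all $\boldsymbol x,\boldsymbol x^*\in\mathcal X^{1:s}$. $\mathcal F_s$ is the class of smooth $f$ on $\mathcal X^{1:s}$ such that $\big\|\int_{\mathcal X^{1:s}}\nabla^uf(\boldsymbol x)\,d\boldsymbol x\big\|^2>0$ for all $u\subseteq\{1,\dots,s\}$ (integral taken coordinatewise). The matrices $A_j$. For given $j,k_j,t_j$, let $\boldsymbol w_j$ be the center (centroid) of $\mathcal X_{j,(k_j,t_j)}$ and $\boldsymbol n_{c_j}$ that of $\mathcal X_{j,(k_j,t_j,c_j)}$,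 i.e. $\int_{\mathcal X_{j,(k_j,t_j)}}\langle\boldsymbol x-\boldsymbol w_j,\boldsymbol\delta\rangle\,d\boldsymbol x=0$ and $\int_{\mathcal X_{j,(k_j,t_j,c_j)}}\langle\boldsymbol x-\boldsymbol n_{c_j},\boldsymbol\delta\rangle\,d\boldsymbol x=0$ for every fixed vector $\boldsymbol\delta$. Then $A_j=\sum_{c_j=0}^{b-1}(\boldsymbol n_{c_j}-\boldsymbol w_j)(\boldsymbol n_{c_j}-\boldsymbol w_j)^T$, and $\lambda_1(A_j)$ is its minimum eigenvalue. *)

(* Defs.v *)
(* A point of R^d is a row vector 'rV[R]_d; a point
   x = (x_1, ..., x_s) of (R^d)^s = R^(ds) is a matrix 'M[R]_(s, d) whose j-th
   row is x_j and whose entry x j l is the l-th coordinate of x_j.  Digits,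
   levels and blocks are numbered from 0. *)
From HB Require Import structures.
From mathcomp Require Import all_boot all_order all_algebra perm.
From mathcomp Require Import all_classical all_reals all_analysis.
Set Implicit Arguments.
Unset Strict Implicit.
Unset Printing Implicit Defensive.
Import Order.TTheory GRing.Theory Num.Theory.
Import numFieldNormedType.Exports.
Local Open Scope classical_set_scope.
Local Open Scope ring_scope.

(* The n-fold product of a sigma-finite measure, on n.-tuple T. *)
Section tuple_measure.
Context d (T : measurableType d) (R : realType).
Variable m1 : {sigma_finite_measure set T -> \bar R}.

Section cons.
Context (n : nat) (m2 : {sigma_finite_measure set (n.-tuple T) -> \bar R}).

Definition tcons (p : T * n.-tuple T) : n.+1.-tuple T := [tuple of p.1 :: p.2].

Lemma measurable_tcons : measurable_fun setT tcons.
Proof. exact: measurable_cons. Qed.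

Definition cons_measure := pushforward (m1 \x m2)%E tcons.

Let cons_measure0 : cons_measure set0 = 0%E.
Proof. by rewrite /cons_measure /pushforward preimage_set0 measure0. Qed.

Let cons_measure_ge0 A : (0 <= cons_measure A)%E.
Proof. by rewrite /cons_measure /pushforward; exact: measure_ge0. Qed.

Let cons_measure_sigma_additive : semi_sigma_additive cons_measure.
Proof. by apply: measure_semi_sigma_additive; exact: measurable_tcons. Qed.

HB.instance Definition _ := isMeasure.Build _ _ _ cons_measure
  cons_measure0 cons_measure_ge0 cons_measure_sigma_additive.

Let cons_measure_sigma_finite : sigma_finite setT cons_measure.
Proof.
have /sigma_finiteP[F [FT ndF mF]] := sigma_finiteT m1.
have /sigma_finiteP[G [GT ndG mG]] := sigma_finiteT m2.
exists (fun i => [set t | F i (thead t) /\ G i [tuple of behead t]]).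
  apply/seteqP; split=> // t _ /=.
  have [i _ Fi] : (\bigcup_i F i) (thead t) by rewrite -FT.
  have [j _ Gj] : (\bigcup_i G i) [tuple of behead t] by rewrite -GT.
  exists (maxn i j) => //=; split.
    by move: Fi; apply/subsetPset/ndF/leq_maxl.
  by move: Gj; apply/subsetPset/ndG/leq_maxr.
move=> i; have [mFi Fi] := mF i; have [mGi Gi] := mG i; split.
  apply: measurableI.
    by rewrite -[X in measurable X]setTI; exact: measurable_tnth.
  by rewrite -[X in measurable X]setTI; exact: measurable_behead.
rewrite (_ : cons_measure _ = (m1 \x m2)%E (F i `*` G i)).
  by rewrite product_measure1E// lte_mul_pinfty// ge0_fin_numE.
congr product_measure1; apply/seteqP.
by split=> -[x t] /=; rewrite (_ : [tuple of _] = t)//; apply/val_inj.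
Qed.

HB.instance Definition _ := Measure_isSigmaFinite.Build _ _ _ cons_measure
  cons_measure_sigma_finite.

End cons.

Fixpoint tuple_measure n : {sigma_finite_measure set (n.-tuple T) -> \bar R} :=
  match n with
  | 0 => dirac ([tuple] : 0.-tuple T)
  | n.+1 => cons_measure (tuple_measure n)
  end.


Lemma tuple_measure_box n (A : 'I_n -> set T) : (forall i, measurable (A i)) ->
  tuple_measure n [set t | forall i, A i (tnth t i)] =
  (\prod_(i < n) m1 (A i))%E.
Proof.
elim: n A => [|n ih] A mA /=.
  by rewrite big_ord0 diracE mem_set// => -[].
rewrite big_ord_recl -ih; last by move=> i; exact: mA.
rewrite /cons_measure /pushforward -product_measure1E//; last first.
  rewrite (_ : mkset _ = \big[setI/setT]_(i < n)
      ((fun t : n.-tuple T => tnth t i) @^-1` A (lift ord0 i))); last first.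
    rewrite -bigcap_seq; apply/seteqP; split=> t /=.
      by move=> At i _; exact: At.
    by move=> At i; apply: At => /=; rewrite mem_index_enum.
  apply: bigsetI_measurable => i _.
  by rewrite -[X in measurable X]setTI; exact: measurable_tnth.
congr product_measure1; apply/seteqP; split=> -[x t] /=.
  move=> At; split=> [|i]; first exact: (At ord0).
  by have := At (lift ord0 i); rewrite tnthS; congr (A _ (tnth _ _)); apply/val_inj.
move=> [Ax At] i; have [j ->|->] := unliftP ord0 i; last exact: Ax.
by rewrite tnthS; have := At j; congr (A _ (tnth _ _)); apply/val_inj.
Qed.

End tuple_measure.

(* The Borel sigma-algebra and the Lebesgue measure on real m x n matrices,
   the latter transported from the product measure on (m * n).-tuple R; it is
   pinned down by mx_lebesgue_box below. *)
Definition borel_mx_display : measure_display.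
Proof. exact: default_measure_display. Qed.

Section borel_mx.
Context (R : realType) (m n : nat).
Local Notation M := 'M[R]_(m, n).

Let borel0 : <<s @open M >> set0. Proof. exact: sigma_algebra0. Qed.

Let borelC A : <<s @open M >> A -> <<s @open M >> (~` A).
Proof. exact: sigma_algebraC. Qed.

Let borel_bigcup (F : _^nat) : (forall i, <<s @open M >> (F i)) ->
  <<s @open M >> (\bigcup_i F i).
Proof. exact: sigma_algebra_bigcup. Qed.

HB.instance Definition _ := @isMeasurable.Build borel_mx_display M
  <<s @open M >> borel0 borelC borel_bigcup.

Definition mx_of_tuple (t : (m * n).-tuple R) : M :=
  \matrix_(i, j) tnth t (mxvec_index i j).

Let ratbox (c : 'M[rat]_(m, n) * 'M[rat]_(m, n)) : set M :=
  [set x | forall i j, ratr (c.1 i j) < x i j < ratr (c.2 i j)].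

Let openE_ratbox (U : set M) : open U ->
  U = \bigcup_c [set x | ratbox c `<=` U /\ ratbox c x].
Proof.
rewrite openE => oU; apply/seteqP; split=> [x /oU [P xP PU]|x [c _ []]]; last exact.
have /choice[c /= cP] (k : 'I_m * 'I_n) : exists pq : rat * rat,
    ratr pq.1 < x k.1 k.2 < ratr pq.2 /\
    forall y, ratr pq.1 < y < ratr pq.2 -> P k.1 k.2 y.
  have /nbhs_ballP[e /= e0 eP] := xP k.1 k.2.
  have [p] : exists p : rat, ratr p \in `](x k.1 k.2 - e), (x k.1 k.2)[.
    by apply: rat_in_itvoo; rewrite ltrBlDr ltrDl.
  rewrite in_itv/= => /andP[p1 p2].
  have [q] : exists q : rat, ratr q \in `](x k.1 k.2), (x k.1 k.2 + e)[.
    by apply: rat_in_itvoo; rewrite ltrDl.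
  rewrite in_itv/= => /andP[q1 q2].
  exists (p, q); split=> /= [|y /andP[py yq]]; first by rewrite p2 q1.
  apply: eP; rewrite /ball/= distrC ltr_distl (lt_trans p1 py)/=.
  exact: lt_trans yq q2.
exists (\matrix_(i, j) (c (i, j)).1, \matrix_(i, j) (c (i, j)).2) => //=.
split=> [y yc|i j]; last by rewrite !mxE; exact: (cP (i, j)).1.
apply: PU => i j; apply: (cP (i, j)).2.
by have := yc i j; rewrite /= !mxE.
Qed.

Lemma measurable_mx_of_tuple :
  measurable_fun [set: (m * n).-tuple (measurableTypeR R)] mx_of_tuple.
Proof.
apply: (@measurability _ _ _ _ _ _ (@open M)) => //.
move=> _ [U oU <-]; rewrite setTI (openE_ratbox oU) preimage_bigcup.
apply: countable_bigcupT_measurable => [|c]; first exact: countableP.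
have [cU|cU] := pselect (ratbox c `<=` U); last first.
  by rewrite (_ : _ @^-1` _ = set0)//; apply/seteqP; split=> t [].
rewrite (_ : _ @^-1` _ = \big[setI/setT]_(k : 'I_m * 'I_n)
    ((fun t : (m * n).-tuple R => tnth t (mxvec_index k.1 k.2)) @^-1`
     `]ratr (c.1 k.1 k.2), ratr (c.2 k.1 k.2)[)); last first.
  rewrite -bigcap_seq; apply/seteqP; split=> t /=.
    by move=> [_ tc] [i j] _ /=; have := tc i j; rewrite mxE in_itv.
  move=> tc; split=> // i j; rewrite mxE.
  by have := tc (i, j); rewrite /= in_itv/=; apply; rewrite mem_index_enum.
apply: bigsetI_measurable => k _.
rewrite -[X in measurable X]setTI.
exact: (@measurable_tnth _ (measurableTypeR R)).
Qed.

Definition mx_lebesgue : set M -> \bar R :=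
  pushforward (tuple_measure (@lebesgue_measure R) (m * n)) mx_of_tuple.

Let mx_lebesgue0 : mx_lebesgue set0 = 0%E.
Proof. by rewrite /mx_lebesgue /pushforward preimage_set0 measure0. Qed.

Let mx_lebesgue_ge0 A : (0 <= mx_lebesgue A)%E.
Proof. by rewrite /mx_lebesgue /pushforward; exact: measure_ge0. Qed.

Let mx_lebesgue_sigma_additive : semi_sigma_additive mx_lebesgue.
Proof.
by apply: measure_semi_sigma_additive; exact: measurable_mx_of_tuple.
Qed.

HB.instance Definition _ := isMeasure.Build _ _ _ mx_lebesgue
  mx_lebesgue0 mx_lebesgue_ge0 mx_lebesgue_sigma_additive.

Lemma mx_lebesgue_box (a b : M) : (forall i j, a i j <= b i j) ->
  mx_lebesgue [set x | forall i j, a i j <= x i j <= b i j] =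
  (\prod_i \prod_j (b i j - a i j))%:E.
Proof.
move=> ab; rewrite /mx_lebesgue /pushforward.
pose A (k : 'I_(m * n)) : set (measurableTypeR R) :=
  `[mxvec a 0 k, mxvec b 0 k]%classic.
rewrite (_ : _ @^-1` _ = [set t : (m * n).-tuple R | forall k, A k (tnth t k)]).
  rewrite tuple_measure_box; last by move=> k; exact: measurable_itv.
  rewrite (eq_bigr (fun k => (mxvec b 0 k - mxvec a 0 k)%:E)); last first.
    move=> k _; rewrite /A.
    transitivity (@lebesgue_measure R `[mxvec a 0 k, mxvec b 0 k]%classic) => //.
    rewrite lebesgue_measure_itv/= lte_fin -EFinB.
    case: ltgtP => // [|->]; last by rewrite subrr.
    by case/mxvec_indexP: k => i j; rewrite !mxvecE ltNge ab.
  rewrite prodEFin pair_bigA/=; congr EFin.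
  rewrite (reindex _ (curry_mxvec_bij m n))/=.
  by apply: eq_bigr => -[i j] _ /=; rewrite !mxvecE.
apply/seteqP; split=> t /= tab.
  move=> k; case/mxvec_indexP: k => i j.
  by have := tab i j; rewrite /A /= in_itv/= mxE !mxvecE.
move=> i j; have := tab (mxvec_index i j).
by rewrite /A /= in_itv/= mxE !mxvecE.
Qed.

End borel_mx.

Section euclidean.
Context (R : realType).

(* The library's norm on matrices is the sup norm. *)
Definition enorm m n (x : 'M[R]_(m, n)) : R :=
  Num.sqrt (\sum_i \sum_j x i j ^+ 2).

Definition dotp n (x y : 'rV[R]_n) : R := \sum_i x 0 i * y 0 i.

Definition diam m n (S : set 'M[R]_(m, n)) : \bar R :=
  ereal_sup [set (enorm (x - y))%:E | x in S & y in S].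

(* \matrix_j x_j with x_j in X j for all j *)
Definition prod_set s d (X : 'I_s -> set 'rV[R]_d) : set 'M[R]_(s, d) :=
  [set x | forall j, X j (row j x)].

Definition sobol_extensible m n (S : set 'M[R]_(m, n)) : Prop :=
  [/\ closed S, interior S !=set0 &
      exists2 c, S c & forall z, S z -> forall y : 'M[R]_(m, n),
        (forall i j, Num.min (c i j) (z i j) <= y i j
                       <= Num.max (c i j) (z i j)) -> S y].

End euclidean.

Section splits.
Context (R : realType) (d b : nat).
Local Notation vol := (@mx_lebesgue R 1 d).

Definition fold_split (S : set 'rV[R]_d) (Y : 'I_b -> set 'rV[R]_d) : Prop :=
  [/\ (0 < vol S < +oo)%E,
      forall c, measurable (Y c),
      \bigcup_c Y c = S,
      forall c, vol (Y c) = (vol S * (b%:R^-1)%:E)%E &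
      forall c c', c != c' -> vol (Y c `&` Y c') = 0%E].

(* [cell k t] is only meaningful for t < b ^ k *)
Definition recursive_split (S : set 'rV[R]_d)
    (cell : nat -> nat -> set 'rV[R]_d) : Prop :=
  cell 0 0 = S /\
  forall k t, (t < b ^ k)%N ->
    fold_split (cell k t) (fun c : 'I_b => cell k.+1 (b * t + c)%N).

Definition spherical s (cell : 'I_s -> nat -> nat -> set 'rV[R]_d) : Prop :=
  exists C : R, forall j k t, (t < b ^ k)%N ->
    (diam (cell j k t) <= (C * b%:R `^ (- (k%:R / d%:R)))%:E)%E.

(* the w such that x - w integrates to 0 over S in every direction; it is
   unique when S is a bounded set of positive volume *)
Definition centroid (S : set 'rV[R]_d) : 'rV[R]_d :=
  get [set w | forall delta : 'rV[R]_d,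
                 \int[vol]_(x in S) dotp (x - w) delta = 0].

(* Points being row vectors, the column (n_c - w) is the transpose. *)
Definition split_matrix (cell : nat -> nat -> set 'rV[R]_d) k t : 'M[R]_d :=
  \sum_(c < b)
    let v := centroid (cell k.+1 (b * t + c)%N) - centroid (cell k t) in
    v^T *m v.

Definition min_eigenvalue (A : 'M[R]_d) : R := inf [set l | eigenvalue A l].

End splits.

Section scrambled_geometric_nets.
Context (R : realType) (s d b : nat) (hb : (1 < b)%N).

(* The digit of weight b^-(k+1) of x in [0, 1].  A number with two expansions
   gets the one ending in zeros; 1 gets its only expansion 0.(b-1)(b-1)...,
   whereas the floor formula would give it the digits of 0. *)
Definition digit (x : R) (k : nat) : 'I_b :=
  Ordinal (ltn_pmod (if x < 1 then Num.truncn (x * b%:R ^+ k.+1) else b.-1)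
                    (ltnW hb)).

Definition cell_index (x : R) (K : nat) : nat :=
  (\sum_(k < K) digit x k * b ^ (K - k.+1))%N.

(* limit of the filter generated by the nested cells to which u belongs *)
Definition phi (cell : nat -> nat -> set 'rV[R]_d) (u : R) : 'rV[R]_d :=
  lim (filter_from [set: nat] (fun K => cell K (cell_index u K))).

Definition is_net (m : nat) (a : 'I_(b ^ m) -> 'rV[R]_s) : Prop :=
  (forall i j, 0 <= a i 0 j <= 1) /\
  forall k c : 'I_s -> nat, (forall j, (c j < b ^ k j)%N) ->
    \prod_j (b%:R ^- k j : R) = b%:R ^- m ->
    exists! i, forall j,
      (c j)%:R / b%:R ^+ k j <= a i 0 j < (c j).+1%:R / b%:R ^+ k j.

(* [pi j [:: a_1; ...; a_k]] is the permutation applied to the (k+1)-st digit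
   of the j-th coordinate when its first k digits are a_1, ..., a_k. *)
Definition uniform_independent_perms d0 (Omega : measurableType d0)
    (P : probability Omega R)
    (pi : 'I_s -> seq 'I_b -> Omega -> {perm 'I_b}) : Prop :=
  [/\ forall j a p, measurable [set w | pi j a w = p],
      forall j a p, P [set w | pi j a w = p] = ((b`!)%:R^-1)%:E &
      forall (I : seq ('I_s * seq 'I_b))
             (B : 'I_s * seq 'I_b -> {set {perm 'I_b}}), uniq I ->
        P (\bigcap_(i in [set` I]) [set w | pi i.1 i.2 w \in B i]) =
        (\prod_(i <- I) P [set w | pi i.1 i.2 w \in B i])%E].

Definition scramble (p : seq 'I_b -> {perm 'I_b}) (x : R) : R :=
  limn (series (fun k =>
    (p [seq digit x i | i <- iota 0 k] (digit x k))%:R / b%:R ^+ k.+1 : R)).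

Definition geometric_point (cell : 'I_s -> nat -> nat -> set 'rV[R]_d)
    (p : 'I_s -> seq 'I_b -> {perm 'I_b}) (a : 'rV[R]_s) : 'M[R]_(s, d) :=
  \matrix_(j < s) phi (cell j) (scramble (p j) (a 0 j)).

Definition muhat Omega (f : 'M[R]_(s, d) -> R)
    (cell : 'I_s -> nat -> nat -> set 'rV[R]_d)
    (pi : 'I_s -> seq 'I_b -> Omega -> {perm 'I_b})
    (m : nat) (a : 'I_(b ^ m) -> 'rV[R]_s) (w : Omega) : R :=
  (b ^ m)%:R^-1 *
  \sum_i f (geometric_point cell (fun j t => pi j t w) (a i)).

End scrambled_geometric_nets.

Section smoothness.
Context (R : realType) (s d : nat).

(* A mixed partial derivative of order at most one in each block x_j is indexed
   by alpha, where alpha j = Some l means differentiation in x_{jl} and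
   alpha j = None no differentiation in x_j. *)
Definition partial_index := {ffun 'I_s -> option 'I_d}.

(* alpha indexes one of the d^|u| coordinates of the gradient nabla^u *)
Definition coord_of (u : {set 'I_s}) (alpha : partial_index) : bool :=
  [forall j, isSome (alpha j) == (j \in u)].

Definition add_partial (alpha : partial_index) (j : 'I_s) (l : 'I_d) :
    partial_index :=
  [ffun j' => if j' == j then Some l else alpha j'].

(* g is the family of mixed partial derivatives of f.  At the boundary points of
   X a two-sided derivative would involve values of f outside X: derivatives are
   taken in the interior, and g alpha is their extension to X (continuous as
   soon as [hoelder_gradients] holds). *)
Definition mixed_partials (X : set 'M[R]_(s, d)) (f : 'M[R]_(s, d) -> R)
    (g : partial_index -> 'M[R]_(s, d) -> R) : Prop :=
  (forall x, X x -> g [ffun=> None] x = f x) /\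
  (forall (alpha : partial_index) j l x, alpha j = None -> interior X x ->
     is_derive x (delta_mx j l : 'M[R]_(s, d)) (g alpha)
       (g (add_partial alpha j l) x)).

Definition hoelder_gradients (X : set 'M[R]_(s, d))
    (g : partial_index -> 'M[R]_(s, d) -> R) : Prop :=
  exists B beta : R, [/\ 0 <= B, 0 < beta <= 1 &
    forall (u : {set 'I_s}) x y, X x -> X y ->
      Num.sqrt (\sum_(alpha | coord_of u alpha) (g alpha x - g alpha y) ^+ 2)
        <= B * enorm (x - y) `^ beta].

(* the class F_s of smooth functions on X *)
Definition smooth_nondegenerate (X : set 'M[R]_(s, d)) (f : 'M[R]_(s, d) -> R) :
    Prop :=
  exists g : partial_index -> 'M[R]_(s, d) -> R,
    [/\ mixed_partials X f g, hoelder_gradients X g &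
        forall u : {set 'I_s},
          0 < \sum_(alpha | coord_of u alpha)
                (\int[@mx_lebesgue R s d]_(x in X) g alpha x) ^+ 2].

End smoothness.

(* Main.v *)
(* Lower bounds for the variance come from testing muhat against an explicit
   random variable.  Fix a point xs where some mixed derivative of order one in
   every block is nonzero, a small product of cells Q around xs, and a vector k
   of levels with k_1 + ... + k_s = m, all large enough.  On each product of cells
   of levels k inside Q, the test function nu_k is the multilinear form with
   coefficients D f(xs) applied to the increments n_c - w of the centroids.  It
   has mean zero in the digit k_j of each coordinate j, so that
   - two distinct points of the net do not correlate under nu_k, because they are
     separated in some coordinate j by their first k_j digits and the permutation
     acting on the next digit of one of them is not used by the other one;
   - nu_k and nu_k' are orthogonal if k <> k'.
   With W = n^-1 sum_k sum_i nu_k(x_i) this yields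
     Var muhat >= 2 Cov(muhat, W) - E W^2 = n^-1 sum_k (2 <nu_k, f> - |nu_k|^2).
   Taylor expansion in each block gives <nu_k, f> = |nu_k|^2 up to a small
   relative error, and |nu_k|^2 is a tensor product of the quadratic forms A_j,
   hence at least of order prod_j b^(-2 k_j / d) = n^(-2/d).  There are of order
   m^(s-1) vectors k.
   All of this is carried out on the first K digits, where the points of a cell of
   level K are replaced by one representative: then only finitely many
   permutations matter and the variance is bounded for fixed m as K grows. *)
Require Import Defs.
From HB Require Import structures.
From mathcomp Require Import all_boot all_order all_algebra perm.
From mathcomp Require Import all_classical all_reals all_analysis.
From mathcomp Require Import measurable_realfun measurable_fun_approximation.
From mathcomp Require Import simple_functions ring lra zify.
Set Implicit Arguments.
Unset Strict Implicit.
Unset Printing Implicit Defensive.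
Import Order.TTheory GRing.Theory Num.Theory.
Import numFieldNormedType.Exports.
Local Open Scope classical_set_scope.
Local Open Scope ring_scope.

(** * Rayleigh quotients *)

(** Three obstacles shape the details. Derivatives are available only in the interior of X, and the
    only paths known to stay in X are those inside boxes with corner [c]. The representatives are
    therefore chosen with no coordinate equal to that of [c], so that these boxes have an interior,
    and two representatives are joined through a point common to their boxes. Next, nu_k must have
    mean zero exactly, not up to an error, for the orthogonality relations to hold; so at truncation
    level K the centroids are replaced by means of the representatives. The true centroids return
    only in the eigenvalue bound, at a cost of order b^(-K/d) per increment. Last, muhat differs
    from its truncation, and its measurability is never established: half of E W^2 is sacrificed to
    absorb the difference, whence the factor 3/2 throughout, and the variance is bounded below
    through a measurable minorant. The point xs and the level K0 of the cube Q are chosen before m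
    and determine the final constant; K is chosen after m. *)

Section rayleigh.
Context (R : realType) (d : nat).
Implicit Types (u v : 'rV[R]_d) (A : 'M[R]_d).

Lemma dotpC u v : dotp u v = dotp v u.
Proof. by apply: eq_bigr => i _; rewrite mulrC. Qed.

Lemma dotpDl u v w : dotp (u + v) w = dotp u w + dotp v w.
Proof. by rewrite -big_split; apply: eq_bigr => i _; rewrite !mxE mulrDl. Qed.

Lemma dotpDr u v w : dotp w (u + v) = dotp w u + dotp w v.
Proof. by rewrite dotpC dotpDl !(dotpC w). Qed.

Lemma dotpZl a u v : dotp (a *: u) v = a * dotp u v.
Proof. by rewrite /dotp mulr_sumr; apply: eq_bigr => i _; rewrite !mxE mulrA. Qed.

Lemma dotpZr a u v : dotp u (a *: v) = a * dotp u v.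
Proof. by rewrite dotpC dotpZl dotpC. Qed.

Lemma dotpE u v : dotp u v = (u *m v^T) 0 0.
Proof. by rewrite mxE; apply: eq_bigr => i _; rewrite mxE. Qed.

Lemma dotp_ge0 u : 0 <= dotp u u.
Proof. by apply: sumr_ge0 => i _; rewrite -expr2 sqr_ge0. Qed.

Lemma dotp_eq0 u : (dotp u u == 0) = (u == 0).
Proof.
apply/idP/eqP => [|->]; last first.
  by rewrite /dotp big1// => i _; rewrite !mxE mul0r.
rewrite psumr_eq0 => [/allP u0|i _]; last by rewrite -expr2 sqr_ge0.
apply/rowP => i; have := u0 i; rewrite mem_index_enum => /(_ isT)/=.
by rewrite mulf_eq0 orbb mxE => /eqP.
Qed.

Lemma dotp_mulmx_sym A u v : A^T = A -> dotp (u *m A) v = dotp (v *m A) u.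
Proof.
by move=> sA; rewrite [RHS]dotpC !dotpE trmx_mul sA mulmxA.
Qed.

Lemma mx_entry_le_norm m n (x : 'M[R]_(m, n)) i j : `|x i j| <= `|x|.
Proof.
rewrite [leRHS]/Num.norm /= mx_normrE.
apply/bigmax_geP; right => /=; by exists (i, j).
Qed.

Lemma mx_norm_leP m n (x : 'M[R]_(m, n)) e : 0 <= e ->
  (forall i j, `|x i j| <= e) -> `|x| <= e.
Proof.
move=> e0 xe; rewrite [leLHS]/Num.norm /= mx_normrE; apply/bigmax_leP; split => //=.
Qed.

Lemma sumr_continuous (I : finType) (f : I -> 'rV[R]_d -> R) :
  (forall i, continuous (f i)) -> continuous (fun v => \sum_i f i v).
Proof.
by move=> cf; apply: continuous_big => //; exact: add_continuous.
Qed.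

Lemma dotp_mulmx_continuous A : continuous (fun v => dotp (v *m A) v).
Proof.
apply: sumr_continuous => i v.
have -> : (fun u : 'rV[R]_d => (u *m A) 0 i * u 0 i) =
    (fun u => (\sum_j u 0 j * A j i) * u 0 i) by apply/funext => u; rewrite mxE.
apply: (@continuousM R _ (fun u : 'rV[R]_d => \sum_j u 0 j * A j i)
  (fun u => u 0 i)); last exact: coord_continuous.
apply: (@sumr_continuous _ (fun j v => v 0 j * A j i)) => j {}v.
apply: (@continuousM R _ (fun u : 'rV[R]_d => u 0 j) (fun=> A j i)).
  exact: coord_continuous.
exact: cst_continuous.
Qed.

Lemma sphere_compact : compact [set v : 'rV[R]_d | dotp v v = 1].
Proof.
apply: bounded_closed_compact; last first.
  rewrite (_ : mkset _ = (fun v => dotp (v *m 1%:M) v) @^-1` [set 1]); last first.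
    by apply/seteqP; split => v; rewrite /= mulmx1.
  apply: closed_comp; last exact: closed_eq.
  by move=> v _; exact: dotp_mulmx_continuous.
exists 1; split => // M M1 v /= v1.
have M0 : 0 <= M by rewrite ltW// (lt_trans _ M1).
apply: mx_norm_leP => // i j.
rewrite (le_trans _ (ltW M1))// -(@ler_pXn2r _ 2)// ?nnegrE//.
rewrite expr1n -v1 real_normK ?num_real// /dotp (bigD1 j)//= (ord1 i) -expr2.
by rewrite lerDl sumr_ge0// => k _; rewrite -expr2 sqr_ge0.
Qed.

(** By compactness the form has a minimizer [w] on the unit sphere. Its residual r = wA - mu w
    vanishes, since otherwise moving [w] along r would decrease the Rayleigh quotient; so mu is an
    eigenvalue, and every eigenvalue is at least mu. *)
Lemma min_eigenvalue_le A v : (0 < d)%N -> A^T = A ->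
  min_eigenvalue A * dotp v v <= dotp (v *m A) v.
Proof.
move=> d0 sA.
have [w] : exists2 w, w \in [set v : 'rV[R]_d | dotp v v = 1] &
    forall t, t \in [set v : 'rV[R]_d | dotp v v = 1] ->
      dotp (w *m A) w <= dotp (t *m A) t.
  apply: EVT_min_rV; [|exact: sphere_compact|].
    exists (delta_mx 0 (Ordinal d0)) => /=.
    rewrite /dotp (bigD1 (Ordinal d0))//= !mxE !eqxx mul1r big1 ?addr0// => i i0.
    by rewrite !mxE (negbTE i0) andbF mul0r.
  by apply: continuous_subspaceT => x; exact: dotp_mulmx_continuous.
rewrite inE/= => w1 wmin; set mu := dotp (w *m A) w in wmin.
have wq u : mu * dotp u u <= dotp (u *m A) u.
  have [->|u0] := eqVneq u 0.
    by rewrite mul0mx (eqP (_ : dotp 0 0 == 0)) ?dotp_eq0 ?mulr0.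
  have u2 : 0 < dotp u u by rewrite lt_def dotp_ge0 dotp_eq0 u0.
  pose a := (Num.sqrt (dotp u u))^-1.
  have a2 : a * a = (dotp u u)^-1.
    by rewrite -invfM -expr2 sqr_sqrtr// ltW.
  have := wmin (a *: u); rewrite inE/= -scalemxAl !dotpZl !dotpZr !mulrA a2.
  rewrite mulVf ?gt_eqF// => /(_ erefl).
  by rewrite mulrC ler_pdivlMr.
have wA : w *m A = mu *: w.
  apply/eqP; rewrite -subr_eq0 -dotp_eq0; set r := _ - _.
  have rw : dotp r w = 0.
    by rewrite /r dotpDl -scaleNr dotpZl w1 mulr1 subrr.
  have war : w *m A = r + mu *: w by rewrite subrK.
  clearbody r.
  (* The inequality [wq] at w + t r, simplified by r being orthogonal to w. It cannot hold for all t
     unless r = 0: t = -1 contradicts it if q <= 0, and t = -S/q otherwise. *)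
  have qt t : 0 <= 2 * t * dotp r r + t ^+ 2 * (dotp (r *m A) r - mu * dotp r r).
    have := wq (w + t *: r); rewrite mulmxDl -scalemxAl.
    rewrite !(dotpDl, dotpDr, dotpZl, dotpZr) w1 -/mu (dotp_mulmx_sym r w sA).
    have -> : dotp (w *m A) r = dotp r r.
      by rewrite war dotpDl dotpZl (dotpC w) rw mulr0 addr0.
    rewrite (dotpC w r) rw => H; rewrite -subr_ge0 in H.
    by apply: le_trans H _; rewrite le_eqVlt; apply/orP; left; apply/eqP; ring.
  set S := dotp r r in qt *; set q := (_ - _) in qt.
  have S0 : 0 <= S by exact: dotp_ge0.
  rewrite eq_le S0 andbT leNgt; apply/negP => Sp.
  have [q0|q0] := lerP q 0.
    by have := qt (-1); rewrite sqrrN expr1n; lra.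
  have := qt (- (S / q)).
  rewrite sqrrN expr2.
  have -> : 2 * - (S / q) * S + S / q * (S / q) * q = - (S * S / q).
    by field; rewrite gt_eqF.
  by rewrite oppr_ge0 leNgt divr_gt0// mulr_gt0.
apply: le_trans (wq v); apply: ler_wpM2r; first exact: dotp_ge0.
apply: ge_inf.
  exists mu => l /= /eigenvalueP[u uA u0].
  by have := wq u; rewrite uA dotpZl ler_pM2r// lt_def dotp_ge0 dotp_eq0 u0.
apply/eigenvalueP; exists w => //.
apply/eqP => w0; move: w1; rewrite w0 (eqP (_ : dotp 0 0 == 0)) ?dotp_eq0//.
by move=> /eqP; rewrite eq_sym oner_eq0.
Qed.

End rayleigh.

(** * First-order expansion inside boxes *)

Section real_lemmas.
Context (R : realType).

Lemma powR_small (beta e : R) : 0 < beta -> 0 < e ->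
  exists2 x0 : R, 0 < x0 & forall x : R, 0 <= x <= x0 -> x `^ beta <= e.
Proof.
move=> b0 e0; exists (e `^ beta^-1); first exact: powR_gt0.
move=> x /andP[x0 xe].
rewrite (_ : e = (e `^ beta^-1) `^ beta).
  by apply: ge0_ler_powR => //; rewrite ?ltW// nnegrE// powR_ge0.
by rewrite -powRrM mulVf ?gt_eqF// powRr1// ltW.
Qed.

(* [h'] is the derivative of [h]; the remainder bound makes up for the lack of
   differentiability at the end points. *)
Lemma hoelder_mvt (h h' : R -> R) (A M beta : R) : 0 < beta -> 0 <= A ->
  (forall t t0 : R, 0 <= t <= 1 -> 0 <= t0 <= 1 ->
    `|h t - h t0 - (t - t0) * h' t0| <= A * (`|t - t0| * `|t - t0| `^ beta)) ->
  (forall t : R, 0 <= t <= 1 -> `|h' t| <= M) -> `|h 1 - h 0| <= M.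
Proof.
move=> b0 A0 hh hM; apply/ler_addgt0Pr => e e0.
have A1 : 0 < A + 1 by rewrite ltr_wpDl.
have [x0 x00 small] := powR_small b0 (divr_gt0 e0 A1).
(* Steps of length 1/N are short enough for each remainder to be at most e / N. *)
pose N := (Num.truncn x0^-1).+1.
have N0 : 0 < N%:R :> R by rewrite ltr0n.
have Nv0 : 0 < (N%:R : R)^-1 by rewrite invr_gt0.
have N1 : 0 <= (N%:R : R)^-1 <= x0.
  by rewrite invr_ge0 ltW//= invf_ple ?posrE// ltW// truncnS_gt.
have step i : (i < N)%N -> `|h (i.+1%:R / N%:R) - h (i%:R / N%:R)| <= (M + e) / N%:R.
  move=> iN.
  have i0 : 0 <= (i%:R : R) / N%:R <= 1.
    by rewrite divr_ge0//= ler_pdivrMr// mul1r ler_nat ltnW.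
  have i1 : 0 <= (i.+1%:R : R) / N%:R <= 1.
    by rewrite divr_ge0//= ler_pdivrMr// mul1r ler_nat.
  have := hh _ _ i1 i0; rewrite -mulrBl -natrB// subSnn mul1r.
  rewrite (gtr0_norm Nv0).
  have : A * (N%:R^-1 * N%:R^-1 `^ beta) <= e / N%:R.
    rewrite mulrCA mulrC ler_pM2r//.
    apply: (@le_trans _ _ (A * (e / (A + 1)))).
      by rewrite ler_wpM2l// small.
    by rewrite mulrCA ger_pMr// ler_pdivrMr// mul1r lerDl.
  have := hM _ i0; move: (h' _) (h (_ / _)) (h (i%:R / _)) => u v w um.
  have uN : `|N%:R^-1 * u| <= M / N%:R.
    by rewrite normrM (gtr0_norm Nv0) mulrC ler_pM2r.
  rewrite mulrDl => H1 H2; have {}H1 := le_trans H2 H1.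
  by rewrite -(subrK (N%:R^-1 * u) (v - w)) (le_trans (ler_normD _ _))// addrC lerD.
rewrite (_ : h 1 - h 0 = \sum_(i < N) (h (i.+1%:R / N%:R) - h (i%:R / N%:R))).
  apply: le_trans (ler_norm_sum _ _ _) _.
  apply: (@le_trans _ _ (\sum_(i < N) (M + e) / N%:R)).
    by apply: ler_sum => i _; exact: step.
  by rewrite sumr_const card_ord -(mulr_natr ((M + e) / N%:R)) divfK ?gt_eqF.
rewrite -(big_mkord xpredT (fun i => h (i.+1%:R / N%:R) - h (i%:R / N%:R))).
by rewrite (telescope_sumr (fun i => h (i%:R / N%:R)))// mul0r divff ?gt_eqF.
Qed.

End real_lemmas.

Section enorm.
Context (R : realType) (m n : nat).
Implicit Types x y : 'M[R]_(m, n).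

Lemma enorm_ge0 x : 0 <= enorm x. Proof. exact: sqrtr_ge0. Qed.

Lemma enormN x : enorm (- x) = enorm x.
Proof.
by congr Num.sqrt; apply: eq_bigr => i _; apply: eq_bigr => j _; rewrite mxE sqrrN.
Qed.

Lemma enormZ a x : enorm (a *: x) = `|a| * enorm x.
Proof.
rewrite /enorm -sqrtr_sqr -sqrtrM ?sqr_ge0//; congr Num.sqrt.
rewrite mulr_sumr; apply: eq_bigr => i _.
by rewrite mulr_sumr; apply: eq_bigr => j _; rewrite mxE exprMn.
Qed.

Lemma enorm_delta i j : enorm (delta_mx i j : 'M[R]_(m, n)) = 1.
Proof.
rewrite /enorm (bigD1 i)//= (bigD1 j)//= mxE !eqxx expr1n.
rewrite !big1 ?addr0 ?sqrtr1// => [k ki|k kj].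
  by rewrite big1// => l _; rewrite mxE (negbTE ki) expr0n.
by rewrite mxE (negbTE kj) andbF expr0n.
Qed.


Lemma entry_le_enorm x i j : `|x i j| <= enorm x.
Proof.
rewrite -sqrtr_sqr ler_wsqrtr// (bigD1 i)//= (bigD1 j)//= -addrA lerDl.
by rewrite addr_ge0// sumr_ge0// => k _; rewrite ?sumr_ge0// => *; rewrite sqr_ge0.
Qed.

Lemma enorm_le x r : 0 <= r -> (forall i j, `|x i j| <= r) ->
  enorm x <= (m * n)%:R * r.
Proof.
move=> r0 xr; rewrite -[leRHS]ger0_norm ?mulr_ge0// -sqrtr_sqr ler_wsqrtr//.
apply: (@le_trans _ _ (\sum_(i < m) \sum_(j < n) r ^+ 2)).
  apply: ler_sum => i _; apply: ler_sum => j _.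
  by rewrite -real_normK ?num_real// ler_pXn2r ?nnegrE.
rewrite !sumr_const !card_ord -mulrnA [(n * m)%N]mulnC exprMn.
rewrite -(mulr_natl (r ^+ 2)) ler_wpM2r ?sqr_ge0//.
by rewrite expr2 -natrM ler_nat; case: (m * n)%N => // k; rewrite leq_pmull.
Qed.

End enorm.

Section taylor.
Context (R : realType) (s d : nat).
Local Notation M := 'M[R]_(s, d).

Definition in_box (c z y : M) := forall i j,
  Num.min (c i j) (z i j) <= y i j <= Num.max (c i j) (z i j).

Lemma nbhs_mx (y : M) (P : set M) (Q : 'I_s -> 'I_d -> set R) :
  (forall i j, nbhs (y i j) (Q i j)) ->
  (forall y' : M, (forall i j, Q i j (y' i j)) -> P y') -> nbhs y P.
Proof. by move=> Qn QP; exists Q. Qed.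

Lemma open_box_interior (X : set M) (c z y : M) :
  (forall y, in_box c z y -> X y) ->
  (forall i j, Num.min (c i j) (z i j) < y i j < Num.max (c i j) (z i j)) ->
  interior X y.
Proof.
move=> XB yb.
apply: (@nbhs_mx y X (fun i j =>
  `]Num.min (c i j) (z i j), Num.max (c i j) (z i j)[%classic)) => [i j|y' y'b].
  by apply: near_in_itvoo; rewrite in_itv/=; exact: yb.
apply: XB => i j; have := y'b i j; rewrite /= in_itv/= => /andP[a1 a2].
by rewrite !ltW.
Qed.

Lemma is_derive_line (F : M -> R) (p v : M) (t df : R) :
  is_derive (p + t *: v) v F df -> is_derive t 1 (fun t => F (p + t *: v)) df.
Proof.
case=> dF <-.
have E : (fun h : R => h^-1 *: (((fun t => F (p + t *: v)) \o shift t) (h *: 1) -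
    F (p + t *: v))) =
  (fun h => h^-1 *: ((F \o shift (p + t *: v)) (h *: v) - F (p + t *: v))).
  apply/funext => h /=; congr (_ *: (F _ - _)).
  by rewrite [h *: 1]mulr1 scalerDl addrCA.
split; first by rewrite /derivable E.
by rewrite /derive E.
Qed.


Context (X : set M) (g : partial_index s d -> M -> R) (B beta : R) (c : M).
Hypotheses (B0 : 0 <= B) (beta0 : 0 < beta).
Hypothesis X_box : forall z : M, X z -> forall y : M, in_box c z y -> X y.
Hypothesis g_der : forall (a : partial_index s d) j l x, a j = None ->
  interior X x -> is_derive x (delta_mx j l) (g a) (g (add_partial a j l) x).
Hypothesis g_hoelder : forall a x y, X x -> X y ->
  `|g a x - g a y| <= B * enorm (x - y) `^ beta.

(** Mean value theorem along the segment: the partial derivative at the intermediate point differs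
    from the one at p by the Hoelder bound. The strict inequalities put the whole segment in the
    interior of [X], where [g_der] applies. *)
Lemma taylor_open (a : partial_index s d) j l (z p : M) (t : R) : X z -> a j = None ->
  (forall i k, Num.min (c i k) (z i k) < p i k < Num.max (c i k) (z i k)) ->
  (forall i k, Num.min (c i k) (z i k) < (p + t *: delta_mx j l) i k
     < Num.max (c i k) (z i k)) ->
  `|g a (p + t *: delta_mx j l) - g a p - t * g (add_partial a j l) p|
    <= B * (`|t| * `|t| `^ beta).
Proof.
move=> Xz aj pin qin; set e := delta_mx j l in qin *.
have seg (u : R) : 0 <= u <= 1 -> interior X (p + (u * t) *: e).
  move=> /andP[u0 u1]; apply: (open_box_interior (X_box Xz)) => i k.
  have := pin i k; have := qin i k.
  have -> : (p + t *: e) i k = p i k + t * e i k by rewrite mxE [X in _ + X]mxE.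
  have -> : (p + (u * t) *: e) i k = p i k + u * (t * e i k).
    by rewrite mxE [X in _ + X]mxE mulrA.
  move: (p i k) (t * e i k) (Num.min _ _) (Num.max _ _) => P T lo hi.
  move=> /andP[a1 a2] /andP[a3 a4].
  have [->|un0] := eqVneq u 0; first by rewrite mul0r addr0 a3 a4.
  have up : 0 < u by rewrite lt_def un0.
  have u1' : 0 <= 1 - u by rewrite subr_ge0.
  have b1 : 0 < u * (P + T - lo) by rewrite mulr_gt0// subr_gt0.
  have b2 : 0 < u * (hi - (P + T)) by rewrite mulr_gt0// subr_gt0.
  have b3 : 0 <= (1 - u) * (P - lo) by rewrite mulr_ge0// subr_ge0 ltW.
  have b4 : 0 <= (1 - u) * (hi - P) by rewrite mulr_ge0// subr_ge0 ltW.
  by apply/andP; split; lra.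
pose h (u : R) := g a (p + (u * t) *: e) - u * (t * g (add_partial a j l) p).
pose dh (u : R) :=
  t * (g (add_partial a j l) (p + (u * t) *: e) - g (add_partial a j l) p).
have hder (u : R) : 0 <= u <= 1 -> is_derive u 1 h (dh u).
  move=> u01.
  have D1 : is_derive (u * t) 1 (fun x => g a (p + x *: e))
      (g (add_partial a j l) (p + (u * t) *: e)).
    by apply: is_derive_line; apply: g_der => //; exact: seg.
  have D2 : is_derive u 1 (fun u : R => u * t) t.
    apply: is_derive_eq.
    by rewrite /GRing.scale /= mulr0 add0r mulr1.
  have D3 : is_derive u 1 (fun u : R => u * (t * g (add_partial a j l) p))
      (t * g (add_partial a j l) p).
    apply: is_derive_eq.
    by rewrite /GRing.scale /= mulr0 add0r mulr1.
  have D4 := @is_derive1_comp _ (fun x => g a (p + x *: e)) (fun u => u * t) u _ _ D1 D2.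
  have -> : dh u = g (add_partial a j l) (p + (u * t) *: e) * t -
      t * g (add_partial a j l) p by rewrite /dh mulrBr mulrC.
  exact: (is_deriveB D4 D3).
have [w /=||u u01] := @MVT_segment R h dh 0 1 ler01.
- by rewrite in_itv/= => /andP[w0 w1]; apply: hder; rewrite !ltW.
- apply: derivable_within_continuous => w; rewrite in_itv/= => w01.
  exact: (@ex_derive _ _ _ _ _ _ _ (hder w w01)).
rewrite in_itv/= in u01; rewrite subr0 mulr1 /h mul1r !mul0r scale0r addr0 subr0 mul1r.
rewrite addrAC => ->; rewrite /dh normrM mulrCA ler_wpM2l//.
have Xp : X p.
  by have := seg 0; rewrite mul0r scale0r addr0 lexx ler01 => /(_ isT)/interior_subset.
have Xu : X (p + (u * t) *: e) by apply: interior_subset; apply: seg.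
apply: le_trans (g_hoelder (add_partial a j l) Xu Xp) _.
rewrite ler_wpM2l// addrAC subrr add0r enormZ enorm_delta mulr1.
apply: ge0_ler_powR; rewrite ?nnegrE ?normr_ge0//; first exact: ltW.
case/andP: u01 => u0 u1.
by rewrite normrM (ger0_norm u0) ler_piMl.
Qed.

(** The shift by 2 keeps [eps 0] strictly below 1. *)
Let eps n : R := n.+2%:R^-1.

Let eps01 n : 0 < eps n < 1.
Proof.
by rewrite /eps invr_gt0 ltr0n/= invf_lt1 ?ltr0n// ltr1n.
Qed.

Let cvg_eps : eps n @[n --> \oo] --> (0 : R).
Proof.
have := @cvg_harmonic R; rewrite -(cvg_shiftS (harmonic : nat -> R)).
exact.
Qed.

Let hoelder_cvg (a : partial_index s d) (w : nat -> M) (p : M) (K : R) :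
  X p -> (forall n, X (w n)) -> (forall n, enorm (p - w n) <= eps n * K) ->
  g a (w n) @[n --> \oo] --> g a p.
Proof.
move=> Xp Xw wK; apply/cvgrPdist_le => e e0.
have B1 : 0 < B + 1 by rewrite ltr_wpDl.
have [x0 x00 small] := powR_small beta0 (divr_gt0 e0 B1).
have K0 : 0 <= K.
  have [e1 _] := andP (eps01 0).
  by rewrite -(pmulr_rge0 _ e1) (le_trans (enorm_ge0 _) (wK 0)).
have : \forall n \near \oo, eps n * K <= x0.
  have c0 : eps n * K @[n --> \oo] --> 0 * K.
    by apply: cvgM; [exact: cvg_eps|exact: cvg_cst].
  rewrite mul0r in c0; exact: (cvgr_le _ c0).
apply: filterS => n nx0.
apply: le_trans (g_hoelder a Xp (Xw n)) _.
apply: (@le_trans _ _ (B * (e / (B + 1)))).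
  by rewrite ler_wpM2l// small// enorm_ge0/= (le_trans (wK n)).
by rewrite mulrCA ger_pMr// ler_pdivrMr// mul1r lerDl.
Qed.

(* Since no coordinate of z equals that of c, the box is the closure of its
   interior, and the bound of [taylor_open] passes to the limit. *)
Lemma taylor_box (a : partial_index s d) j l (z p : M) (t : R) :
  X z -> (forall i k, z i k != c i k) -> a j = None ->
  in_box c z p -> in_box c z (p + t *: delta_mx j l) ->
  `|g a (p + t *: delta_mx j l) - g a p - t * g (add_partial a j l) p|
    <= B * (`|t| * `|t| `^ beta).
Proof.
move=> Xz zc aj pb qb; set e := delta_mx j l in qb *.
(* [sh n] contracts the box towards its centre [m] by the factor 1 - eps n. This puts every point
   strictly inside and scales the step t by the same factor. *)
pose m : M := 2^-1 *: (c + z).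
pose sh n (p : M) := p + eps n *: (m - p).
have mb i k : Num.min (c i k) (z i k) < m i k < Num.max (c i k) (z i k).
  rewrite !mxE; have := zc i k.
  by case: (ltgtP (c i k) (z i k)) => [h|h|->]; rewrite ?eqxx// => _;
    apply/andP; split; lra.
have shb n p' : in_box c z p' -> forall i k,
    Num.min (c i k) (z i k) < sh n p' i k < Num.max (c i k) (z i k).
  move=> p'b i k; have := p'b i k; have := mb i k; have := eps01 n.
  have -> : sh n p' i k = p' i k + eps n * (m i k - p' i k) by rewrite !mxE.
  move: (eps n) (p' i k) (m i k) (Num.min _ _) (Num.max _ _) => E P Q lo hi.
  move=> /andP[E0 E1] /andP[a1 a2] /andP[a3 a4].
  have b1 : 0 < E * (Q - lo) by rewrite mulr_gt0// subr_gt0.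
  have b2 : 0 < E * (hi - Q) by rewrite mulr_gt0// subr_gt0.
  have b3 : 0 <= (1 - E) * (P - lo) by rewrite mulr_ge0// subr_ge0// ltW.
  have b4 : 0 <= (1 - E) * (hi - P) by rewrite mulr_ge0// subr_ge0// ltW.
  by apply/andP; split; lra.
have shX n p' : in_box c z p' -> X (sh n p').
  move=> p'b; apply: interior_subset.
  exact: (open_box_interior (X_box Xz) (shb n p' p'b)).
have she n : sh n (p + t *: e) = sh n p + ((1 - eps n) * t) *: e.
  by apply/matrixP => i k; rewrite /sh !mxE; ring.
have cv p' b : in_box c z p' -> g b (sh n p') @[n --> \oo] --> g b p'.
  move=> p'b; apply: (@hoelder_cvg _ _ _ (enorm (m - p'))).
  - exact: X_box p'b.
  - by move=> n; exact: shX.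
  - move=> n; rewrite /sh opprD addrA subrr sub0r enormN enormZ ger0_norm//.
    by case/andP: (eps01 n) => /ltW.
have cve : (1 - eps n) * t @[n --> \oo] --> t.
  rewrite (_ : nbhs t = nbhs ((1 - 0) * t)); last by rewrite subr0 mul1r.
  by apply: cvgM; [apply: cvgB; [exact: cvg_cst|exact: cvg_eps]|exact: cvg_cst].
have lim : `|g a (sh n (p + t *: e)) - g a (sh n p) -
      (1 - eps n) * t * g (add_partial a j l) (sh n p)| @[n --> \oo] -->
    `|g a (p + t *: e) - g a p - t * g (add_partial a j l) p|.
  apply: cvg_norm; apply: cvgB; first by apply: cvgB; exact: cv.
  by apply: cvgM => //; exact: cv.
apply: (cvgr_to_le lim); near=> n.
have := shb n _ qb; rewrite she => qn.
apply: le_trans (taylor_open Xz aj (shb n p pb) qn) _.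
have tn : `|(1 - eps n) * t| <= `|t|.
  have /andP[/ltW e0 /ltW e1] := eps01 n.
  by rewrite normrM ger0_norm ?subr_ge0// ler_piMl// gerBl.
rewrite ler_wpM2l// ler_pM// ?powR_ge0//.
by apply: ge0_ler_powR; rewrite ?nnegrE//; exact: ltW.
Unshelve. all: by end_near. Qed.

End taylor.

(** * Mixed differences *)

Section setrow.
Context (R : realType) (s d : nat).
Local Notation M := 'M[R]_(s, d).

Definition setrow (p : M) (j : 'I_s) (v : 'rV[R]_d) : M :=
  \matrix_(i, l) if i == j then v 0 l else p i l.

Lemma setrowC (p : M) i j u v : i != j ->
  setrow (setrow p i u) j v = setrow (setrow p j v) i u.
Proof.
move=> ij; apply/matrixP => k l; rewrite !mxE.
by case: (k =P j) => [->|//]; rewrite eq_sym (negbTE ij).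
Qed.

Lemma row_setrow (p : M) i j v : row i (setrow p j v) = if i == j then v else row i p.
Proof. by apply/rowP => l; rewrite !mxE; case: ifP => //; rewrite !mxE. Qed.

Lemma setrowD (p : M) j v t l :
  setrow p j (v + t *: delta_mx 0 l) = setrow p j v + t *: delta_mx j l.
Proof.
apply/matrixP => i k; rewrite !mxE eqxx /=; case: ifP => ij //=.
by rewrite mulr0 addr0.
Qed.

End setrow.

(* The point of the interval from c to p closest to q.  As it also lies between
   c and q, the way from p to q through it leaves neither box. *)
Definition clamp (R : realDomainType) (c p q : R) :=
  Num.max (Num.min c p) (Num.min (Num.max c p) q).

Lemma clampP (R : realFieldType) (c p q : R) :
  [/\ Num.min c p <= clamp c p q <= Num.max c p,
      Num.min c q <= clamp c p q <= Num.max c q &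
      Num.min p q <= clamp c p q <= Num.max p q].
Proof.
rewrite /clamp; have [cp|cp] := leP c p; have [pq|pq] := leP p q;
  have [cq|cq] := leP c q;
  rewrite ?(max_r cp) ?(max_l (ltW cp)) ?(max_r (ltW cp)) ?(max_r pq)
    ?(max_r cq) ?(max_l (ltW pq)) ?(max_l (ltW cq)) ?(min_r (ltW cq))
    ?(min_l cq) ?lexx; by split; apply/andP; split; lra.
Qed.

Section mixed.
Context (R : realType) (s d : nat).
Local Notation M := 'M[R]_(s, d).
Context (X : set M) (g : partial_index s d -> M -> R) (B beta : R) (c : M).
Hypotheses (B0 : 0 <= B) (beta0 : 0 < beta).
Hypothesis X_box : forall z : M, X z -> forall y : M, in_box c z y -> X y.
Hypothesis g_der : forall (a : partial_index s d) j l x, a j = None ->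
  interior X x -> is_derive x (delta_mx j l) (g a) (g (add_partial a j l) x).
Hypothesis g_hoelder : forall a x y, X x -> X y ->
  `|g a x - g a y| <= B * enorm (x - y) `^ beta.
Context (Z : 'I_s -> set 'rV[R]_d).
Hypothesis ZX : forall z : M, (forall j, Z j (row j z)) ->
  X z /\ forall i k, z i k != c i k.

Definition row_box j (z v : 'rV[R]_d) := forall k,
  Num.min (c j k) (z 0 k) <= v 0 k <= Num.max (c j k) (z 0 k).

(** Rows reachable inside the boxes from row j of [c] to the points of [Z j]. Rows taken from the
    different hulls can be combined freely without leaving [X], which permits changing one block at
    a time. *)
Definition hull j : set 'rV[R]_d := [set v | exists2 z, Z j z & row_box j z v].

Lemma row_box_refl j z : row_box j z z.
Proof. by move=> k; rewrite ge_min le_max lexx !orbT. Qed.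

Lemma hull_in (p : M) : (forall j, hull j (row j p)) -> X p.
Proof.
move=> ph.
have /choice[z zP] j : exists z, Z j z /\ row_box j z (row j p).
  by have [z Zz zb] := ph j; exists z.
pose zz : M := \matrix_(j, k) z j 0 k.
have rz j : row j zz = z j by apply/rowP => k; rewrite !mxE.
have [Xz _] : X zz /\ forall i k, zz i k != c i k.
  by apply: ZX => j; rewrite rz; case: (zP j).
apply: X_box Xz _ _ => j k; have := (zP j).2 k; by rewrite !mxE.
Qed.

Lemma taylor_row (a : partial_index s d) j l (p : M) (z v : 'rV[R]_d) (t : R) :
  a j = None -> (forall i, i != j -> hull i (row i p)) -> Z j z ->
  row_box j z v -> row_box j z (v + t *: delta_mx 0 l) ->
  `|g a (setrow p j (v + t *: delta_mx 0 l)) - g a (setrow p j v)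
    - t * g (add_partial a j l) (setrow p j v)| <= B * (`|t| * `|t| `^ beta).
Proof.
move=> aj ph Zz vb vb'.
have /choice[zs zP] i : exists z, Z i z /\
    row_box i z (row i (setrow p j v)) /\
    row_box i z (row i (setrow p j (v + t *: delta_mx 0 l))).
  rewrite !row_setrow; have [->|ij] := eqVneq i j; first by exists z.
  by have [w Zw wb] := ph i ij; exists w.
pose zz : M := \matrix_(j, k) zs j 0 k.
have rz i : row i zz = zs i by apply/rowP => k; rewrite !mxE.
have [Xz zc] : X zz /\ forall i k, zz i k != c i k.
  by apply: ZX => i; rewrite rz; case: (zP i).
rewrite setrowD; apply: (taylor_box B0 beta0 X_box g_der g_hoelder Xz) => //.
  by move=> i k; have := (zP i).2.1 k; rewrite !mxE.
by move=> i k; have := (zP i).2.2 k; rewrite setrowD !mxE.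
Qed.

Context (I : finType) (om : 'I_s -> I -> R) (y : 'I_s -> I -> 'rV[R]_d).

(* If the weights om j sum to 0, this is an average of mixed differences of F in
   the blocks js; [lin] below is its leading term for F = g a. *)
Fixpoint lam (js : seq 'I_s) (F : M -> R) (p : M) : R :=
  if js is j :: js' then \sum_i om j i * lam js' F (setrow p j (y j i)) else F p.

Hypothesis yZ : forall j i, om j i != 0 -> Z j (y j i).

(** The expansion in block j holds for each choice of rows in the other blocks, and averaging over
    block k costs the factor \sum_i |om k i|. Rows of weight zero are dropped because only the
    others are known to lie in [Z]. *)
Lemma lam_taylor js (a : partial_index s d) j l (p : M) (z v : 'rV[R]_d) (t : R) :
  j \notin js -> a j = None -> (forall i, i != j -> hull i (row i p)) -> Z j z ->
  row_box j z v -> row_box j z (v + t *: delta_mx 0 l) ->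
  `|lam js (g a) (setrow p j (v + t *: delta_mx 0 l)) - lam js (g a) (setrow p j v)
    - t * lam js (g (add_partial a j l)) (setrow p j v)|
  <= (\prod_(k <- js) \sum_i `|om k i|) * (B * (`|t| * `|t| `^ beta)).
Proof.
move=> + aj + Zz vb vb'; elim: js p => [|k js ih] p /=.
  by move=> _ ph; rewrite big_nil mul1r; exact: (taylor_row _ _ Zz).
rewrite inE negb_or => /andP[jk jjs] ph.
rewrite big_cons -mulrA mulr_suml mulr_sumr -!sumrB.
apply: le_trans (ler_norm_sum _ _ _) _; apply: ler_sum => i _.
rewrite mulrCA -!mulrBr normrM.
have [->|oi] := eqVneq (om k i) 0; first by rewrite normr0 !mul0r.
rewrite ler_wpM2l// !(setrowC p (i := j) (j := k))//.
apply: ih => // i' i'j; rewrite row_setrow; case: ifP => [/eqP->|_]; last exact: ph.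
exists (y k i); first exact: yZ.
exact: row_box_refl.
Qed.

Context (xs : M) (rho : R) (delta : 'I_s -> R).
Hypotheses (Xxs : X xs) (rho0 : 0 <= rho) (delta0 : forall j, 0 <= delta j).
Hypothesis om0 : forall j, \sum_i om j i = 0.
Hypothesis y_near : forall j i, om j i != 0 ->
  forall l, `|y j i 0 l - xs j l| <= rho.
Hypothesis y_close : forall j i i', om j i != 0 -> om j i' != 0 ->
  forall l, `|y j i 0 l - y j i' 0 l| <= delta j.

Definition moment j l := \sum_i om j i * y j i 0 l.

Fixpoint lin (js : seq 'I_s) (a : partial_index s d) : R :=
  if js is j :: js' then \sum_l moment j l * lin js' (add_partial a j l)
  else g a xs.

Definition row_near j (v : 'rV[R]_d) := forall l, `|v 0 l - xs j l| <= rho.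

(** Coordinates are exchanged one by one; the constraints on a row are coordinatewise, so every
    intermediate row satisfies them as soon as both ends do. *)
Lemma box_path j (z : 'rV[R]_d) (H : 'rV[R]_d -> R) (E : R) :
  (forall v t l, row_box j z v -> row_box j z (v + t *: delta_mx 0 l) ->
    row_near j v -> row_near j (v + t *: delta_mx 0 l) ->
    `|H (v + t *: delta_mx 0 l) - H v| <= `|t| * E) ->
  forall w w', row_box j z w -> row_box j z w' -> row_near j w -> row_near j w' ->
  `|H w - H w'| <= (\sum_l `|w 0 l - w' 0 l|) * E.
Proof.
move=> HE w w' wb w'b wn w'n.
pose wk k : 'rV[R]_d := \row_l if (l < k)%N then w 0 l else w' 0 l.
have wkS (k : 'I_d) : wk k.+1 = wk k + (w 0 k - w' 0 k) *: delta_mx 0 k.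
  apply/rowP => l; rewrite !mxE /= ltnS leq_eqVlt.
  have [->|lk] := eqVneq l k; first by rewrite eqxx ltnn/= mulr1 addrC subrK.
  by rewrite -val_eqE /= in lk; rewrite (negbTE lk) mulr0 addr0.
have wkb k : row_box j z (wk k) by move=> l; rewrite mxE; case: ifP.
have wkn k : row_near j (wk k) by move=> l; rewrite mxE; case: ifP.
have -> : H w - H w' = \sum_(k < d) (H (wk k.+1) - H (wk k)).
  rewrite -(big_mkord xpredT (fun k => H (wk k.+1) - H (wk k))).
  rewrite (telescope_sumr (fun k => H (wk k)))//; congr (H _ - H _).
    by apply/rowP => l; rewrite mxE ltn_ord.
  by apply/rowP => l; rewrite mxE.
apply: le_trans (ler_norm_sum _ _ _) _; rewrite mulr_suml; apply: ler_sum => k _.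
by rewrite wkS; apply: HE => //; rewrite -wkS.
Qed.

(** Induction on the blocks. After subtraction of the linear part in block j, the derivative of what
    remains is the error of the induction hypothesis for [add_partial a j l]. The remainder is thus
    nearly constant on the rows [y j i], and its constant part is killed by weights of sum 0. Each
    block contributes a factor [delta j]; the power of [rho] comes from the Hoelder bound once all
    blocks have been differentiated. *)
Lemma lam_lin js (a : partial_index s d) (p : M) :
  uniq js -> (forall j, j \in js -> a j = None) ->
  (forall j, hull j (row j p)) -> (forall j, row_near j (row j p)) ->
  `|lam js (g a) p - lin js a| <=
  B * ((s * d)%:R * rho) `^ beta *
    \prod_(j <- js) ((\sum_i `|om j i|) * (2 * d%:R * delta j)).
Proof.
elim: js a p => [|j js ih] a p /=.
  move=> _ _ ph pn; rewrite big_nil mulr1.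
  apply: le_trans (g_hoelder _ (hull_in ph) Xxs) _; rewrite ler_wpM2l//.
  apply: ge0_ler_powR; rewrite ?nnegrE ?enorm_ge0 ?mulr_ge0//; first exact: ltW.
  by apply: enorm_le => // i l; have := pn i l; rewrite !mxE.
move=> /andP[jjs ujs] an ph pn.
pose E := B * ((s * d)%:R * rho) `^ beta *
  \prod_(k <- js) ((\sum_i `|om k i|) * (2 * d%:R * delta k)).
have aj : a j = None by apply: an; rewrite mem_head.
pose mt l := lin js (add_partial a j l).
pose H v := lam js (g a) (setrow p j v) - \sum_l v 0 l * mt l.
have hullp v : (forall i, i != j -> hull i (row i (setrow p j v))).
  by move=> i ij; rewrite row_setrow (negbTE ij).
have Hseg z v t l : Z j z -> row_box j z v -> row_box j z (v + t *: delta_mx 0 l) ->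
    row_near j v -> row_near j (v + t *: delta_mx 0 l) ->
    `|H (v + t *: delta_mx 0 l) - H v| <= `|t| * E.
  move=> Zz vb v'b vn v'n.
  pose h u := H (v + (u * t) *: delta_mx 0 l).
  pose h' u := t * (lam js (g (add_partial a j l))
    (setrow p j (v + (u * t) *: delta_mx 0 l)) - mt l).
  have seg (u : R) : 0 <= u <= 1 -> row_box j z (v + (u * t) *: delta_mx 0 l).
    move=> /andP[u0 u1] k; have := vb k; have := v'b k.
    rewrite !mxE -mulrA.
    move: (v 0 k) (t * _) (Num.min _ _) (Num.max _ _) => P T lo hi.
    move=> /andP[a1 a2] /andP[a3 a4].
    have b1 : 0 <= u * (P + T - lo) by rewrite mulr_ge0// subr_ge0.
    have b2 : 0 <= u * (hi - (P + T)) by rewrite mulr_ge0// subr_ge0.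
    have b3 : 0 <= (1 - u) * (P - lo) by rewrite mulr_ge0// subr_ge0.
    have b4 : 0 <= (1 - u) * (hi - P) by rewrite mulr_ge0// subr_ge0.
    by apply/andP; split; lra.
  have segn (u : R) : 0 <= u <= 1 -> row_near j (v + (u * t) *: delta_mx 0 l).
    move=> /andP[u0 u1] k; have := vn k; have := v'n k.
    rewrite !mxE -mulrA.
    move: (v 0 k) (t * _) (xs j k) => P T x0.
    rewrite !ler_norml => /andP[a1 a2] /andP[a3 a4].
    have b1 : 0 <= u * (P + T - x0 + rho) by rewrite mulr_ge0//; lra.
    have b2 : 0 <= u * (rho - (P + T - x0)) by rewrite mulr_ge0//; lra.
    have b3 : 0 <= (1 - u) * (P - x0 + rho) by rewrite mulr_ge0//; lra.
    have b4 : 0 <= (1 - u) * (rho - (P - x0)) by rewrite mulr_ge0//; lra.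
    by apply/andP; split; lra.
  have -> : H (v + t *: delta_mx 0 l) - H v = h 1 - h 0.
    by rewrite /h mul1r mul0r scale0r addr0.
  apply: (@hoelder_mvt _ h h' ((\prod_(k <- js) \sum_i `|om k i|) *
      (B * (`|t| * `|t| `^ beta))) _ _ beta0) => [|u u0 uu uu0|u uu].
  - rewrite mulr_ge0//; last by rewrite mulr_ge0// mulr_ge0// powR_ge0.
    by apply: prodr_ge0 => k _; apply: sumr_ge0.
  - have := @lam_taylor js a j l p z (v + (u0 * t) *: delta_mx 0 l)
      ((u - u0) * t) jjs aj.
    have E1 : v + (u0 * t) *: delta_mx 0 l + ((u - u0) * t) *: delta_mx 0 l =
        v + (u * t) *: delta_mx 0 l.
      by rewrite -addrA -scalerDl; congr (_ + _ *: _); ring.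
    rewrite E1 => /(_ _ Zz (seg _ uu0) (seg _ uu)) T.
    have {}T := T (fun i _ => ph i).
    apply: le_trans (le_trans _ T) _; last first.
      rewrite -!mulrA ler_wpM2l//; first by apply: prodr_ge0 => k _; apply: sumr_ge0.
      rewrite ler_wpM2l// normrM powRM//.
      rewrite le_eqVlt; apply/orP; left; apply/eqP; ring.
    rewrite le_eqVlt; apply/orP; left; apply/eqP; congr `|_|.
    rewrite /h /h' /H.
    have Hs (u' : R) : \sum_l0 (v + (u' * t) *: delta_mx 0 l) 0 l0 * mt l0 =
        \sum_l0 v 0 l0 * mt l0 + u' * t * mt l.
      under eq_bigr do rewrite !mxE mulrDl.
      rewrite big_split/=; congr (_ + _).
      rewrite (bigD1 l)//= eqxx mulr1 big1 ?addr0// => k kl.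
      by rewrite (negbTE kl) mulr0 mul0r.
    rewrite !Hs.
    by ring.
  - rewrite /h' normrM ler_wpM2l//; apply: ih => //.
    + move=> k kjs; rewrite ffunE; case: (k =P j) => [kj|_].
        by rewrite -kj kjs in jjs.
      by apply: an; rewrite inE kjs orbT.
    + move=> k; rewrite row_setrow; case: ifP => [/eqP->|_]; last exact: ph.
      by exists z => //; exact: seg.
    + move=> k; rewrite row_setrow; case: ifP => [/eqP->|_]; last exact: pn.
      exact: segn.
have E0 : 0 <= E.
  rewrite mulr_ge0//; first by rewrite mulr_ge0// powR_ge0.
  by apply: prodr_ge0 => k _; rewrite mulr_ge0 ?sumr_ge0// mulr_ge0.
have Hpair i i' : om j i != 0 -> om j i' != 0 ->
    `|H (y j i) - H (y j i')| <= 2 * d%:R * delta j * E.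
  move=> oi oi'.
  (* A direct path from [y j i] to [y j i'] may leave the two boxes. The detour through [md] stays
     in the first box up to [md] and in the second one after it; each half costs d * delta j, whence
     the factor 2 * d. *)
  pose md : 'rV[R]_d := \row_k clamp (c j k) (y j i 0 k) (y j i' 0 k).
  have mdP k : [/\ Num.min (c j k) (y j i 0 k) <= md 0 k <=
        Num.max (c j k) (y j i 0 k),
      Num.min (c j k) (y j i' 0 k) <= md 0 k <= Num.max (c j k) (y j i' 0 k) &
      Num.min (y j i 0 k) (y j i' 0 k) <= md 0 k <=
        Num.max (y j i 0 k) (y j i' 0 k)].
    by rewrite mxE; exact: clampP.
  have mdb : row_box j (y j i) md by move=> k; have [] := mdP k.
  have mdb' : row_box j (y j i') md by move=> k; have [] := mdP k.
  have between (k : 'I_d) : `|y j i 0 k - md 0 k| <= delta j /\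
      `|md 0 k - y j i' 0 k| <= delta j.
    have [_ _] := mdP k; have := y_close oi oi' k.
    move: (md 0 k) (y j i 0 k) (y j i' 0 k) => m P Q.
    by case: (leP P Q) => ?; rewrite !ler_norml => /andP[? ?] /andP[? ?];
      split; apply/andP; split; lra.
  have mdn : row_near j md.
    move=> k; have [_ _] := mdP k; have := y_near oi k; have := y_near oi' k.
    move: (md 0 k) (y j i 0 k) (y j i' 0 k) (xs j k) => m P Q x0.
    by case: (leP P Q) => ?; rewrite !ler_norml => /andP[? ?] /andP[? ?] /andP[? ?];
      apply/andP; split; lra.
  rewrite -(subrKA (H md)); apply: le_trans (ler_normD _ _) _.
  have -> : 2 * d%:R * delta j * E = d%:R * delta j * E + d%:R * delta j * E by ring.
  have bound (w w' : 'rV[R]_d) : (forall k, `|w 0 k - w' 0 k| <= delta j) ->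
      (\sum_k `|w 0 k - w' 0 k|) * E <= d%:R * delta j * E.
    move=> ww; rewrite ler_wpM2r//.
    apply: (@le_trans _ _ (\sum_(k < d) delta j)); first by apply: ler_sum.
    by rewrite sumr_const card_ord mulr_natl.
  apply: lerD.
    apply: le_trans (bound _ _ (fun k => (between k).1)).
    apply: (box_path (z := y j i)) => //; last exact: y_near.
    - by move=> v t l; apply: Hseg; exact: yZ.
    - exact: row_box_refl.
  apply: le_trans (bound _ _ (fun k => (between k).2)).
  apply: (box_path (z := y j i')) => //; last exact: y_near.
  - by move=> v t l; apply: Hseg; exact: yZ.
  - exact: row_box_refl.
have -> : \sum_i om j i * lam js (g a) (setrow p j (y j i)) -
    \sum_l moment j l * lin js (add_partial a j l) = \sum_i om j i * H (y j i).
  rewrite /H; under [RHS]eq_bigr do rewrite mulrBr mulr_sumr.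
  rewrite sumrB; congr (_ - _); rewrite exchange_big/=; apply: eq_bigr => l _.
  by rewrite /moment mulr_suml; apply: eq_bigr => i _; rewrite mulrA.
rewrite big_cons mulrCA -/E.
have [i0 oi0|om_eq0] := pickP (fun i => om j i != 0); last first.
  rewrite !big1 ?mul0r ?normr0// => i _; have /negbFE/eqP-> := om_eq0 i.
    by rewrite normr0.
  by rewrite mul0r.
(* The weights sum to 0, so only differences of [H] matter. *)
have -> : \sum_i om j i * H (y j i) = \sum_i om j i * (H (y j i) - H (y j i0)).
  under [RHS]eq_bigr do rewrite mulrBr.
  by rewrite sumrB -mulr_suml om0 mul0r subr0.
apply: le_trans (ler_norm_sum _ _ _) _.
rewrite -!mulrA mulr_suml; apply: ler_sum => i _; rewrite normrM.
have [->|oi] := eqVneq (om j i) 0; first by rewrite normr0 !mul0r.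
by rewrite ler_wpM2l//; apply: le_trans (Hpair i i0 oi oi0) _; rewrite !mulrA.
Qed.

End mixed.

(** * Multilinear sums *)

Section nest.
Context (R : realFieldType) (s : nat) (T : finType).
Local Notation Z := {ffun 'I_s -> T}.
Implicit Types (z : Z) (F G : Z -> R) (w : 'I_s -> T -> R) (js : seq 'I_s).

Definition upd z (j : 'I_s) (i : T) : Z := [ffun k => if k == j then i else z k].

Lemma updC z j k i l : j != k -> upd (upd z j i) k l = upd (upd z k l) j i.
Proof.
move=> jk; apply/ffunP => h; rewrite !ffunE.
by case: (h =P k) => [->|//]; rewrite eq_sym (negbTE jk).
Qed.

(** Iterated form of a weighted sum over several coordinates. [lam], [lin] and [tensor] recurse over
    the blocks and are compared with it block by block; [nest_enum] then flattens it. *)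
Fixpoint nest js w F z : R :=
  if js is j :: js' then \sum_i w j i * nest js' w F (upd z j i) else F z.

Lemma nest_upd js w F j i z : j \notin js ->
  nest js w (fun z => F (upd z j i)) z = nest js w F (upd z j i).
Proof.
elim: js z => [//|k js ih] z /=; rewrite inE negb_or => /andP[jk jjs].
by apply: eq_bigr => l _; rewrite ih// updC// eq_sym.
Qed.

Lemma nest_lin (J : finType) (c : J -> R) js w (F : J -> Z -> R) z :
  nest js w (fun z => \sum_i c i * F i z) z = \sum_i c i * nest js w (F i) z.
Proof.
elim: js z => [//|k js ih] z /=.
under eq_bigr do rewrite ih mulr_sumr.
rewrite exchange_big/=; apply: eq_bigr => i _; rewrite mulr_sumr.
by apply: eq_bigr => l _; rewrite mulrCA.
Qed.

Lemma nest_ext js w w' F G z :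
  (forall j i, j \in js -> w j i = w' j i) ->
  (forall z', (forall k, k \notin js -> z' k = z k) -> F z' = G z') ->
  nest js w F z = nest js w' G z.
Proof.
elim: js z => [|j js ih] z ww FG /=; first by apply: FG.
apply: eq_bigr => i _; rewrite ww ?mem_head//; congr (_ * _); apply: ih.
  by move=> k l kjs; rewrite ww// inE kjs orbT.
move=> z' z'E; apply: FG => k; rewrite inE negb_or => /andP[kj kjs].
by rewrite z'E// ffunE (negbTE kj).
Qed.

Lemma nest_le js w F G z : (forall j i, 0 <= w j i) ->
  (forall z, F z <= G z) -> nest js w F z <= nest js w G z.
Proof.
move=> w0 FG; elim: js z => [|j js ih] z //=.
by apply: ler_sum => i _; rewrite ler_wpM2l.
Qed.

Lemma nest_flat js w F z : uniq js ->
  nest js w F z = \sum_(z' : Z | [forall k, (k \notin js) ==> (z' k == z k)])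
    (\prod_(j <- js) w j (z' j)) * F z'.
Proof.
elim: js z => [|j js ih] z /= => [_|/andP[jjs ujs]].
  rewrite (big_pred1 z) ?big_nil ?mul1r// => z'.
  apply/forallP/eqP => [zz|->//].
  by apply/ffunP => k; exact/eqP/zz.
rewrite (partition_big (fun z' : Z => z' j) predT)//=.
apply: eq_bigr => i _; rewrite ih// mulr_sumr; apply: eq_big => z'.
  apply/forallP/andP => [h|[/forallP h /eqP zj] k].
    split; last by have := h j; rewrite jjs ffunE eqxx.
    apply/forallP => k; apply/implyP; rewrite inE negb_or => /andP[kj kjs].
    by have := h k; rewrite kjs ffunE (negbTE kj).
  apply/implyP => kjs; rewrite ffunE; case: (k =P j) => [->|/eqP kj]; first exact/eqP.
  by have := h k; rewrite inE negb_or kj kjs.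
move=> h; rewrite big_cons !mulrA; congr (_ * _ * _).
by have /forallP/(_ j) := h; rewrite jjs ffunE eqxx => /eqP ->.
Qed.

Lemma nest_enum w F z :
  nest (enum 'I_s) w F z = \sum_(z' : Z) (\prod_j w j (z' j)) * F z'.
Proof.
rewrite nest_flat ?enum_uniq//; apply: eq_big => [z'|z' _].
  by apply/forallP => k; rewrite mem_enum.
by rewrite big_enum.
Qed.

End nest.

Section tensor.
Context (R : realFieldType) (s d : nat) (I : finType).
Context (w : 'I_s -> I -> R) (N : 'I_s -> I -> 'I_d -> R) (lambda : 'I_s -> R).
Hypotheses (w0 : forall j i, 0 <= w j i) (lambda0 : forall j, 0 <= lambda j).
Hypothesis wN : forall j (v : 'I_d -> R),
  lambda j * \sum_l v l ^+ 2 <= \sum_i w j i * (\sum_l v l * N j i l) ^+ 2.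

(** The sum of squares with the contraction by [N] performed one block at a time, so that [wN] can
    be applied in a single block while the indices of the others stay frozen. *)
Fixpoint tensor (js : seq 'I_s) (H : {ffun 'I_s -> 'I_d} -> R)
    (a : {ffun 'I_s -> 'I_d}) : R :=
  if js is j :: js' then
    \sum_i w j i * tensor js' (fun a => \sum_l N j i l * H (upd a j l)) a
  else H a ^+ 2.

Lemma tensor_ge js H a : uniq js ->
  (\prod_(j <- js) lambda j) * nest js (fun _ _ => 1) (fun a => H a ^+ 2) a
    <= tensor js H a.
Proof.
elim: js H a => [|j js ih] H a /=; first by rewrite big_nil mul1r.
move=> /andP[jjs ujs]; rewrite big_cons.
apply: (@le_trans _ _ (\sum_i w j i * ((\prod_(j <- js) lambda j) *
    nest js (fun _ _ => 1) (fun a => (\sum_l N j i l * H (upd a j l)) ^+ 2) a))).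
  under [leRHS]eq_bigr do rewrite mulrCA.
  rewrite -[leRHS]mulr_sumr (mulrC (lambda j)) -mulrA.
  apply: ler_wpM2l; first exact: prodr_ge0.
  rewrite -nest_lin.
  under eq_bigr do rewrite mul1r -nest_upd//.
  pose F := fun l (z : {ffun 'I_s -> 'I_d}) => H (upd z j l) ^+ 2.
  have -> : lambda j * \sum_(i < d) nest js (fun=> fun=> 1) (F i) a =
      nest js (fun _ _ => 1) (fun z => \sum_i lambda j * F i z) a.
    by rewrite nest_lin mulr_sumr.
  apply: nest_le => // z; rewrite -mulr_sumr.
  apply: le_trans (wN j (fun l => H (upd z j l))) _.
  apply: ler_sum => i _; rewrite ler_wpM2l//.
  by under eq_bigr do rewrite mulrC.
by apply: ler_sum => i _; rewrite ler_wpM2l// ih.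
Qed.

Lemma tensor_nest js H a z : uniq js -> tensor js H a =
  nest js w (fun z : {ffun 'I_s -> I} =>
    nest js (fun j l => N j (z j) l) H a ^+ 2) z.
Proof.
elim: js H a z => [//|j js ih] H a z /= /andP[jjs ujs].
apply: eq_bigr => i _; congr (_ * _).
rewrite (ih _ _ (upd z j i))//; apply: nest_ext => // z' z'E; congr (_ ^+ 2).
rewrite nest_lin z'E// ffunE eqxx; apply: eq_bigr => l _; congr (_ * _).
by rewrite nest_upd.
Qed.

(** Lower bounds of positive semidefinite forms multiply under tensor products. Here bounds on the
    single A_j become a bound on |nu_k|^2. *)
Lemma tensor_lower (i0 : I) (l0 : 'I_d) (H : {ffun 'I_s -> 'I_d} -> R) :
  (\prod_j lambda j) * \sum_a H a ^+ 2 <=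
  \sum_(z : {ffun 'I_s -> I}) (\prod_j w j (z j)) *
    (\sum_a H a * \prod_j N j (z j) (a j)) ^+ 2.
Proof.
have := tensor_ge H [ffun=> l0] (enum_uniq 'I_s).
rewrite (tensor_nest _ _ [ffun=> i0]) ?enum_uniq//.
rewrite !nest_enum big_enum/=.
under [X in _ * X <= _]eq_bigr do rewrite big1// mul1r.
move=> /le_trans; apply; rewrite le_eqVlt; apply/orP; left; apply/eqP.
apply: eq_bigr => z _; rewrite nest_enum; congr (_ * _ ^+ 2).
by apply: eq_bigr => a _; rewrite mulrC.
Qed.

End tensor.

Section mixed_flat.
Context (R : realType) (s d : nat) (I : finType).
Context (om : 'I_s -> I -> R) (y : 'I_s -> I -> 'rV[R]_d).

Definition row_mx_of (z : {ffun 'I_s -> I}) : 'M[R]_(s, d) :=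
  \matrix_(j, l) y j (z j) 0 l.

Lemma lam_nest js F z : lam om y js F (row_mx_of z) =
  nest js om (fun z => F (row_mx_of z)) z.
Proof.
elim: js z => [//|j js ih] z /=; apply: eq_bigr => i _; congr (_ * _).
rewrite -ih; congr (lam _ _ _ _ _); apply/matrixP => k l.
by rewrite !mxE ffunE; case: eqP => [->|].
Qed.

Lemma lin_nest js (g : partial_index s d -> 'M[R]_(s, d) -> R) xs
    (a : partial_index s d) (a0 : {ffun 'I_s -> 'I_d}) :
  uniq js -> lin g om y xs js a =
  nest js (moment om y) (fun b : {ffun 'I_s -> 'I_d} =>
    g [ffun k => if k \in js then Some (b k) else a k] xs) a0.
Proof.
elim: js a a0 => [|j js ih] a a0 /=.
  by move=> _; congr (g _ _); apply/ffunP => k; rewrite ffunE.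
move=> /andP[jjs ujs]; apply: eq_bigr => l _; congr (_ * _).
rewrite (ih _ (upd a0 j l))//; apply: nest_ext => // b bE.
congr (g _ _); apply/ffunP => k; rewrite !ffunE inE.
have [->|kj] := eqVneq k j; first by rewrite (negbTE jjs) bE// ffunE eqxx.
by [].
Qed.

End mixed_flat.

(** * Lower bound on one product of cells *)

Section class_bound.
Context (R : realType) (s d : nat).
Local Notation M := 'M[R]_(s, d).
Context (X : set M) (g : partial_index s d -> M -> R) (B beta : R) (c : M).
Hypotheses (B0 : 0 <= B) (beta0 : 0 < beta).
Hypothesis X_box : forall z : M, X z -> forall y : M, in_box c z y -> X y.
Hypothesis g_der : forall (a : partial_index s d) j l x, a j = None ->
  interior X x -> is_derive x (delta_mx j l) (g a) (g (add_partial a j l) x).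
Hypothesis g_hoelder : forall a x y, X x -> X y ->
  `|g a x - g a y| <= B * enorm (x - y) `^ beta.
Context (Z : 'I_s -> set 'rV[R]_d).
Hypothesis ZX : forall z : M, (forall j, Z j (row j z)) ->
  X z /\ forall i k, z i k != c i k.
Context (I : finType) (w : 'I_s -> I -> R) (y : 'I_s -> I -> 'rV[R]_d).
Context (N : 'I_s -> I -> 'I_d -> R) (lambda delta : 'I_s -> R) (xs : M) (rho : R).
Hypotheses (w0 : forall j i, 0 <= w j i) (lambda0 : forall j, 0 <= lambda j).
Hypothesis wN : forall j (v : 'I_d -> R),
  lambda j * \sum_l v l ^+ 2 <= \sum_i w j i * (\sum_l v l * N j i l) ^+ 2.
Hypotheses (Xxs : X xs) (rho0 : 0 <= rho) (delta0 : forall j, 0 <= delta j).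
Hypothesis yZ : forall j i, w j i != 0 -> Z j (y j i).
Hypothesis y_near : forall j i, w j i != 0 ->
  forall l, `|y j i 0 l - xs j l| <= rho.
Hypothesis y_close : forall j i i', w j i != 0 -> w j i' != 0 ->
  forall l, `|y j i 0 l - y j i' 0 l| <= delta j.
Hypothesis N_le : forall j i l, w j i != 0 -> `|N j i l| <= delta j.
Hypothesis N_mean : forall j l, \sum_i w j i * N j i l = 0.
Hypothesis N_moment : forall j l l',
  \sum_i w j i * N j i l * y j i 0 l' = \sum_i w j i * N j i l * N j i l'.

Definition top_partial (b : {ffun 'I_s -> 'I_d}) : partial_index s d :=
  [ffun j => Some (b j)].

Let G b := g (top_partial b) xs.

Definition contrast (z : {ffun 'I_s -> I}) :=
  \sum_b g (top_partial b) xs * \prod_j N j (z j) (b j).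

(** Expanding [contrast] turns the cross term into \sum_b G b * L b, where L b is a mixed difference
    of f with weights [om b]. By [lam_lin] each L b is close to its linear part, and [N_moment]
    identifies the sum of the linear parts with the quadratic term Q itself. The total is thus at
    least 2 Q - 3/2 Q minus twice the error, and [tensor_lower] bounds Q from below. *)
Lemma class_bound (z0 : {ffun 'I_s -> I}) (j0 : 'I_s) (l0 : 'I_d) :
  (forall j, w j (z0 j) != 0) ->
  2^-1 * ((\prod_j lambda j) * \sum_b G b ^+ 2) -
  2 * ((\sum_b `|G b|) * (B * ((s * d)%:R * rho) `^ beta *
    \prod_j ((\sum_i w j i) * delta j * (2 * d%:R * delta j)))) <=
  \sum_(z : {ffun 'I_s -> I}) (\prod_j w j (z j)) *
    (2 * contrast z * g [ffun=> None] (row_mx_of y z) - 3 / 2 * contrast z ^+ 2).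
Proof.
move=> wz0.
pose om (b : {ffun 'I_s -> 'I_d}) j i := w j i * N j i (b j).
pose E := B * ((s * d)%:R * rho) `^ beta *
    \prod_j ((\sum_i w j i) * delta j * (2 * d%:R * delta j)).
pose f := g [ffun=> None].
pose L b := \sum_(z : {ffun 'I_s -> I}) (\prod_j om b j (z j)) * f (row_mx_of y z).
pose Q := \sum_(z : {ffun 'I_s -> I}) (\prod_j w j (z j)) * contrast z ^+ 2.
have omw b j i : om b j i != 0 -> w j i != 0.
  by apply: contraNneq => wi; rewrite /om wi mul0r.
have LE b : `|L b - lin g (om b) y xs (enum 'I_s) [ffun=> None]| <= E.
  rewrite /L -(nest_enum _ _ z0) -lam_nest.
  have H := @lam_lin R s d X g B beta c B0 beta0 X_box g_der g_hoelder Z ZX I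
    (om b) y _ xs rho delta Xxs rho0 delta0 _ _ _ (enum 'I_s) [ffun=> None]
    (row_mx_of y z0).
  apply: le_trans (H _ _ _ _ _ _ _ _) _ => //.
  - by move=> j i /omw; exact: yZ.
  - by move=> j; exact: N_mean.
  - by move=> j i /omw; exact: y_near.
  - by move=> j i i' /omw wi /omw; exact: y_close.
  - exact: enum_uniq.
  - by move=> j _; rewrite ffunE.
  - move=> j; exists (y j (z0 j)); first exact/yZ/wz0.
    have -> : row j (row_mx_of y z0) = y j (z0 j) by apply/rowP => l; rewrite !mxE.
    exact: row_box_refl.
  - move=> j l; rewrite !mxE; exact/y_near/wz0.
  - rewrite big_enum/= /E ler_wpM2l ?mulr_ge0 ?powR_ge0//.
    apply: ler_prod => j _; rewrite mulr_ge0 ?sumr_ge0//= ?mulr_ge0//.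
    rewrite ler_wpM2r ?mulr_ge0// mulr_suml ler_sum// => i _.
    rewrite /om normrM ger0_norm//.
    have [->|wi] := eqVneq (w j i) 0; first by rewrite !mul0r.
    by rewrite ler_wpM2l// N_le.
have linE b : lin g (om b) y xs (enum 'I_s) [ffun=> None] =
    \sum_(b' : {ffun 'I_s -> 'I_d})
      (\prod_j \sum_i w j i * N j i (b j) * N j i (b' j)) * G b'.
  rewrite (lin_nest _ _ _ _ _ [ffun=> l0]) ?enum_uniq// nest_enum.
  apply: eq_bigr => b' _; congr (_ * _).
    by apply: eq_bigr => j _; rewrite /moment -N_moment.
  by congr g; apply/ffunP => k; rewrite !ffunE mem_enum.
have QE : \sum_b G b * lin g (om b) y xs (enum 'I_s) [ffun=> None] = Q.
  under eq_bigr do rewrite linE mulr_sumr.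
  transitivity (\sum_(b : {ffun 'I_s -> 'I_d}) \sum_(b' : {ffun 'I_s -> 'I_d})
      \sum_(z : {ffun 'I_s -> I})
      (\prod_j w j (z j)) * ((G b * \prod_j N j (z j) (b j)) *
        (G b' * \prod_j N j (z j) (b' j)))).
    apply: eq_bigr => b _; apply: eq_bigr => b' _.
    rewrite (bigA_distr_bigA (fun j i => w j i * N j i (b j) * N j i (b' j)))/=.
    rewrite mulr_suml mulr_sumr; apply: eq_bigr => z _.
    by rewrite !big_split/=; ring.
  rewrite /Q; under eq_bigr do rewrite exchange_big/=.
  rewrite exchange_big/=; apply: eq_bigr => z _.
  rewrite /contrast expr2 mulr_suml mulr_sumr; apply: eq_bigr => b _.
  by rewrite mulr_sumr mulr_sumr.
have LQ : \sum_(z : {ffun 'I_s -> I})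
    (\prod_j w j (z j)) * (contrast z * f (row_mx_of y z)) =
    \sum_b G b * L b.
  rewrite /L; under [RHS]eq_bigr do rewrite mulr_sumr.
  rewrite exchange_big/=; apply: eq_bigr => z _.
  rewrite /contrast mulr_suml mulr_sumr; apply: eq_bigr => b _.
  by rewrite /om big_split/= -/(G b); ring.
have Qge : (\prod_j lambda j) * \sum_b G b ^+ 2 <= Q.
  exact: (tensor_lower w0 lambda0 wN (z0 j0) l0).
have -> : \sum_(z : {ffun 'I_s -> I}) (\prod_j w j (z j)) *
    (2 * contrast z * g [ffun=> None] (row_mx_of y z) - 3 / 2 * contrast z ^+ 2) =
    2 * (\sum_b G b * L b) - 3 / 2 * Q.
  rewrite -LQ /Q !mulr_sumr -sumrB; apply: eq_bigr => z _.
  by rewrite -/f; ring.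
have : `|\sum_b G b * L b - Q| <= (\sum_b `|G b|) * E.
  rewrite -QE -sumrB mulr_suml; apply: le_trans (ler_norm_sum _ _ _) _.
  by apply: ler_sum => b _; rewrite -mulrBr normrM ler_wpM2l.
rewrite -/E ler_norml => /andP[h1 h2].
move: Qge h1 h2; move: ((\prod_j lambda j) * _) ((\sum_b `|G b|) * E) => A1 A2.
clear QE LQ LE linE; clearbody Q.
by move: (\sum_b G b * L b) => SL *; lra.
Qed.

End class_bound.

(** * Cells and centroids *)

(** The pairwise intersections form a null set, outside which the parts are disjoint. *)
Lemma Rintegral_ae_partition d0 (T : measurableType d0) (R : realType)
    (mu : {measure set T -> \bar R}) (n : nat) (D : set T) (Y : 'I_n -> set T)
    (f : T -> R) :
  (forall c, measurable (Y c)) -> \bigcup_c Y c = D ->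
  (forall c c', c != c' -> mu (Y c `&` Y c') = 0%E) ->
  mu.-integrable D (EFin \o f) ->
  Rintegral mu D f = \sum_c Rintegral mu (Y c) f.
Proof.
move=> mY YD Y0 intf.
pose N := \big[setU/set0]_(p : 'I_n * 'I_n | p.1 != p.2) (Y p.1 `&` Y p.2).
have [mN N0] : measurable N /\ mu N = 0%E.
  rewrite /N; elim/big_ind: _ => [|A A' [mA A0] [mA' A'0]|p p12].
  - by rewrite measure0.
  - by split; [exact: measurableU|rewrite measureU0].
  - by split; [exact: measurableI|exact: Y0].
have mD : measurable D.
  by rewrite -YD; apply: fin_bigcup_measurable => //; exact: finite_finset.
have YsubD c : Y c `<=` D by move=> x Yx; rewrite -YD; exists c.
have -> : Rintegral mu D f = Rintegral mu (D `\` N) f.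
  by rewrite /Rintegral (negligible_integral mN mD intf N0).
have DN : D `\` N = \big[setU/set0]_(c <- enum 'I_n) (Y c `\` N).
  apply/seteqP; split => x.
    rewrite -YD => -[[c _ Yc] Nx].
    by rewrite -bigcup_seq; exists c => //=; rewrite mem_enum.
  rewrite -bigcup_seq => -[c _ [Yc Nx]]; split => //; exact: YsubD Yc.
rewrite DN /Rintegral integral_bigsetU_EFin; first last.
- rewrite -DN; apply: (measurable_funS mD); first exact: subDsetl.
  exact: (measurable_int mu).
- move=> c c' _ _ [x [[Yc Nx] [Yc' _]]]; apply/eqP/negP => cc'.
  apply: Nx; rewrite /N -bigcup_seq_cond; exists (c, c') => //=.
  by rewrite mem_index_enum/=; apply/negP.
- exact: enum_uniq.
- by move=> c; exact: measurableD.
rewrite big_enum/= -sum_fine//.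
  apply: eq_bigr => c _; rewrite (negligible_integral mN (mY c) _ N0)//.
  by apply: integrableS intf => //; exact: YsubD.
move=> c _; apply: integrable_fin_num; first exact: measurableD.
apply: integrableS intf => //; first exact: measurableD.
by move=> x [Yx _]; exact: YsubD Yx.
Qed.

Lemma measurable_coord (R : realType) m n (i : 'I_m) (j : 'I_n) (D : set 'M[R]_(m, n)) :
  measurable D ->
  measurable_fun D (fun x : 'M[R]_(m, n) => x i j : measurableTypeR R).
Proof.
move=> mD; apply: (measurable_funS measurableT) => //.
apply: (measurability _ (measurable_realfun.RGenOInfty.measurableE R)) => //.
move=> _ [_ [r ->] <-]; rewrite setTI; apply: sub_gen_smallest.
apply: open_comp; last exact: interval_open.
by move=> x _; exact: coord_continuous.
Qed.

Section centroid.
Context (R : realType) (d : nat).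
Local Notation vol := (@mx_lebesgue R 1 d).
Implicit Types S : set 'rV[R]_d.

Lemma bounded_coord S : bounded_set S ->
  exists2 r : R, 0 <= r & forall x, S x -> forall l, `|x 0 l| <= r.
Proof.
move=> [M [Mr MS]]; exists (`|M| + 1); first by rewrite addr_ge0.
move=> x Sx l; apply: le_trans (mx_entry_le_norm _ _ _) _.
apply: (MS (`|M| + 1)) => //.
by rewrite (le_lt_trans (ler_norm _))// ltrDl.
Qed.

Lemma integrable_coord S l : measurable S -> bounded_set S -> (vol S < +oo)%E ->
  vol.-integrable S (EFin \o (fun x : 'rV[R]_d => x 0 l)).
Proof.
move=> mS bS fS; apply: measurable_bounded_integrable => //.
  exact: measurable_coord.
have [r r0 rS] := bounded_coord bS.
exists r; split; first exact: num_real.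
by move=> M rM x Sx /=; apply: le_trans (rS x Sx l) (ltW rM).
Qed.

(** [centroid] is a choice by [get], so a witness must be exhibited: the vector of coordinate
    averages. Testing the chosen vector against [delta_mx 0 l] then determines its coordinates. *)
Lemma centroidE S l : measurable S -> bounded_set S -> (0 < vol S < +oo)%E ->
  Rintegral vol S (fun x => x 0 l) = centroid S 0 l * fine (vol S).
Proof.
move=> mS bS /andP[S0 Sf].
have intc k : vol.-integrable S (EFin \o (fun x : 'rV[R]_d => x 0 k)).
  exact: integrable_coord.
have intk (r : R) : vol.-integrable S (EFin \o (fun=> r)).
  apply: measurable_bounded_integrable => //.
  by exists `|r|; split; [exact: num_real|move=> M rM x _ /=; exact: ltW].
have v0 : fine (vol S) != 0 by rewrite gt_eqF// fine_gt0// S0.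
suff : [set w | forall delta : 'rV[R]_d,
    \int[vol]_(x in S) dotp (x - w) delta = 0] (centroid S).
  move=> /(_ (delta_mx 0 l)).
  under eq_Rintegral => x _.
    rewrite (_ : dotp _ _ = x 0 l - centroid S 0 l); last first.
      rewrite /dotp (bigD1 l)//= big1 ?addr0 ?mxE ?eqxx ?mulr1 ?mxE// => k kl.
      by rewrite [delta_mx 0 l 0 k]mxE (negbTE kl) andbF mulr0.
    over.
  by rewrite RintegralB// Rintegral_cst// => /eqP; rewrite subr_eq0 => /eqP.
rewrite /centroid; apply: getPex.
exists (\row_k (Rintegral vol S (fun x => x 0 k) / fine (vol S))) => delta /=.
have -> : (fun x : 'rV[R]_d =>
    dotp (x - \row_k (Rintegral vol S (fun x => x 0 k) / fine (vol S))) delta) =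
  (fun x => \sum_(k < d)
    (x 0 k - Rintegral vol S (fun x => x 0 k) / fine (vol S)) * delta 0 k).
  by apply/funext => x; apply: eq_bigr => k _; rewrite !mxE.
have intm k : vol.-integrable S (EFin \o (fun x : 'rV[R]_d =>
    (x 0 k - Rintegral vol S (fun x => x 0 k) / fine (vol S)))).
  exact: (integrableB mS (intc k) (intk _)).
have intz k : vol.-integrable S (EFin \o (fun x : 'rV[R]_d =>
    (x 0 k - Rintegral vol S (fun x => x 0 k) / fine (vol S)) * delta 0 k)).
  exact: (integrableZr mS (delta 0 k) (intm k)).
rewrite /Rintegral; under eq_integral do rewrite -sumEFin.
rewrite integral_sum// -sum_fine; last by move=> k _; exact: (integrable_fin_num mS (intz k)).
rewrite big1// => k _.
rewrite -[LHS]/(Rintegral vol S (fun x => (x 0 k - Rintegral vol S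
  (fun x => x 0 k) / fine (vol S)) * delta 0 k)) RintegralZr// RintegralB//.
rewrite Rintegral_cst// divfK//.
by rewrite subrr mul0r.
Qed.

End centroid.

Section words.
Context (b : nat).

(** Horner's rule, leading digit first: the index t of the cell reached by the successive choices in
    w. *)
Definition idx (w : seq 'I_b) : nat := foldl (fun t (c : 'I_b) => b * t + c)%N 0%N w.

Lemma idx_rcons w c : idx (rcons w c) = (b * idx w + c)%N.
Proof. by rewrite /idx foldl_rcons. Qed.

Lemma idx_lt w : (idx w < b ^ size w)%N.
Proof.
elim/last_ind: w => [//|w c ih]; rewrite idx_rcons size_rcons expnS.
have := ltn_ord c; nia.
Qed.

End words.

Section cells.
Context (R : realType) (d b : nat) (b0 : (0 < b)%N).
Local Notation vol := (@mx_lebesgue R 1 d).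
Context (X : set 'rV[R]_d) (cell : nat -> nat -> set 'rV[R]_d).
Hypotheses (X_bounded : bounded_set X) (X_vol : vol X = 1%E).
Hypothesis split : recursive_split b X cell.

Let bR0 : 0 < b%:R :> R. Proof. by rewrite ltr0n. Qed.

Let bt_lt k t (c : 'I_b) : (t < b ^ k)%N -> (b * t + c < b ^ k.+1)%N.
Proof. by have := ltn_ord c; rewrite expnS; nia. Qed.

Lemma cell_cases k t : (t < b ^ k.+1)%N ->
  exists t' (c : 'I_b), (t' < b ^ k)%N /\ t = (b * t' + c)%N.
Proof.
move=> tb; exists (t %/ b)%N, (Ordinal (ltn_pmod t b0)); split.
  by rewrite ltn_divLR// mulnC -expnS.
by rewrite mulnC -divn_eq.
Qed.

Lemma cell_vol k t : (t < b ^ k)%N -> vol (cell k t) = (b%:R ^- k)%:E.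
Proof.
elim: k t => [|k ih] t.
  by rewrite expn0 ltnS leqn0 => /eqP ->; rewrite split.1 X_vol expr0 invr1.
move=> /cell_cases[t' [c [t'k ->]]].
have [_ _ _ -> _] := split.2 k t' t'k.
by rewrite ih// -EFinM -invfM -exprSr.
Qed.

Lemma cell_measurable k t : (t < b ^ k)%N -> measurable (cell k t).
Proof.
case: k => [|k].
  rewrite expn0 ltnS leqn0 => /eqP ->.
  have [_ mY <- _ _] := split.2 0%N 0%N isT.
  by apply: fin_bigcup_measurable => // ; exact: finite_finset.
move=> /cell_cases[t' [c [t'k ->]]].
by have [_ mY _ _ _] := split.2 k t' t'k; exact: mY.
Qed.

Lemma cell_sub k t (c : 'I_b) : (t < b ^ k)%N ->
  cell k.+1 (b * t + c) `<=` cell k t.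
Proof. by move=> tk; have [_ _ <- _ _] := split.2 k t tk; move=> x Yx; exists c. Qed.

Lemma cell_subX k t : (t < b ^ k)%N -> cell k t `<=` X.
Proof.
elim: k t => [|k ih] t.
  by rewrite expn0 ltnS leqn0 => /eqP ->; rewrite split.1.
move=> /cell_cases[t' [c [t'k ->]]].
exact: subset_trans (cell_sub t'k) (ih _ t'k).
Qed.

Lemma cell_take (w : seq 'I_b) k :
  cell (size w) (idx w) `<=` cell (size (take k w)) (idx (take k w)).
Proof.
elim/last_ind: w => [//|w c ih]; rewrite -cats1 take_cat.
case: ltnP => kw; last first.
  by case: (k - size w)%N => [|n] //=; rewrite cats0 cats1 size_rcons idx_rcons;
    exact/cell_sub/idx_lt.
apply: subset_trans ih; rewrite cats1 size_rcons idx_rcons; exact/cell_sub/idx_lt.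
Qed.

Lemma cell_cover k x : X x -> exists2 w : seq 'I_b, size w = k & cell k (idx w) x.
Proof.
move=> Xx; elim: k => [|k [w wk wx]]; first by exists [::]; rewrite // split.1.
have [|_ _ Yk _ _] := split.2 k (idx w); first by rewrite -wk idx_lt.
move: wx; rewrite -Yk => -[c _ cx]; exists (rcons w c); first by rewrite size_rcons wk.
by rewrite idx_rcons.
Qed.

Lemma cell_bounded k t : (t < b ^ k)%N -> bounded_set (cell k t).
Proof.
move=> tk; have [M [Mr MX]] := X_bounded; exists M; split => // N MN x cx.
by apply: MX MN _ _; exact: cell_subX cx.
Qed.

Let cell_vol_fin k t : (t < b ^ k)%N -> (0 < vol (cell k t) < +oo)%E.
Proof. by move=> tk; rewrite cell_vol// lte_fin invr_gt0 exprn_gt0// ltry. Qed.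

Lemma centroid_split k t l : (t < b ^ k)%N ->
  centroid (cell k t) 0 l =
  b%:R^-1 * \sum_(c < b) centroid (cell k.+1 (b * t + c)) 0 l.
Proof.
move=> tk; have [_ mY Yk _ Y0] := split.2 k t tk.
have := Rintegral_ae_partition mY Yk Y0
  (integrable_coord l (cell_measurable tk) (cell_bounded tk) (andP (cell_vol_fin tk)).2).
rewrite centroidE//; [|exact: cell_measurable|exact: cell_bounded|exact: cell_vol_fin].
under eq_bigr => c _.
  rewrite centroidE//; [|exact: cell_bounded (bt_lt c tk)|exact: cell_vol_fin (bt_lt c tk)].
  rewrite cell_vol ?bt_lt//=.
  over.
rewrite cell_vol//= -mulr_suml exprSr invfM => E.
have bk : (b%:R ^- k : R) != 0 by rewrite invr_eq0 expf_neq0// gt_eqF.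
by apply: (mulIf bk); rewrite E; ring.
Qed.

(** The slice of the cell by a hyperplane x_l = c_l lies in a degenerate box, hence is null, and
    finitely many slices cannot cover a cell of positive volume. *)
Lemma cell_generic (c : 'rV[R]_d) k t : (t < b ^ k)%N ->
  exists2 x, cell k t x & forall l, x 0 l != c 0 l.
Proof.
move=> tk; apply: contrapT => nex.
have mc := cell_measurable tk.
have [r r0 rc] := bounded_coord (cell_bounded tk).
pose P l := cell k t `&` [set x : 'rV[R]_d | x 0 l = c 0 l].
have mP l : measurable (P l).
  have := @measurable_coord R 1 d 0 l _ mc mc [set c 0 l] (measurable_set1 _).
  by [].
have P0 l : vol (P l) = 0%E.
  pose a : 'rV[R]_d := \row_j if j == l then c 0 l else - r.
  pose a' : 'rV[R]_d := \row_j if j == l then c 0 l else r.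
  have mbox : measurable [set x : 'rV[R]_d | forall i j, a i j <= x i j <= a' i j].
    rewrite (_ : mkset _ = \bigcap_(j in [set: 'I_d])
        [set x : 'rV[R]_d | a 0 j <= x 0 j <= a' 0 j]).
      apply: fin_bigcap_measurable; first exact: finite_finset.
      move=> j _; have := @measurable_coord R 1 d 0 j _ measurableT measurableT
        `[a 0 j, a' 0 j]%classic (measurable_itv _).
      rewrite setTI; congr measurable; apply/seteqP; split => x /=; by rewrite in_itv.
    apply/seteqP; split => x /= xa; first by move=> j _; exact: xa.
    by move=> i j; rewrite (ord1 i); exact: xa.
  apply: (subset_measure0 (mP l) mbox); last first.
    have aa' : forall i j, a i j <= a' i j.
      move=> i j; rewrite !mxE; case: ifP => // _.
      by rewrite (le_trans _ r0)// oppr_le0.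
    apply: etrans (mx_lebesgue_box aa') _.
    by rewrite big_ord1 (bigD1 l)//= !mxE eqxx subrr mul0r.
  move=> x [cx /= xl] i j; rewrite (ord1 i) !mxE; case: ifP => [/eqP ->|_].
    by rewrite xl lexx.
  by rewrite -ler_norml rc.
have E : cell k t = \big[setU/set0]_l P l.
  apply/seteqP; split => x; last by rewrite -bigcup_seq => -[l _ []].
  move=> cx; apply: contrapT => nP; apply: nex; exists x => // l.
  apply/eqP => xl; apply: nP; rewrite -bigcup_seq; exists l => //=.
  by rewrite mem_index_enum.
have [_ U0] : measurable (\big[setU/set0]_l P l) /\ vol (\big[setU/set0]_l P l) = 0%E.
  elim/big_ind: _ => [|A A' [mA A0] [mA' A'0]|l _].
  - by rewrite measure0.
  - by split; [exact: measurableU|rewrite measureU0].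
  - by split.
by have := cell_vol_fin tk; rewrite E U0 ltxx.
Qed.

Context (C : R) (C0 : 0 <= C).
Definition cell_size k := C * b%:R `^ (- (k%:R / d%:R)).
Hypothesis cell_diam : forall k t, (t < b ^ k)%N ->
  (diam (cell k t) <= (cell_size k)%:E)%E.

Lemma cell_size_ge0 k : 0 <= cell_size k.
Proof. by rewrite mulr_ge0// powR_ge0. Qed.

Lemma cell_enorm k t x y : (t < b ^ k)%N -> cell k t x -> cell k t y ->
  enorm (x - y) <= cell_size k.
Proof.
move=> tk cx cy; rewrite -lee_fin; apply: le_trans (cell_diam tk).
by apply: ereal_sup_ubound => /=; exists x => //; exists y.
Qed.

Lemma cell_coord k t x y l : (t < b ^ k)%N -> cell k t x -> cell k t y ->
  `|x 0 l - y 0 l| <= cell_size k.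
Proof.
move=> tk cx cy; apply: le_trans (cell_enorm tk cx cy).
by apply: le_trans (entry_le_enorm _ 0 l); rewrite !mxE.
Qed.

Lemma centroid_near k t x l : (t < b ^ k)%N -> cell k t x ->
  `|x 0 l - centroid (cell k t) 0 l| <= cell_size k.
Proof.
move=> tk cx.
have mc := cell_measurable tk.
have fc := cell_vol_fin tk.
have /andP[fc0 fc1] := fc.
have v0 : 0 < fine (vol (cell k t)) by rewrite fine_gt0// fc0.
have ic := integrable_coord l mc (cell_bounded tk) fc1.
have intk (r : R) : vol.-integrable (cell k t) (EFin \o (fun=> r)).
  apply: measurable_bounded_integrable => //.
  by exists `|r|; split; [exact: num_real|move=> M rM y _ /=; exact: ltW].
have E : (centroid (cell k t) 0 l - x 0 l) * fine (vol (cell k t)) =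
    Rintegral vol (cell k t) (fun y => y 0 l - x 0 l).
  by rewrite RintegralB// Rintegral_cst// centroidE ?mulrBl//; exact: cell_bounded.
rewrite -(ler_pM2r v0) distrC -[X in _ * X <= _](ger0_norm (ltW v0)) -normrM E.
have ib := integrableB mc ic (intk (x 0 l)).
refine (le_trans (le_normr_Rintegral mc ib) _).
have -> : cell_size k * fine (vol (cell k t)) =
  Rintegral vol (cell k t) (fun=> cell_size k) by rewrite Rintegral_cst.
refine (le_Rintegral mc (integrable_abse ib) (intk _) _).
by move=> y cy; exact: (cell_coord _ tk cy cx).
Qed.

End cells.

(** * Prefix classes and discrete centroids *)

Section prefix_sums.
Context (R : realFieldType) (b K : nat) (b0 : (0 < b)%N).
Local Notation D := (K.-tuple 'I_b).
Implicit Types (z : D) (w : seq 'I_b).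

Definition in_class w z := take (size w) z == w.

Lemma in_class_take k z : (k <= K)%N -> in_class (take k z) z.
Proof. by move=> kK; rewrite /in_class size_takel ?size_tuple. Qed.

Lemma in_class_takeE k z z0 : (k <= K)%N ->
  in_class (take k z0) z = (take k z == take k z0).
Proof. by move=> kK; rewrite /in_class size_takel ?size_tuple. Qed.

Lemma in_class_rcons w c z : in_class (rcons w c) z -> in_class w z.
Proof.
rewrite /in_class size_rcons => /eqP E.
have := congr1 (take (size w)) E; rewrite take_takel//.
by rewrite -cats1 take_size_cat// => ->.
Qed.

Lemma big_class_split (F : D -> R) w : (size w < K)%N ->
  \sum_(z | in_class w z) F z = \sum_c \sum_(z | in_class (rcons w c) z) F z.
Proof.
move=> wK; pose p z : 'I_b := tnth z (Ordinal wK).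
rewrite (partition_big p predT)//=; apply: eq_bigr => c _; apply: eq_bigl => z.
rewrite /in_class size_rcons (take_nth c) ?size_tuple// eqseq_rcons; congr (_ && _).
by rewrite /p (tnth_nth c).
Qed.

Lemma big_class_full (F : D -> R) w (wK : size w == K) :
  \sum_(z | in_class w z) F z = F (Tuple wK).
Proof.
apply: big_pred1 => z; rewrite /in_class (eqP wK) -[X in take X](size_tuple z) take_size.
by rewrite /= -val_eqE.
Qed.

Lemma class_card w : (size w <= K)%N ->
  \sum_(z | in_class w z) 1 = b%:R ^+ (K - size w) :> R.
Proof.
move: {2}(K - size w)%N (erefl (K - size w)%N) => n.
elim: n w => [|n ih] w nE wK.
  have wK' : size w == K by rewrite eqn_leq wK -subn_eq0 nE.
  by rewrite nE expr0 (big_class_full (fun=> 1) wK').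
have wK1 : (size w < K)%N by rewrite -subn_gt0 nE.
rewrite big_class_split// nE (eq_bigr (fun=> b%:R ^+ n)).
  by rewrite sumr_const card_ord exprS [RHS]mulr_natl.
by move=> c _; rewrite ih size_rcons ?subnS ?nE.
Qed.

Lemma class_sum_const w (c : R) : (size w <= K)%N ->
  \sum_(z | in_class w z) c = b%:R ^+ (K - size w) * c.
Proof. by move=> wK; rewrite -class_card// mulr_suml; under [RHS]eq_bigr do rewrite mul1r. Qed.

Definition class_mean (y : D -> R) w := b%:R ^- (K - size w) * \sum_(z | in_class w z) y z.

Let bR0 : b%:R != 0 :> R. Proof. by rewrite pnatr_eq0 -lt0n. Qed.

Lemma class_meanK y w : \sum_(z | in_class w z) y z = b%:R ^+ (K - size w) * class_mean y w.
Proof. by rewrite /class_mean mulrA divff ?mul1r// expf_neq0. Qed.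

Lemma class_mean_split y w : (size w < K)%N ->
  class_mean y w = b%:R^-1 * \sum_c class_mean y (rcons w c).
Proof.
move=> wK; rewrite /class_mean big_class_split// !mulr_sumr; apply: eq_bigr => c _.
by rewrite size_rcons mulrA -invfM -exprS subnSK.
Qed.

Lemma class_mean_near y w (v r : R) : (size w <= K)%N ->
  (forall z, in_class w z -> `|y z - v| <= r) -> `|class_mean y w - v| <= r.
Proof.
move=> wK yv.
have bp : 0 < b%:R ^+ (K - size w) :> R by rewrite exprn_gt0// ltr0n.
rewrite -(ler_pM2l bp) -[X in X * _](gtr0_norm bp) -normrM mulrBr -class_meanK.
rewrite -!class_sum_const// -sumrB; apply: le_trans (ler_norm_sum _ _ _) _.
exact: ler_sum.
Qed.

End prefix_sums.

(** Lagrange's identity: twice the difference of the two sides is a double sum of squares. *)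
Lemma cauchy_schwarz_sum (R : realFieldType) (I : finType) (u v : I -> R) :
  (\sum_i u i * v i) ^+ 2 <= (\sum_i u i ^+ 2) * (\sum_i v i ^+ 2).
Proof.
have : 0 <= \sum_i \sum_j (u i * v j - u j * v i) ^+ 2.
  by apply: sumr_ge0 => i _; apply: sumr_ge0 => j _; exact: sqr_ge0.
rewrite (_ : \sum_i \sum_j _ = 2 * ((\sum_i u i ^+ 2) * (\sum_i v i ^+ 2)) -
    2 * (\sum_i u i * v i) ^+ 2); first by rewrite subr_ge0 ler_pM2l.
transitivity (\sum_i \sum_j (u i ^+ 2 * v j ^+ 2 + u j ^+ 2 * v i ^+ 2 -
    2 * ((u i * v i) * (u j * v j)))).
  by apply: eq_bigr => i _; apply: eq_bigr => j _; ring.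
under eq_bigr do rewrite sumrB big_split/= -!mulr_sumr -mulr_suml.
rewrite sumrB big_split/= -!mulr_suml -!mulr_sumr -mulr_suml expr2; ring.
Qed.

Section discrete_centroids.
Context (R : realType) (d b K : nat) (b0 : (0 < b)%N) (d0 : (0 < d)%N).
Local Notation vol := (@mx_lebesgue R 1 d).
Local Notation D := (K.-tuple 'I_b).
Context (X : set 'rV[R]_d) (cell : nat -> nat -> set 'rV[R]_d).
Hypotheses (X_bounded : bounded_set X) (X_vol : vol X = 1%E).
Hypothesis split : recursive_split b X cell.
Context (C : R) (C0 : 0 <= C).
Local Notation cs := (cell_size d b C).
Hypothesis cell_diam : forall k t, (t < b ^ k)%N ->
  (diam (cell k t) <= (cs k)%:E)%E.
Context (y : D -> 'rV[R]_d).
Hypothesis y_cell : forall z : D, cell K (idx z) (y z).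

Let bR0 : 0 < b%:R :> R. Proof. by rewrite ltr0n. Qed.

(** The discrete centroid: it stands in for the centroid of the cell of w at truncation level K. *)
Definition mean w l := class_mean (fun z => y z 0 l) w.

Definition increment k (z : D) l := mean (take k.+1 z) l - mean (take k z) l.

Lemma y_class w (z : D) : in_class w z -> cell (size w) (idx w) (y z).
Proof.
move=> /eqP E; have yz : cell (size z) (idx z) (y z) by rewrite size_tuple.
by have := cell_take split (size w) yz; rewrite E.
Qed.

(** Downward induction from level K. There the class is a single point of the cell; above, both
    quantities are averages over the b subcells, so the error does not grow. *)
Lemma mean_centroid w l : (size w <= K)%N ->
  `|mean w l - centroid (cell (size w) (idx w)) 0 l| <= cs K.
Proof.
move: {2}(K - size w)%N (erefl (K - size w)%N) => n.
elim: n w => [|n ih] w nE wK.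
  have wK' : size w = K by apply/eqP; rewrite eqn_leq wK -subn_eq0 nE.
  apply: class_mean_near => // z zw; rewrite -wK'.
  apply: (centroid_near b0 X_bounded X_vol split cell_diam); first exact: idx_lt.
  exact: y_class.
have wK1 : (size w < K)%N by rewrite -subn_gt0 nE.
rewrite /mean class_mean_split//.
rewrite (centroid_split b0 X_bounded X_vol split)//; last exact: idx_lt.
rewrite -mulrBr -sumrB normrM ger0_norm ?invr_ge0// ler_pdivrMl//.
apply: le_trans (ler_norm_sum _ _ _) _.
apply: (@le_trans _ _ (\sum_(c < b) cs K)); last first.
  by rewrite sumr_const card_ord mulr_natl.
apply: ler_sum => c _; have := ih (rcons w c).
by rewrite size_rcons idx_rcons subnS nE; apply.
Qed.

Lemma mean_near k (z : D) w l : (k <= K)%N -> (size w <= K)%N ->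
  take k w = take k z -> (k <= size w)%N ->
  `|mean w l - y z 0 l| <= cs k.
Proof.
move=> kK wK wz kw; apply: class_mean_near => // z' z'w.
have E : take k z' = take k z.
  by rewrite -wz -(eqP z'w) take_takel.
have zk : size (take k z) = k by rewrite size_takel// size_tuple.
apply: (cell_coord cell_diam (t := idx (take k z))).
- by rewrite -[X in (_ < b ^ X)%N]zk; exact: idx_lt.
- have /y_class := in_class_take z' kK; rewrite E zk; exact.
- have /y_class := in_class_take z kK; rewrite zk; exact.
Qed.

Lemma increment_le k (z : D) l : (k < K)%N -> `|increment k z l| <= 2 * cs k.
Proof.
move=> kK; rewrite /increment -(subrKA (y z 0 l)).
apply: le_trans (ler_normD _ _) _; rewrite mulr_natl mulr2n lerD//.
  apply: mean_near; rewrite ?take_takel// ?size_takel ?size_tuple//; exact: ltnW.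
rewrite distrC.
by apply: mean_near; rewrite ?take_takel// ?size_takel ?size_tuple//; exact: ltnW.
Qed.

(** Within the class of the first k digits, the increment depends only on the digit of index k, and
    each value of that digit is shared by b^(K-k-1) words. *)
Lemma class_increment k (z0 : D) (F : ('I_d -> R) -> R) : (k < K)%N ->
  \sum_(z | in_class (take k z0) z) F (increment k z) =
  b%:R ^+ (K - k.+1) *
  \sum_c F (fun l => mean (rcons (take k z0) c) l - mean (take k z0) l).
Proof.
move=> kK; have sk : size (take k z0) = k by rewrite size_takel// size_tuple ltnW.
rewrite big_class_split ?sk// mulr_sumr; apply: eq_bigr => c _.
have skc : size (rcons (take k z0) c) = k.+1 by rewrite size_rcons sk.
rewrite -[X in b%:R ^+ (K - X)]skc -class_sum_const ?skc//.
apply: eq_bigr => z zc; congr F; apply/funext => l; rewrite /increment.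
have zc' := in_class_rcons zc.
by move: zc zc'; rewrite /in_class skc sk => /eqP -> /eqP ->.
Qed.

Lemma mean_split k (z0 : D) l : (k < K)%N ->
  \sum_c (mean (rcons (take k z0) c) l - mean (take k z0) l) = 0.
Proof.
move=> kK; have sk : size (take k z0) = k by rewrite size_takel// size_tuple ltnW.
rewrite sumrB sumr_const card_ord [X in _ - X *+ _]/mean class_mean_split ?sk//.
by rewrite -mulrnAl -mulr_natl divff ?gt_eqF// mul1r subrr.
Qed.

Lemma increment_mean k (z0 : D) l : (k < K)%N ->
  \sum_(z | in_class (take k z0) z) increment k z l = 0.
Proof.
by move=> kK; rewrite (class_increment z0 (fun v => v l))// mean_split// mulr0.
Qed.

(** Once the digit of index k is fixed, the increment is constant and [y] averages to the mean of
    the subclass. That mean may be replaced by the increment, because the increments of a class sum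
    to 0. Thanks to this identity the linear part of <nu_k, f> is exactly |nu_k|^2. *)
Lemma increment_moment k (z0 : D) l l' : (k < K)%N ->
  \sum_(z | in_class (take k z0) z) increment k z l * y z 0 l' =
  \sum_(z | in_class (take k z0) z) increment k z l * increment k z l'.
Proof.
move=> kK; have sk : size (take k z0) = k by rewrite size_takel// size_tuple ltnW.
rewrite (class_increment z0 (fun v => v l * v l'))// big_class_split ?sk//.
under [in RHS]eq_bigr do rewrite mulrBr.
rewrite sumrB -mulr_suml mean_split// mul0r subr0 mulr_sumr.
apply: eq_bigr => c _.
have skc : size (rcons (take k z0) c) = k.+1 by rewrite size_rcons sk.
rewrite (eq_bigr (fun z : D => (mean (rcons (take k z0) c) l - mean (take k z0) l)
    * y z 0 l')).
  by rewrite -mulr_sumr (class_meanK b0 (fun z => y z 0 l')) skc -/(mean _ _); ring.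
move=> z zc; congr (_ * _); rewrite /increment.
have zc' := in_class_rcons zc.
by move: zc zc'; rewrite /in_class skc sk => /eqP -> /eqP ->.
Qed.

Lemma split_matrix_form k t (v : 'rV[R]_d) :
  dotp (v *m split_matrix b cell k t) v =
  \sum_(c < b) (\sum_l v 0 l *
     (centroid (cell k.+1 (b * t + c)) 0 l - centroid (cell k t) 0 l)) ^+ 2.
Proof.
rewrite /split_matrix mulmx_sumr dotpE mulmx_suml summxE; apply: eq_bigr => c _ /=.
set u := _ - _.
have -> : v *m (u^T *m u) *m v^T = (v *m u^T) *m (v *m u^T)^T.
  by rewrite trmx_mul trmxK !mulmxA.
have E : (v *m u^T) 0 0 = \sum_l v 0 l *
     (centroid (cell k.+1 (b * t + c)) 0 l - centroid (cell k t) 0 l).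
  by rewrite mxE; apply: eq_bigr => l _; rewrite !mxE.
by rewrite mxE big_ord1 [(_^T) 0 0]mxE E expr2.
Qed.

Lemma split_matrix_sym k t : (split_matrix b cell k t)^T = split_matrix b cell k t.
Proof.
rewrite /split_matrix raddf_sum; apply: eq_bigr => c _ /=.
by rewrite trmx_mul trmxK.
Qed.

(** The centroid increments V satisfy the bound with mu and differ from the discrete ones N by at
    most 2 cs K. With (p + q)^2 <= 2 p^2 + 2 q^2 and Cauchy-Schwarz, mu |v|^2 is at most twice the
    discrete form plus 8 b d (cs K)^2 |v|^2. The hypothesis makes the last term at most mu |v|^2 /
    2, which leaves mu / 4. *)
Lemma increment_eigen k (z0 : D) (mu : R) (v : 'I_d -> R) : (k < K)%N ->
  mu <= min_eigenvalue (split_matrix b cell k (idx (take k z0))) ->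
  4 * (b * d)%:R * cs K ^+ 2 <= 4^-1 * mu ->
  b%:R ^+ (K - k.+1) * (4^-1 * mu) * \sum_l v l ^+ 2 <=
  \sum_(z | in_class (take k z0) z) (\sum_l v l * increment k z l) ^+ 2.
Proof.
move=> kK muA csK; have sk : size (take k z0) = k by rewrite size_takel// size_tuple ltnW.
rewrite (class_increment z0 (fun N => (\sum_l v l * N l) ^+ 2))// -mulrA.
rewrite ler_wpM2l ?exprn_ge0//.
set w := take k z0 in muA sk *.
pose vv : 'rV[R]_d := \row_l v l.
have vvE : dotp vv vv = \sum_l v l ^+ 2.
  by apply: eq_bigr => l _; rewrite mxE expr2.
have S0 : 0 <= \sum_l v l ^+ 2 by apply: sumr_ge0 => l _; exact: sqr_ge0.
have muQ : mu * \sum_l v l ^+ 2 <= \sum_(c < b) (\sum_l v l *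
     (centroid (cell k.+1 (b * idx w + c)) 0 l - centroid (cell k (idx w)) 0 l)) ^+ 2.
  apply: le_trans (ler_wpM2r S0 muA) _.
  have := min_eigenvalue_le vv d0 (split_matrix_sym k (idx w)).
  rewrite split_matrix_form vvE => /le_trans; apply.
  rewrite le_eqVlt; apply/orP; left; apply/eqP; apply: eq_bigr => c _; congr (_ ^+ 2).
  by apply: eq_bigr => l _; rewrite mxE.
pose V c l := centroid (cell k.+1 (b * idx w + c)) 0 l - centroid (cell k (idx w)) 0 l.
pose N c l := mean (rcons w c) l - mean w l.
have NV (c : 'I_b) l : `|V c l - N c l| <= 2 * cs K.
  have := @mean_centroid (rcons w c) l; rewrite size_rcons idx_rcons sk => /(_ kK) h1.
  have := @mean_centroid w l; rewrite sk => /(_ (ltnW kK)) h2.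
  have -> : V c l - N c l = - (mean (rcons w c) l -
      centroid (cell k.+1 (b * idx w + c)) 0 l) +
      (mean w l - centroid (cell k (idx w)) 0 l) by rewrite /V /N; ring.
  by apply: le_trans (ler_normD _ _) _; rewrite normrN mulr_natl mulr2n lerD.
have cs0 : 0 <= cs K by exact: cell_size_ge0.
have key (c : 'I_b) : (\sum_l v l * V c l) ^+ 2 <= 2 * (\sum_l v l * N c l) ^+ 2 +
    2 * ((\sum_l v l ^+ 2) * (d%:R * (2 * cs K) ^+ 2)).
  have -> : \sum_l v l * V c l = \sum_l v l * N c l + \sum_l v l * (V c l - N c l).
    by rewrite -big_split; apply: eq_bigr => l _ /=; ring.
  have CS : (\sum_l v l * (V c l - N c l)) ^+ 2 <=
      (\sum_l v l ^+ 2) * (d%:R * (2 * cs K) ^+ 2).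
    apply: le_trans (cauchy_schwarz_sum _ _) _; rewrite ler_wpM2l//.
    apply: (@le_trans _ _ (\sum_(l < d) (2 * cs K) ^+ 2)).
      apply: ler_sum => l _; rewrite -real_normK ?num_real// ler_pXn2r ?nnegrE//.
      by rewrite mulr_ge0.
    by rewrite sumr_const card_ord -[leLHS]mulr_natl.
  move: CS; move: (\sum_l v l * N c l) (\sum_l v l * (V c l - N c l)) => P Q CS.
  have := sqr_ge0 (P - Q); lra.
have : \sum_(c < b) (\sum_l v l * V c l) ^+ 2 <=
   2 * (\sum_(c < b) (\sum_l v l * N c l) ^+ 2) +
   2 * (b%:R * ((\sum_l v l ^+ 2) * (d%:R * (2 * cs K) ^+ 2))).
  apply: le_trans (ler_sum _ (fun c _ => key c)) _.
  by rewrite big_split/= -mulr_sumr sumr_const card_ord -[X in _ + X <= _]mulr_natl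
    [b%:R * (2 * _)]mulrCA.
move=> h; have {}h := le_trans muQ h.
have h3 := ler_wpM2r S0 csK; rewrite natrM in h3.
rewrite -/N; move: h h3 S0.
move: (\sum_l v l ^+ 2) (\sum_(c < b) _) => S Q; rewrite exprMn.
move: (cs K ^+ 2) (b%:R : R) (d%:R : R) => cc bb dd; nra.
Qed.

End discrete_centroids.

(** * Digits and scrambling *)

Section digits.
Context (R : realType) (b : nat) (hb : (1 < b)%N).
Implicit Types x : R.

Let bR0 : 0 < b%:R :> R. Proof. by rewrite ltr0n ltnW. Qed.

Lemma idx_mkseq (q : nat -> 'I_b) K :
  idx (mkseq q K) = (\sum_(k < K) q k * b ^ (K - k.+1))%N.
Proof.
elim: K => [|K ih]; first by rewrite big_ord0.
rewrite mkseqS idx_rcons ih big_ord_recr/= subnn expn0 muln1.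
congr (_ + _)%N; rewrite big_distrr/=; apply: eq_bigr => k _.
by rewrite mulnCA -expnS subSn ?ltn_ord//; congr (_ * b ^ _)%N; rewrite subSS subnSK.
Qed.

Lemma cell_index_idx x K : cell_index hb x K = idx (mkseq (digit hb x) K).
Proof. by rewrite idx_mkseq. Qed.

Lemma cell_index_lt x K : (cell_index hb x K < b ^ K)%N.
Proof. by rewrite cell_index_idx -[X in (_ < b ^ X)%N](size_mkseq (digit hb x) K) idx_lt. Qed.

Lemma cell_indexS x K : cell_index hb x K.+1 = (b * cell_index hb x K + digit hb x K)%N.
Proof. by rewrite !cell_index_idx mkseqS idx_rcons. Qed.

Lemma cell_indexE x K : 0 <= x < 1 -> cell_index hb x K = Num.truncn (x * b%:R ^+ K).
Proof.
move=> /andP[x0 x1]; elim: K => [|K ih].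
  rewrite /cell_index big_ord0 expr0 mulr1; apply/esym/truncn_def.
  by rewrite x0 x1.
rewrite cell_indexS ih /= x1.
set t := Num.truncn (x * b%:R ^+ K.+1).
suff -> : Num.truncn (x * b%:R ^+ K) = (t %/ b)%N by rewrite mulnC -divn_eq.
have /andP[t1 t2] : t%:R <= x * b%:R ^+ K.+1 < t.+1%:R.
  by apply: truncn_itv; rewrite mulr_ge0// exprn_ge0// ltW.
apply: truncn_def; rewrite exprSr mulrA in t1 t2.
have bb : b%:R * b%:R^-1 = 1 :> R by rewrite divff// gt_eqF.
apply/andP; split.
  rewrite -(ler_pM2r bR0); apply: le_trans t1.
  by rewrite -natrM ler_nat leq_trunc_div.
rewrite -(ltr_pM2r bR0); apply: lt_le_trans t2 _.
by rewrite -natrM ler_nat ltn_ceil// ltnW.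
Qed.

Lemma cell_index_box x K c :
  c%:R / b%:R ^+ K <= x < c.+1%:R / b%:R ^+ K -> (c < b ^ K)%N ->
  cell_index hb x K = c.
Proof.
have bK : 0 < b%:R ^+ K :> R by rewrite exprn_gt0.
rewrite ler_pdivrMr// ltr_pdivlMr// => /andP[x1 x2] cb.
rewrite cell_indexE; first by apply: truncn_def; rewrite x1.
rewrite -(pmulr_lge0 _ bK) (le_trans _ x1)//= -(ltr_pM2r bK) mul1r.
by apply: lt_le_trans x2 _; rewrite -natrX ler_nat.
Qed.

(** There are b^m elementary boxes of shape k, as many as points. The map from a box to its point is
    injective, since the leading digits of the point determine the box, hence bijective. So every
    point lies in a box, although a coordinate could a priori be 1, and two points with the same
    leading digits would share one. *)
Lemma net_separation s m (a : 'I_(b ^ m) -> 'rV[R]_s) (k : 'I_s -> nat) i i' :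
  is_net a -> (\sum_j k j = m)%N -> i != i' ->
  exists j, mkseq (digit hb (a i 0 j)) (k j) != mkseq (digit hb (a i' 0 j)) (k j).
Proof.
move=> [a01 net] km ii'.
have vol : \prod_j (b%:R ^- k j : R) = b%:R ^- m.
  by rewrite -km prodfV -expr_sum.
pose C := {dffun forall j : 'I_s, 'I_(b ^ k j)}.
pose inbox (c : C) i := forall j,
  ((c j : nat)%:R / b%:R ^+ k j : R) <= a i 0 j < ((c j).+1%:R / b%:R ^+ k j).
have /choice[h hP] (c : C) : exists i, inbox c i /\ forall i', inbox c i' -> i' = i.
  have [j0 [h1 h2]] := net k (fun j => c j) (fun j => ltn_ord (c j)) vol.
  by exists j0; split => // j1 /h2.
have hinj : injective h.
  move=> c c' hcc'; apply/ffunP => j; apply: val_inj => /=.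
  rewrite -(cell_index_box ((hP c).1 j) (ltn_ord _)).
  by rewrite hcc' (cell_index_box ((hP c').1 j) (ltn_ord _)).
have card : #|C| = #|'I_(b ^ m)|.
  rewrite card_dep_ffun foldrE big_map big_enum/= card_ord -km.
  rewrite expn_sum; apply: eq_bigr => j _; exact: card_ord.
have [h' _ h'K] := inj_card_bij hinj (eq_leq (esym card)).
apply: contrapT => /forallNP same; move/negP: ii'; apply; apply/eqP.
have iP := hP (h' i); rewrite h'K in iP.
have i'P := hP (h' i'); rewrite h'K in i'P.
apply: i'P.2 => j.
have := iP.1 j.
have E : h' i j = h' i' j :> nat.
  rewrite -(cell_index_box (iP.1 j) (ltn_ord _)) -(cell_index_box (i'P.1 j) (ltn_ord _)).
  by rewrite !cell_index_idx; congr idx; apply/eqP/negPn/negP; exact: same.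
by rewrite E.
Qed.

End digits.

Section digit_series.
Context (R : realType) (b : nat) (hb : (1 < b)%N).
Let bR0 : 0 < b%:R :> R. Proof. by rewrite ltr0n ltnW. Qed.
Context (q : nat -> 'I_b).
Let S : nat -> R := series (fun k => (q k)%:R / b%:R ^+ k.+1).

Let S_S k : S k.+1 = S k + (q k)%:R / b%:R ^+ k.+1.
Proof. by rewrite /S /series /= big_nat_recr. Qed.

Let bpow k : b%:R ^- k = b%:R * b%:R ^- k.+1 :> R.
Proof. by rewrite exprS invfM mulrA divff ?mul1r// gt_eqF. Qed.

Let S_idx K : S K = (idx (mkseq q K))%:R / b%:R ^+ K.
Proof.
elim: K => [|K ih]; first by rewrite /S /series /= big_geq// mul0r.
by rewrite S_S ih mkseqS idx_rcons natrD natrM mulrDl bpow; ring.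
Qed.

(** Equality holds when the digits K, ..., K + i - 1 all equal b - 1. *)
Let S_le K i : S (K + i) <= S K + b%:R ^- K - b%:R ^- (K + i).
Proof.
elim: i => [|i ih]; first by rewrite addn0 addrK.
rewrite addnS S_S; apply: le_trans (lerD ih (lexx _)) _.
rewrite -!addrA !lerD2l (bpow (K + i)).
have : (q (K + i)%N)%:R + 1 <= b%:R :> R by rewrite natr1 ler_nat.
have : 0 < b%:R ^- (K + i).+1 :> R by rewrite invr_gt0 exprn_gt0.
move: (b%:R ^- (K + i).+1 : R) (b%:R : R) ((q (K + i)%N)%:R : R) => v bb qq v0 qb.
nra.
Qed.

Let S_nd : nondecreasing_seq S.
Proof.
apply/nondecreasing_seqP => k; rewrite S_S lerDl divr_ge0// exprn_ge0// ltW.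
Qed.

(** A digit below b - 1 at a position k0 >= K keeps the limit away from the right end of the
    interval given by the first K digits, by at least b^-(k0+1). Without it the sum could reach that
    end, where [digit] reads another expansion or the number is 1. *)
Lemma digit_series_index K k0 : (K <= k0)%N -> (q k0 < b.-1)%N ->
  cell_index hb (limn S) K = idx (mkseq q K).
Proof.
move=> Kk0 qk0.
have S1 : S k0.+1 <= S K + b%:R ^- K - 2 * b%:R ^- k0.+1.
  have := S_le K (k0 - K); rewrite subnKC// => h.
  rewrite S_S; apply: le_trans (lerD h (lexx _)) _.
  rewrite -!addrA !lerD2l (bpow k0).
  have : (q k0)%:R + 2 <= b%:R :> R by rewrite -natrD ler_nat; lia.
  have : 0 < b%:R ^- k0.+1 :> R by rewrite invr_gt0 exprn_gt0.
  move: (b%:R ^- k0.+1 : R) (b%:R : R) ((q k0)%:R : R) => v bb qq v0 qb.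
  nra.
have Sub n : S n <= S K + b%:R ^- K - b%:R ^- k0.+1.
  have p0 j : 0 < b%:R ^- j :> R by rewrite invr_gt0 exprn_gt0.
  have [nk|nk] := leqP n k0.+1.
    apply: le_trans (S_nd nk) _; apply: le_trans S1 _.
    by have := p0 k0.+1; lra.
  have := S_le k0.+1 (n - k0.+1); rewrite subnKC ?(ltnW nk)// => h.
  by have := p0 n; have := p0 k0.+1; lra.
have cvS : cvgn S.
  apply: nondecreasing_is_cvgn S_nd _.
  by exists (S K + b%:R ^- K - b%:R ^- k0.+1) => _ [n _ <-]; exact: Sub.
have ub : limn S <= S K + b%:R ^- K - b%:R ^- k0.+1.
  by apply: limr_le cvS _; near=> n; exact: Sub.
have lb : S K <= limn S.
  apply: limr_ge cvS _; near=> n; apply: S_nd; near: n.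
  exact: nbhs_infty_ge.
apply: cell_index_box; last first.
  by rewrite -[X in (_ < b ^ X)%N](size_mkseq q K) idx_lt.
rewrite -S_idx lb/= -natr1 mulrDl -S_idx mul1r.
apply: le_lt_trans ub _; rewrite ltrBlDr ltrDl.
by rewrite invr_gt0 exprn_gt0.
Unshelve. all: by end_near. Qed.

End digit_series.

Section phi.
Context (R : realType) (d b : nat) (hb : (1 < b)%N) (d0 : (0 < d)%N).
Context (X : set 'rV[R]_d) (cell : nat -> nat -> set 'rV[R]_d).
Hypothesis split : recursive_split b X cell.
Context (C : R) (C0 : 0 <= C).
Local Notation cs := (cell_size d b C).
Hypothesis cell_diam : forall k t, (t < b ^ k)%N ->
  (diam (cell k t) <= (cs k)%:E)%E.
Hypothesis cell_nonempty : forall k t, (t < b ^ k)%N -> cell k t !=set0.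

Lemma cell_size_cvg0 : cs k @[k --> \oo] --> (0 : R).
Proof.
have -> : cs = fun k => C * (b%:R `^ (- d%:R^-1)) ^+ k.
  apply/funext => k; congr (C * _).
  by rewrite -powR_mulrn ?powR_ge0// -powRrM mulNr mulrC.
rewrite (_ : nbhs (0 : R) = nbhs (C * (0 : R))); last by rewrite mulr0.
apply: cvgM; first exact: cvg_cst.
apply: cvg_expr; rewrite ger0_norm ?powR_ge0//.
rewrite powRN invf_lt1 ?powR_gt0 ?ltr0n 1?ltnW//.
rewrite -[X in X < _](congr1 (fun f => f d%:R^-1) (@powR1 R)).
by apply: gt0_ltr_powR; rewrite ?nnegrE ?invr_gt0 ?ltr0n ?ltr1n.
Qed.

Let F (u : R) := filter_from [set: nat] (fun K => cell K (cell_index hb u K)).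

Let cell_mono (u : R) K K' : (K <= K')%N ->
  cell K' (cell_index hb u K') `<=` cell K (cell_index hb u K).
Proof.
move=> KK'; rewrite -(subnKC KK'); elim: (K' - K)%N => [|n ih].
  by rewrite addn0.
apply: subset_trans ih; rewrite addnS cell_indexS.
by apply: (cell_sub split); exact: cell_index_lt.
Qed.

Let F_filter u : ProperFilter (F u).
Proof.
apply: filter_from_proper; last by move=> K _; exact/cell_nonempty/cell_index_lt.
apply: filter_from_filter; first by exists 0%N.
move=> K K' _ _; exists (maxn K K') => // x cx; split.
  by apply: cell_mono cx; exact: leq_maxl.
by apply: cell_mono cx; exact: leq_maxr.
Qed.

Lemma phi_cvg u : F u --> phi hb cell u.
Proof.
have FF := F_filter u.
suff : cvg (F u) by [].
apply: cauchy_cvg; apply: cauchy_exP => e e0.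
have : \forall k \near \oo, cs k < e.
  have := cell_size_cvg0; move/cvgr_lt; exact.
move=> [K _ /(_ K (leqnn K)) Ke].
have [x cx] := cell_nonempty (cell_index_lt hb u K).
exists x; exists K => // y cy.
rewrite -ball_normE /ball_/=; apply: le_lt_trans Ke.
apply: mx_norm_leP => [|i j]; first exact: cell_size_ge0.
rewrite (ord1 i) !mxE; exact: (cell_coord cell_diam _ (cell_index_lt hb u K)).
Qed.

(** The cells need not be closed, so the limit may lie outside them. As its neighbourhoods meet the
    cell of level K, it is still within [cs K] of each point of that cell, coordinatewise. *)
Lemma phi_near u K x l : cell K (cell_index hb u K) x ->
  `|phi hb cell u 0 l - x 0 l| <= cs K.
Proof.
move=> cx; apply/ler_addgt0Pr => e e0.
have /(_ _ (nbhsx_ballx (phi hb cell u) e e0)) := @phi_cvg u.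
move=> [K' _ K'e].
have [v cv] := cell_nonempty (cell_index_lt hb u (maxn K K')).
have cvK := cell_mono (leq_maxl K K') cv.
have cvK' := cell_mono (leq_maxr K K') cv.
rewrite -(subrKA (v 0 l)) addrC; apply: le_trans (ler_normD _ _) _.
apply: lerD; first exact: (cell_coord cell_diam _ (cell_index_lt hb u K)).
have := K'e _ cvK'; rewrite -ball_normE /ball_/= => /ltW.
by apply: le_trans; have := mx_entry_le_norm (phi hb cell u - v) 0 l; rewrite !mxE.
Qed.

End phi.

(** * Averages over finitely many permutations *)

Section rotation.
Context (b : nat) (hb : (1 < b)%N).

(** The b cyclic shifts act simply transitively on the digits, and composing with them preserves the
    uniform law of a permutation; the averages below rest on this invariance. *)
Definition rot_digit (e c : 'I_b) : 'I_b := Ordinal (ltn_pmod (c + e) (ltnW hb)).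

Definition digit0 : 'I_b := Ordinal (ltnW hb).

Lemma rot_digit0 c : rot_digit digit0 c = c.
Proof. by apply: val_inj; rewrite /= addn0 modn_small. Qed.

Lemma rot_digit_inj e : injective (rot_digit e).
Proof.
move=> c c' /(congr1 val)/= /eqP; rewrite eqn_modDr !modn_small//.
by move=> /eqP/val_inj.
Qed.

Lemma rot_digitC e c : rot_digit e c = rot_digit c e.
Proof. by apply: val_inj; rewrite /= addnC. Qed.

Definition rot_perm e : {perm 'I_b} := perm (@rot_digit_inj e).

End rotation.

Section finite_scramble.
Context (R : realFieldType) (s b K : nat) (hb : (1 < b)%N).
Local Notation Z := {ffun 'I_s -> K.-tuple 'I_b}.
Local Notation node := ('I_s * {bseq K of 'I_b})%type.
Local Notation S := {ffun node -> {perm 'I_b}}.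

Definition rot_word (z : Z) (e : 'I_s -> nat -> 'I_b) : Z :=
  [ffun j => [tuple rot_digit hb (e j i) (tnth (z j) i) | i < K]].

Definition shift_word (z : Z) (j : 'I_s) (k : nat) (e : 'I_b) : Z :=
  rot_word z (fun j' k' => if (j' == j) && (k' == k) then e else digit0 hb).

Lemma rot_word_inj e : injective (rot_word ^~ e).
Proof.
move=> z z' /ffunP zz'; apply/ffunP => j; apply: eq_from_tnth => i.
have := zz' j; rewrite !ffunE => /(congr1 (fun t => tnth t i)).
by rewrite !tnth_mktuple => /rot_digit_inj.
Qed.

Lemma sum_rot_word (F : Z -> R) e : \sum_z F (rot_word z e) = \sum_z F z.
Proof. by rewrite [RHS](reindex_inj (@rot_word_inj e)). Qed.

Definition rot_perms (t : S) (r : node -> 'I_b) : S :=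
  [ffun v => (t v * rot_perm hb (r v))%g].

Lemma rot_perms_inj r : injective (rot_perms ^~ r).
Proof.
move=> t t' /ffunP tt'; apply/ffunP => v; have := tt' v.
by rewrite !ffunE => /mulIg.
Qed.

Lemma sum_rot_perms (F : S -> R) r : \sum_t F (rot_perms t r) = \sum_t F t.
Proof. by rewrite [RHS](reindex_inj (@rot_perms_inj r)). Qed.

(** [bseq] makes the nodes a finite type; a word longer than K gets the identity. *)
Definition perm_at (t : S) (j : 'I_s) (w : seq 'I_b) : {perm 'I_b} :=
  if insub w : option {bseq K of 'I_b} is Some w' then t (j, w') else 1%g.

Definition scrambled_word (p : 'I_s -> seq 'I_b -> {perm 'I_b})
    (A : 'I_s -> nat -> 'I_b) : Z :=
  [ffun j => [tuple p j (mkseq (A j) i) (A j i) | i < K]].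

Lemma perm_at_rot t r j (A : nat -> 'I_b) (k : 'I_K) (kK : (size (mkseq A k) <= K)%N) c :
  perm_at (rot_perms t r) j (mkseq A k) c =
  rot_digit hb (r (j, Bseq kK)) (perm_at t j (mkseq A k) c).
Proof. by rewrite /perm_at insubT ffunE permM permE. Qed.

Lemma mkseq_size_le (A : nat -> 'I_b) (k : 'I_K) : (size (mkseq A k) <= K)%N.
Proof. by rewrite size_mkseq ltnW. Qed.

Lemma scrambled_word_rot t r A :
  scrambled_word (perm_at (rot_perms t r)) A =
  [ffun j => [tuple rot_digit hb (r (j, Bseq (mkseq_size_le (A j) i)))
    (tnth (scrambled_word (perm_at t) A j) i) | i < K]].
Proof.
apply/ffunP => j; apply: eq_from_tnth => i.
by rewrite !ffunE !tnth_mktuple (perm_at_rot _ _ _ (mkseq_size_le (A j) i)).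
Qed.

(** A single scrambled point is uniform over the words. Rotating by e_jk all permutations of depth k
    in coordinate j shifts the digits of the word by e; for fixed t, these shifts reach every word
    exactly once. *)
Lemma sum_scrambled_word (F : Z -> R) A :
  (\sum_(t : S) F (scrambled_word (perm_at t) A)) * #|{: Z}|%:R =
  #|{: S}|%:R * \sum_z F z.
Proof.
pose ex (e : Z) (j : 'I_s) (k : nat) := nth (digit0 hb) (e j) k.
transitivity (\sum_(e : Z) \sum_(t : S) F (rot_word (scrambled_word (perm_at t) A) (ex e))).
  rewrite mulr_natr -sumr_const; apply: eq_bigr => e _.
  rewrite -(sum_rot_perms _ (fun v : node => ex e v.1 (size v.2))).
  apply: eq_bigr => t _; congr F; rewrite scrambled_word_rot.
  apply/ffunP => j; rewrite !ffunE; apply: eq_from_tnth => i.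
  by rewrite !tnth_mktuple /= size_mkseq.
rewrite exchange_big/= mulr_natl -sumr_const; apply: eq_bigr => t _.
move: (scrambled_word _ _) => z.
have inj : injective (fun e : Z => rot_word z (ex e)).
  move=> e e' /ffunP ee'; apply/ffunP => j; apply: eq_from_tnth => i.
  have := ee' j; rewrite !ffunE => /(congr1 (fun t => tnth t i)).
  rewrite !tnth_mktuple ![rot_digit _ (ex _ _ _) _]rot_digitC => /rot_digit_inj.
  by rewrite /ex -!tnth_nth.
by rewrite [RHS](reindex_inj inj).
Qed.

Let bR0 : b%:R != 0 :> R. Proof. by rewrite pnatr_eq0 -lt0n ltnW. Qed.

Lemma sum_separated (nu F : Z -> R) A A' j k : (k < K)%N ->
  (forall z, \sum_e nu (shift_word z j k e) = 0) ->
  mkseq (A j) k != mkseq (A' j) k ->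
  \sum_(t : S) nu (scrambled_word (perm_at t) A) * F (scrambled_word (perm_at t) A') = 0.
Proof.
move=> kK nu0 AA'.
(* The digit of index k is permuted at the node formed by the k digits before it. Rotating the
   permutation at (j, w) therefore moves that digit of the first word only and leaves the second
   word fixed. The total is multiplied by b in order to sum over all rotations. *)
pose w := Bseq (mkseq_size_le (A j) (Ordinal kK)).
pose r (e : 'I_b) (v : node) := if v == (j, w) then e else digit0 hb.
apply: (mulfI bR0); rewrite mulr0 mulr_natl -[X in _ *+ X](card_ord b) -sumr_const.
under eq_bigr => e _ do rewrite -(sum_rot_perms _ (r e)).
rewrite exchange_big/= big1// => t _.
have EA e : scrambled_word (perm_at (rot_perms t (r e))) A =
    shift_word (scrambled_word (perm_at t) A) j k e.
  rewrite scrambled_word_rot; apply/ffunP => j'; rewrite !ffunE.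
  apply: eq_from_tnth => i; rewrite !tnth_mktuple; congr (rot_digit _ _ _).
  rewrite /r xpair_eqE; have [->|//] := eqVneq j' j; rewrite /= -val_eqE /=.
  have [->|ik] := eqVneq (i : nat) k; first by rewrite eqxx.
  case: eqP => // /(congr1 size); rewrite !size_mkseq => ik'.
  by rewrite ik' eqxx in ik.
have EA' e : scrambled_word (perm_at (rot_perms t (r e))) A' =
    scrambled_word (perm_at t) A'.
  rewrite scrambled_word_rot; apply/ffunP => j'; rewrite [LHS]ffunE.
  apply: eq_from_tnth => i; rewrite [LHS]tnth_mktuple /r xpair_eqE.
  have [->|_] := eqVneq j' j; last by rewrite rot_digit0.
  rewrite /= -val_eqE /=; case: eqP => [E|_]; last by rewrite rot_digit0.
  have ik : (i : nat) = k by have := congr1 size E; rewrite !size_mkseq.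
  by move: AA'; rewrite -E ik eqxx.
under eq_bigr do rewrite EA EA'.
by rewrite -mulr_suml nu0 mul0r.
Qed.

Lemma sum_invariant (nu nu' : Z -> R) j k :
  (forall z e, nu (shift_word z j k e) = nu z) ->
  (forall z, \sum_e nu' (shift_word z j k e) = 0) ->
  \sum_z nu z * nu' z = 0.
Proof.
move=> inv nu0; apply: (mulfI bR0).
rewrite mulr0 mulr_natl -[X in _ *+ X](card_ord b) -sumr_const.
rewrite (eq_bigr (fun e : 'I_b => \sum_z nu z * nu' (shift_word z j k e))); last first.
  move=> e _; rewrite -(sum_rot_word (fun z => nu z * nu' z)
    (fun j' k' => if (j' == j) && (k' == k) then e else digit0 hb)).
  by apply: eq_bigr => z _; rewrite -/(shift_word z j k e) inv.
by rewrite exchange_big/= big1// => z _; rewrite -mulr_sumr nu0 mulr0.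
Qed.

End finite_scramble.

Section bessel.
Context (R : realFieldType) (s b K n : nat) (hb : (1 < b)%N) (n0 : (0 < n)%N).
Local Notation Z := {ffun 'I_s -> K.-tuple 'I_b}.
Local Notation S := {ffun 'I_s * {bseq K of 'I_b} -> {perm 'I_b}}.
Context (A : 'I_n -> 'I_s -> nat -> 'I_b) (J : finType) (level : J -> 'I_s -> nat).
Context (nu : J -> Z -> R) (f : Z -> R) (j0 : 'I_s).
Hypothesis levelK : forall k j, (level k j < K)%N.
Hypothesis nu_mean : forall k j z, \sum_e nu k (shift_word hb z j (level k j) e) = 0.
Hypothesis nu_inv : forall k k', k != k' ->
  exists j, forall z e, nu k (shift_word hb z j (level k' j) e) = nu k z.
Hypothesis A_separated : forall i i' k, i != i' ->
  exists j, mkseq (A i j) (level k j) != mkseq (A i' j) (level k j).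

Definition avg (T : finType) (F : T -> R) := #|T|%:R^-1 * \sum_t F t.

Let word (t : S) i : Z := scrambled_word K (perm_at t) (A i).

Definition estimate (t : S) := n%:R^-1 * \sum_i f (word t i).

Definition witness (t : S) := n%:R^-1 * \sum_k \sum_i nu k (word t i).

Let nR0 : n%:R != 0 :> R. Proof. by rewrite pnatr_eq0 -lt0n. Qed.

Let S0 : #|{: S}|%:R != 0 :> R.
Proof. by rewrite pnatr_eq0 -lt0n; apply/card_gt0P; exists [ffun=> 1%g]. Qed.

Let Z0 : #|{: Z}|%:R != 0 :> R.
Proof.
rewrite pnatr_eq0 -lt0n; apply/card_gt0P.
by exists [ffun=> [tuple digit0 hb | _ < K]].
Qed.

Let sum_word (F : Z -> R) i : \sum_t F (word t i) = #|{: S}|%:R * avg F.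
Proof.
by apply: (mulIf Z0); rewrite sum_scrambled_word// /avg; field.
Qed.

Let sum_nuF (F : Z -> R) k i :
  \sum_t nu k (word t i) * (\sum_i' F (word t i')) =
  #|{: S}|%:R * avg (fun z => nu k z * F z).
Proof.
under eq_bigr do rewrite mulr_sumr.
rewrite exchange_big/= (bigD1 i)//= [X in _ + X]big1 ?addr0; last first.
  move=> i' ii'; have [|j] := @A_separated i i' k; first by rewrite eq_sym.
  apply: sum_separated; [exact: levelK|exact: nu_mean].
by rewrite (sum_word (fun z => nu k z * F z)).
Qed.

Let avg_nu k : avg (nu k) = 0.
Proof.
rewrite /avg; have := @sum_invariant R s b K hb (fun=> 1) (nu k) j0 (level k j0)
  (fun _ _ => erefl) (nu_mean k j0).
by under eq_bigr do rewrite mul1r; move=> ->; rewrite mulr0.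
Qed.

Let avg_nunu k k' : k != k' -> avg (fun z => nu k z * nu k' z) = 0.
Proof.
move=> /nu_inv[j kk']; rewrite /avg.
by rewrite (sum_invariant (hb := hb) (j := j) (k := level k' j))// mulr0.
Qed.

Lemma avgD (T : finType) (F G : T -> R) : avg (fun t => F t + G t) = avg F + avg G.
Proof. by rewrite /avg big_split mulrDr. Qed.

Lemma avgZ (T : finType) (c : R) (F : T -> R) : avg (fun t => c * F t) = c * avg F.
Proof. by rewrite /avg -mulr_sumr mulrCA. Qed.

Let avg_S (c : R) : #|{: S}|%:R^-1 * (#|{: S}|%:R * c) = c.
Proof. by rewrite mulrA mulVf ?mul1r. Qed.

Let avg_witness : avg witness = 0.
Proof.
rewrite avgZ /avg exchange_big/= big1 ?mulr0// => k _.
by rewrite exchange_big/= big1// => i _; rewrite sum_word avg_nu mulr0.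
Qed.

Let avg_witness_sum (F : Z -> R) :
  avg (fun t => witness t * (n%:R^-1 * \sum_i F (word t i))) =
  n%:R^-1 * \sum_k avg (fun z => nu k z * F z).
Proof.
transitivity (n%:R^-1 * (n%:R^-1 * \sum_k \sum_(i < n)
    avg (fun z => nu k z * F z))).
  rewrite (_ : (fun t => _) = (fun t => n%:R^-1 * (n%:R^-1 *
      \sum_k \sum_i nu k (word t i) * \sum_i' F (word t i')))); last first.
    apply/funext => t; rewrite /witness mulrACA -mulrA; congr (_ * (_ * _)).
    rewrite mulr_suml; apply: eq_bigr => k _; rewrite mulr_suml.
    by [].
  rewrite !avgZ; congr (_ * (_ * _)); rewrite /avg exchange_big/= mulr_sumr.
  apply: eq_bigr => k _; rewrite exchange_big/= mulr_sumr; apply: eq_bigr => i _.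
  by rewrite sum_nuF avg_S.
congr (_ * _); under eq_bigr do rewrite sumr_const card_ord -mulr_natl.
by rewrite -mulr_sumr mulrA mulVf ?mul1r.
Qed.

(** The centre e disappears because the witness has mean 0. In the remaining averages only equal
    points survive, and in that of the square only equal levels; summing over the n points cancels
    one of the two factors 1/n. *)
Lemma avg_bessel (e : R) :
  avg (fun t => 2 * (estimate t - e) * witness t - 3 / 2 * witness t ^+ 2) =
  n%:R^-1 * \sum_k avg (fun z => 2 * nu k z * f z - 3 / 2 * nu k z ^+ 2).
Proof.
have E1 : avg (fun t => witness t * estimate t) =
    n%:R^-1 * \sum_k avg (fun z => nu k z * f z) by exact: avg_witness_sum.
have E2 : avg (fun t => witness t ^+ 2) = n%:R^-1 * \sum_k avg (fun z => nu k z ^+ 2).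
  transitivity (\sum_k' avg (fun t => witness t * (n%:R^-1 * \sum_i nu k' (word t i)))).
    rewrite /avg -mulr_sumr; congr (_ * _); rewrite exchange_big/=.
    apply: eq_bigr => t _; rewrite -mulr_sumr expr2; congr (_ * _).
    by rewrite /witness mulr_sumr.
  under eq_bigr do rewrite avg_witness_sum.
  rewrite -mulr_sumr exchange_big/=; congr (_ * _); apply: eq_bigr => k _.
  rewrite (bigD1 k)//= big1 ?addr0 => [|k' kk'].
    by congr avg; apply/funext => z; rewrite expr2.
  by apply: avg_nunu; rewrite eq_sym.
transitivity (2 * avg (fun t => witness t * estimate t) + (- 2 * e) * avg witness
    + (- (3 / 2)) * avg (fun t => witness t ^+ 2)).
  rewrite -!avgZ -!avgD; congr avg; apply/funext => t; ring.
rewrite avg_witness E1 E2 mulr0 addr0 mulrCA [X in _ + X]mulrCA -mulrDr.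
congr (_ * _); rewrite !mulr_sumr -big_split/=; apply: eq_bigr => k _.
by rewrite -!avgZ -!avgD; congr avg; apply/funext => z; ring.
Qed.

End bessel.

(** * The law of the scramble *)

Section lower_integral.
Context d (T : measurableType d) (R : realType) (mu : {measure set T -> \bar R}).
Local Open Scope ereal_scope.
Import HBNNSimple.

(** The integral of a nonnegative function is a supremum over the simple functions below it, and
    those approximating f1 lie below f2. Measurability is thus asked of f1 only, which allows f2 to
    be the squared deviation of [muhat]. *)
Lemma ge0_le_integral_lower (f1 f2 : T -> \bar R) :
  measurable_fun setT f1 -> (forall x, 0 <= f1 x) ->
  (forall x, f1 x <= f2 x) -> \int[mu]_x f1 x <= \int[mu]_x f2 x.
Proof.
move=> mf1 f10 f12.
have f20 x : 0 <= f2 x by exact: le_trans (f12 x).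
pose g := nnsfun_approx measurableT mf1.
rewrite (@nd_ge0_integral_lim _ _ _ _ f1 g)//; last 2 first.
- by move=> x m n mn; exact/lefP/nd_nnsfun_approx.
- by move=> x; apply: cvg_nnsfun_approx.
apply: lime_le.
  by apply: is_cvg_sintegral => // t m n mn; exact/lefP/nd_nnsfun_approx.
near=> n; rewrite ge0_integralTE//; apply: ereal_sup_ubound => /=.
exists (g n) => // t; apply: le_trans (f12 t).
by rewrite /g nnsfun_approxE; exact: le_approx.
Unshelve. all: by end_near. Qed.

End lower_integral.

Section scramble_law.
Context (R : realType) (s b K : nat) (hb : (1 < b)%N).
Context (d0 : measure_display) (Omega : measurableType d0) (P : probability Omega R).
Context (pi : 'I_s -> seq 'I_b -> Omega -> {perm 'I_b}).
Hypothesis pi_law : uniform_independent_perms P pi.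
Local Notation node := ('I_s * {bseq K of 'I_b})%type.
Local Notation S := {ffun node -> {perm 'I_b}}.

Definition state (w : Omega) : S := [ffun v => pi v.1 (val v.2) w].

Let perm_measurable j a (B : {set {perm 'I_b}}) :
  measurable [set w | pi j a w \in B].
Proof.
have [mpi _ _] := pi_law.
rewrite (_ : mkset _ = \bigcup_(p in [set` B]) [set w | pi j a w = p]).
  by apply: fin_bigcup_measurable => //; exact: finite_finset.
apply/seteqP; split => w /=; first by move=> wB; exists (pi j a w).
by move=> [p pB ->].
Qed.

Let word_node (v : node) : 'I_s * seq 'I_b := (v.1, val v.2).

Let state_cap (t : S) : [set w | state w = t] =
  \bigcap_(i in [set` [seq word_node v | v <- enum {: node}]])
    [set w | pi i.1 i.2 w \in [set perm_at t i.1 i.2]%SET].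
Proof.
apply/seteqP; split => w /=.
  move=> <- i /= /mapP[v _ ->]; rewrite inE /perm_at valK ffunE /=.
  by case: v.
move=> wt; apply/ffunP => -[j v]; rewrite ffunE /=.
have jv : (j, val v) \in [seq word_node v | v <- enum {: node}].
  by apply/mapP; exists (j, v) => //; rewrite mem_enum.
by have := wt _ jv; rewrite /= inE /perm_at valK => /eqP.
Qed.

Lemma state_measurable t : measurable [set w | state w = t].
Proof.
rewrite state_cap; apply: fin_bigcap_measurable; first exact: finite_seq.
by move=> i _; exact: perm_measurable.
Qed.

Lemma state_law t : P [set w | state w = t] = (#|{: S}|%:R^-1)%:E.
Proof.
have [_ ppi ind] := pi_law; rewrite state_cap ind; last first.
  rewrite map_inj_uniq ?enum_uniq// => -[j v] [j' v'] [-> vv'].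
  by congr (_, _); exact: val_inj.
rewrite big_map (eq_bigr (fun=> ((b`!)%:R^-1)%:E)); last first.
  move=> v _; rewrite -(ppi v.1 (val v.2) (perm_at t v.1 (val v.2))).
  by congr (P _); apply/seteqP; split => w /=; rewrite inE => /eqP.
rewrite prodEFin; congr EFin; rewrite big_const_seq count_predT iter_mulr_1.
rewrite exprVn -natrX card_ffun; congr (_ %:R^-1); congr (_ ^ _)%N.
  by rewrite -card_Sn; apply: eq_card => p; rewrite !inE.
by rewrite cardE.
Qed.

Lemma integral_state (F : S -> R) :
  (\int[P]_w (F (state w))%:E = (avg F)%:E)%E.
Proof.
have E w : F (state w) = \sum_t F t * \1_[set w | state w = t] w.
  rewrite (bigD1 (state w))//= big1 ?addr0.
    by rewrite indicE mem_set// mulr1.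
  by move=> t tw; rewrite indicE memNset ?mulr0//= => /esym/eqP; exact/negP.
under eq_integral do rewrite E -sumEFin.
have int t : P.-integrable setT (EFin \o \1_[set w | state w = t]).
  by apply: integrable_indic => //; exact: state_measurable.
rewrite integral_sum//; last first.
  by move=> t; apply: (integrableZl measurableT (F t) (int t)).
rewrite /avg mulr_sumr -sumEFin; apply: eq_bigr => t _.
under eq_integral do rewrite EFinM.
rewrite integralZl//; last exact: int.
rewrite integral_indic ?setIT//; last exact: state_measurable.
by rewrite [X in (_ * X)%E]state_law -EFinM mulrC.
Qed.

Lemma state_fun_measurable (F : S -> R) :
  measurable_fun setT (fun w => (F (state w))%:E).
Proof.
move=> _ Y mY; rewrite setTI.
rewrite (_ : _ @^-1` _ = \bigcup_(t in [set t | Y (F t)%:E]) [set w | state w = t]).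
  by apply: fin_bigcup_measurable => [|t _]; [exact: finite_finset|exact: state_measurable].
apply/seteqP; split => w /=; first by move=> Yw; exists (state w).
by move=> [t /= Yt ->].
Qed.

(* Outside this event [digit] recovers the first K scrambled digits from the
   scrambled number: they are not followed by digits b - 1 only. *)
Definition maximal_tail (j : 'I_s) (A : nat -> 'I_b) : set Omega :=
  \bigcap_(k in [set k | (K <= k)%N]) [set w | pi j (mkseq A k) w \in
    [set p : {perm 'I_b} | ~~ (p (A k) < b.-1)%N]%SET].

Lemma maximal_tail_measurable j A : measurable (maximal_tail j A).
Proof. by apply: bigcap_measurable => // ; exists K => /=. Qed.

(** The nodes along A have distinct lengths, so the conditions at different depths are independent.
    Each has probability at most q = 1 - 1/b!, because the transposition [p0] sends the digit to 0 <
    b - 1 and violates it. Hence L of them give at most q^L. *)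
Lemma maximal_tail_null j A : P (maximal_tail j A) = 0%E.
Proof.
have [_ ppi ind] := pi_law.
pose B k := [set p : {perm 'I_b} | ~~ (p (A k) < b.-1)%N]%SET.
pose q : R := 1 - (b`!)%:R^-1.
have q0 : 0 <= q by rewrite subr_ge0 invf_le1 ?ler1n ?ltr0n fact_gt0.
have q1 : q < 1 by rewrite ltrBlDr ltrDl invr_gt0 ltr0n fact_gt0.
have PB k : (P [set w | pi j (mkseq A k) w \in B k] <= q%:E)%E.
  pose p0 : {perm 'I_b} := tperm (A k) (digit0 hb).
  have mp0 := perm_measurable j (mkseq A k) [set p0]%SET.
  have : (P [set w | pi j (mkseq A k) w \in B k] <=
      P (~` [set w | pi j (mkseq A k) w \in [set p0]%SET]))%E.
    apply: le_measure; rewrite ?inE//; first exact: measurableC.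
    move=> w /=; rewrite !inE => h /eqP pw; move: h.
    by rewrite pw /p0 tpermL /= -ltnS prednK ?hb//; lia.
  move=> /le_trans; apply; rewrite probability_setC//.
  rewrite (_ : [set w | _] = [set w | pi j (mkseq A k) w = p0]); last first.
    by apply/seteqP; split => w /=; rewrite inE => /eqP.
  by rewrite ppi.
have PL L : (P (maximal_tail j A) <= (q ^+ L)%:E)%E.
  pose I := [seq (j, mkseq A k) | k <- iota K L].
  pose BB (i : 'I_s * seq 'I_b) := B (size i.2).
  have Iu : uniq I.
    rewrite map_inj_uniq ?iota_uniq// => k k' [] /(congr1 size).
    by rewrite !size_mkseq.
  have := ind I BB Iu; set E := \bigcap_(i in _) _ => PE.
  have mE : measurable E.
    apply: fin_bigcap_measurable; first exact: finite_seq.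
    by move=> i _; exact: perm_measurable.
  apply: (@le_trans _ _ (P E)).
    apply: le_measure; rewrite ?inE//; first exact: maximal_tail_measurable.
    move=> w wt i /= /mapP[k]; rewrite mem_iota => /andP[Kk _] -> /=.
    by rewrite /BB /= size_mkseq; exact: wt.
  rewrite PE big_map -[L in q ^+ L](size_iota K).
  elim: (iota K L) => [|k l ih]; first by rewrite big_nil expr0.
  rewrite big_cons /= exprS EFinM; apply: lee_pmul => //.
  - exact: prode_ge0.
  - by rewrite /BB /= size_mkseq; exact: PB.
apply/eqP; rewrite eq_le measure_ge0 andbT; apply/lee_addgt0Pr => e e0.
have : (fun L => q ^+ L) @ \oo --> (0 : R) by apply: cvg_expr; rewrite ger0_norm.
move=> /cvgr_lt/(_ _ e0)[L _ /(_ L (leqnn L))/= Le].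
by rewrite add0e; apply: le_trans (PL L) _; rewrite lee_fin ltW.
Qed.

(** With x the value of h, D its approximation and y the witness, (x - e)^2 >= 2 (x - e) y - y^2.
    Replacing x by D in the product costs at most 2 (x - D)^2 + y^2 / 2, which explains both 3/2 and
    2 eps^2. *)
Lemma variance_lower (h : Omega -> R) (N : set Omega) (est wit : S -> R) (eps : R) :
  measurable N -> P N = 0%E ->
  (forall w, ~ N w -> `|h w - est (state w)| <= eps) ->
  exists e : R, ((avg (fun t => 2 * (est t - e) * wit t - 3 / 2 * wit t ^+ 2) -
    2 * eps ^+ 2)%:E <= 'V_P[h])%E.
Proof.
move=> mN PN happ; pose e := fine 'E_P[h]; exists e.
pose F t := 2 * (est t - e) * wit t - 3 / 2 * wit t ^+ 2 - 2 * eps ^+ 2.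
(* [ge0_le_integral_lower] asks for a nonnegative minorant; passing to the positive part only
   increases the average of [F]. *)
pose Fp t := Num.max 0 (F t).
have -> : ('V_P[h] = \int[P]_w ((h w - e) ^+ 2)%:E)%E.
  rewrite /variance covariance.unlock /e expectation.unlock.
  by apply: eq_integral => w _; rewrite expr2.
apply: (@le_trans _ _ (\int[P]_w (Fp (state w))%:E)%E).
  rewrite integral_state lee_fin /avg.
  have S0 : 0 < #|{: S}|%:R :> R.
    by rewrite ltr0n; apply/card_gt0P; exists [ffun=> 1%g].
  have -> : 2 * eps ^+ 2 = #|{: S}|%:R^-1 * \sum_(t : S) 2 * eps ^+ 2.
    by rewrite sumr_const -(mulr_natl (2 * eps ^+ 2)) mulKf// gt_eqF.
  rewrite -mulrBr -sumrB ler_wpM2l ?invr_ge0 ?ler0n//; apply: ler_sum => t _.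
  by rewrite /Fp le_max lexx orbT.
rewrite (ae_eq_integral (fun w => ((Fp (state w)) * \1_(~` N) w)%:E))//; last 3 first.
- exact: state_fun_measurable.
- apply/measurable_EFinP; apply: measurable_funM.
    exact/measurable_EFinP/state_fun_measurable.
  by apply: measurable_indic; exact: measurableC.
- exists N; split => // w /= /existsNP; apply: contraPP => Nw [].
  by rewrite indicE mem_set// mulr1.
apply: ge0_le_integral_lower.
- apply/measurable_EFinP; apply: measurable_funM.
    exact/measurable_EFinP/state_fun_measurable.
  by apply: measurable_indic; exact: measurableC.
- by move=> w; rewrite lee_fin mulr_ge0// le_max lexx.
move=> w; rewrite lee_fin indicE.
have [Nw|Nw] := pselect (N w); first by rewrite memNset ?mulr0 ?sqr_ge0//=; exact.
rewrite mem_set// mulr1 /Fp ge_max sqr_ge0/= /F.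
have := happ w Nw; move: (h w) (est _) (wit _) => x D y.
rewrite -ler_sqr ?nnegrE// ?(le_trans _ (happ w Nw))// real_normK ?num_real// => h1.
have h2 := sqr_ge0 (x - e - y); have h3 := sqr_ge0 (2 * (x - D) + y).
nra.
Qed.

End scramble_law.

(** * Contribution of one vector of levels *)

Lemma sum_indicator (R : pzSemiRingType) (I : finType) (p : pred I) (F : I -> R) :
  \sum_i (p i)%:R * F i = \sum_(i | p i) F i.
Proof.
by rewrite [RHS]big_mkcond; apply: eq_bigr => i _; case: (p i); rewrite ?mul1r ?mul0r.
Qed.

Section level_contribution.
Context (R : realType) (s d b : nat) (hd : (0 < d)%N) (hb : (1 < b)%N).
Local Notation M := 'M[R]_(s, d).
Context (X : 'I_s -> set 'rV[R]_d) (cell : 'I_s -> nat -> nat -> set 'rV[R]_d).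
Hypothesis X_bounded : forall j, bounded_set (X j).
Hypothesis X_volume : forall j, mx_lebesgue (X j) = 1%E.
Hypothesis cell_split : forall j, recursive_split b (X j) (cell j).
Context (C : R) (C0 : 0 <= C).
Local Notation cs := (cell_size d b C).
Hypothesis cell_diam : forall j k t, (t < b ^ k)%N ->
  (diam (cell j k t) <= (cs k)%:E)%E.
Context (g : partial_index s d -> M -> R) (B beta : R) (c : M).
Hypotheses (B0 : 0 <= B) (beta0 : 0 < beta).
Hypothesis X_box : forall z : M, prod_set X z ->
  forall y : M, in_box c z y -> prod_set X y.
Hypothesis g_der : forall (a : partial_index s d) j l x, a j = None ->
  interior (prod_set X) x ->
  is_derive x (delta_mx j l) (g a) (g (add_partial a j l) x).
Hypothesis g_hoelder : forall a x y, prod_set X x -> prod_set X y ->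
  `|g a x - g a y| <= B * enorm (x - y) `^ beta.
Context (ct : R) (ct0 : 0 < ct).
Hypothesis eigen : forall j k t, (t < b ^ k)%N ->
  ct * b%:R `^ (- (2 * k%:R / d%:R)) <=
    min_eigenvalue (split_matrix b (cell j) k t).
Context (xs : M) (Xxs : prod_set X xs) (K0 : nat) (T : 'I_s -> seq 'I_b).
Hypotheses (T_size : forall j, size (T j) = K0)
  (T_cell : forall j, cell j K0 (idx (T j)) (row j xs)).

Let b0 : (0 < b)%N. Proof. exact: ltnW. Qed.
Let bR0 : 0 < b%:R :> R. Proof. by rewrite ltr0n. Qed.

Definition decay : R := b%:R `^ (- (2 / d%:R)).

Lemma decay_gt0 : 0 < decay. Proof. exact: powR_gt0. Qed.

Lemma decay_le1 : decay <= 1.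
Proof.
rewrite -(powRr0 (b%:R : R)); apply: ler_powR; first by rewrite ler1n.
by rewrite oppr_le0 divr_ge0.
Qed.

Lemma decayX k : decay ^+ k = b%:R `^ (- (2 * k%:R / d%:R)).
Proof.
rewrite -powR_mulrn ?powR_ge0// -powRrM; congr (_ `^ _).
by rewrite mulNr mulrAC.
Qed.

Lemma cell_size_sqr k : cs k ^+ 2 = C ^+ 2 * decay ^+ k.
Proof.
rewrite exprMn decayX; congr (_ * _); rewrite -powR_mulrn ?powR_ge0// -powRrM.
by congr (_ `^ _); ring.
Qed.

Context (K : nat) (y : 'I_s -> K.-tuple 'I_b -> 'rV[R]_d).
Hypothesis y_cell : forall j (z : K.-tuple 'I_b), cell j K (idx z) (y j z).
Hypothesis y_generic : forall j (z : K.-tuple 'I_b) l, y j z 0 l != c j l.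
Local Notation Z := {ffun 'I_s -> K.-tuple 'I_b}.

Let G b := g (top_partial b) xs.

Definition in_cube (z : Z) := [forall j, take K0 (z j) == T j].

(* The function nu_k described at the top. *)
Definition level_test (k : 'I_s -> nat) (z : Z) : R :=
  if in_cube z then
    contrast g (fun j (i : K.-tuple 'I_b) l => increment (y j) (k j) i l) xs z
  else 0.

Let f := g [ffun=> None].

Definition level_loss (k : 'I_s -> nat) (z : Z) : R :=
  2 * level_test k z * f (row_mx_of y z) - 3 / 2 * level_test k z ^+ 2.

(** ct / 4 comes from [increment_eigen], and 1 / b from its factor b^(K-k_j-1) = b^(K-k_j) / b. *)
Definition main_const : R := (ct / (4 * b%:R)) ^+ s * \sum_b G b ^+ 2.

(** 8 d C^2 is the product of the bounds 2 cs (k j) and 2 d * 2 cs (k j) of one block, stripped of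
    its decay. The small factor is the Hoelder bound on the cube of level K0 around [xs]. *)
Definition error_const : R :=
  (\sum_b `|G b|) * (B * ((s * d)%:R * cs K0) `^ beta) * (8 * d%:R * C ^+ 2) ^+ s.

Definition same_class (k : 'I_s -> nat) (z0 z : Z) :=
  [forall j, in_class (take (k j) (z0 j)) (z j)].

Lemma same_classE k z0 z :
  (same_class k z0 z)%:R = \prod_j (in_class (take (k j) (z0 j)) (z j))%:R :> R.
Proof.
case: (boolP (same_class k z0 z)) => [/forallP h|].
  by rewrite big1// => j _; rewrite h.
by rewrite negb_forall => /existsP[j /negbTE hj]; rewrite (bigD1 j)//= hj mul0r.
Qed.

(** [class_bound] with the indicators of the prefixes of z0 as weights. As K0 <= k_j, the class lies
    in the cube, hence near [xs]; as k_j <= m, the condition on [cs K] at level m covers every level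
    k_j. *)
Lemma class_loss k m (z0 : Z) (j0 : 'I_s) : (\sum_j k j = m)%N ->
  (forall j, (K0 <= k j)%N) -> (m < K)%N ->
  4 * (b * d)%:R * cs K ^+ 2 <= 4^-1 * (ct * decay ^+ m) -> in_cube z0 ->
  (\prod_j b%:R ^+ (K - k j)) * decay ^+ m * (2^-1 * main_const - 2 * error_const) <=
  \sum_(z | same_class k z0 z) level_loss k z.
Proof.
move=> km K0k mK csK z0c.
have kK j : (k j < K)%N.
  by apply: leq_ltn_trans mK; rewrite -km (bigD1 j)//= leq_addr.
pose w j (i : K.-tuple 'I_b) : R := (in_class (take (k j) (z0 j)) i)%:R.
pose N j (i : K.-tuple 'I_b) l := increment (y j) (k j) i l.
pose lam j : R := b%:R ^+ (K - (k j).+1) * (4^-1 * (ct * decay ^+ k j)).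
(* A common bound for the diameter [cs (k j)] of the cell and for the increments. *)
pose del j : R := 2 * cs (k j).
have sz j : size (take (k j) (z0 j)) = k j.
  by rewrite size_takel// size_tuple ltnW.
have w_in j i : w j i != 0 -> in_class (take (k j) (z0 j)) i.
  by rewrite /w pnatr_eq0 eqb0 negbK.
have y_k j i : w j i != 0 -> cell j (k j) (idx (take (k j) (z0 j))) (y j i).
  move=> /w_in/(y_class (cell_split j) (y_cell j)).
  by rewrite sz.
have idx_k j : (idx (take (k j) (z0 j)) < b ^ k j)%N.
  by rewrite -[X in (_ < b ^ X)%N]sz idx_lt.
have w_sum j : \sum_i w j i = b%:R ^+ (K - k j).
  under eq_bigr do rewrite -(mulr1 (w j _)).
  by rewrite sum_indicator class_card ?sz// ltnW.
pose Zg j : set 'rV[R]_d := [set v | X j v /\ forall l, v 0 l != c j l].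
have w0 j i : 0 <= w j i by exact: ler0n.
have q0 n : 0 <= ct * decay ^+ n.
  by rewrite mulr_ge0 ?(ltW ct0)// exprn_ge0// ltW// decay_gt0.
have lam0 j : 0 <= lam j.
  by apply: mulr_ge0; [exact/exprn_ge0/ltW|exact: mulr_ge0].
have del0 j : 0 <= del j by rewrite mulr_ge0// cell_size_ge0.
have ZX (z : M) : (forall j, Zg j (row j z)) ->
    prod_set X z /\ forall i l, z i l != c i l.
  move=> zZ; split=> [j|i l]; first by case: (zZ j).
  by have [_ /(_ l)] := zZ i; rewrite mxE.
have wN j (v : 'I_d -> R) :
    lam j * \sum_l v l ^+ 2 <= \sum_i w j i * (\sum_l v l * N j i l) ^+ 2.
  rewrite sum_indicator.
  apply: (increment_eigen b0 hd (X_bounded j) (X_volume j) (cell_split j) C0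
    (@cell_diam j) (y_cell j) v (kK j)).
    by rewrite decayX; exact: eigen.
  apply: le_trans csK _; rewrite ler_pM2l ?invr_gt0// ler_pM2l//.
  rewrite -km (bigD1 j)//= exprD ler_piMr ?exprn_ge0 ?(ltW decay_gt0)//.
  by rewrite exprn_ile1 ?(ltW decay_gt0)// decay_le1.
have yZ j i : w j i != 0 -> Zg j (y j i).
  move=> _; split; last by move=> l; exact: y_generic.
  apply: (cell_subX b0 (cell_split j) _ (y_cell j i)).
  by rewrite -[X in (_ < b ^ X)%N](size_tuple i) idx_lt.
have y_near j i : w j i != 0 -> forall l, `|y j i 0 l - xs j l| <= cs K0.
  move=> wi l; have -> : xs j l = row j xs 0 l by rewrite mxE.
  apply: (cell_coord (@cell_diam j) (t := idx (T j))) => //.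
    by rewrite -[X in (_ < b ^ X)%N](T_size j) idx_lt.
  have : in_class (T j) i.
    rewrite /in_class T_size; have /forallP/(_ j)/eqP <- := z0c.
    have /eqP := w_in _ _ wi; rewrite sz => E.
    by rewrite -[take K0 i](take_takel _ (K0k j)) E take_takel.
  by move=> /(y_class (cell_split j) (y_cell j)); rewrite T_size.
have cs2 k' : cs k' <= 2 * cs k'.
  by have := cell_size_ge0 d b C0 k'; lra.
have y_close j i i' : w j i != 0 -> w j i' != 0 ->
    forall l, `|y j i 0 l - y j i' 0 l| <= del j.
  move=> /y_k yi /y_k yi' l; apply: le_trans (cs2 _).
  exact: (cell_coord (@cell_diam j) _ (idx_k j) yi yi').
have N_le j i l : w j i != 0 -> `|N j i l| <= del j.
  move=> _; exact: (increment_le b0 (cell_split j) (@cell_diam j) (y_cell j)).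
have N_mean j l : \sum_i w j i * N j i l = 0.
  by rewrite sum_indicator; exact: increment_mean.
have N_moment j l l' : \sum_i w j i * N j i l * y j i 0 l' =
    \sum_i w j i * N j i l * N j i l'.
  under eq_bigr do rewrite -mulrA; under [RHS]eq_bigr do rewrite -mulrA.
  by rewrite !sum_indicator; exact: increment_moment.
have wz0 j : w j (z0 j) != 0.
  by rewrite /w in_class_take ?oner_neq0// ltnW.
have := @class_bound R s d (prod_set X) g B beta c B0 beta0 X_box g_der g_hoelder
  Zg ZX _ w y N lam del xs (cs K0) w0 lam0 wN Xxs (cell_size_ge0 d b C0 K0) del0 yZ
  y_near y_close N_le N_mean N_moment z0 j0 (Ordinal hd) wz0.
have -> : \sum_(z : Z) (\prod_j w j (z j)) *
    (2 * contrast g N xs z * f (row_mx_of y z) - 3 / 2 * contrast g N xs z ^+ 2) =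
    \sum_(z | same_class k z0 z) level_loss k z.
  rewrite -[RHS]sum_indicator; apply: eq_bigr => z _; rewrite same_classE.
  have [/forallP zz0|] := boolP (same_class k z0 z); last first.
    rewrite negb_forall => /existsP[j /negbTE hj].
    by rewrite !(bigD1 j (P := predT))//= /w hj !mul0r.
  rewrite /level_loss /level_test (_ : in_cube z = true)//.
  apply/forallP => j; have /forallP/(_ j)/eqP <- := z0c.
  have /eqP := zz0 j; rewrite sz => E.
  by rewrite -[take K0 (z j)](take_takel _ (K0k j)) E take_takel.
have powE (x : R) : x ^+ s = \prod_(j < s) x by rewrite prodr_const card_ord.
have -> : \prod_j lam j = (\prod_j b%:R ^+ (K - k j)) * decay ^+ m *
    (ct / (4 * b%:R)) ^+ s.
  rewrite -km -prodrXr -big_split/= powE -big_split/=.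
  apply: eq_bigr => j _; rewrite /lam -(subnSK (kK j)) exprS.
  by field; rewrite gt_eqF.
have -> : \prod_j ((\sum_i w j i) * del j * (2 * d%:R * del j)) =
    (\prod_j b%:R ^+ (K - k j)) * decay ^+ m * (8 * d%:R * C ^+ 2) ^+ s.
  rewrite -km -prodrXr -big_split/= powE -big_split/=.
  apply: eq_bigr => j _; rewrite w_sum /del.
  transitivity (b%:R ^+ (K - k j) * (8 * d%:R * cs (k j) ^+ 2)); first by ring.
  by rewrite cell_size_sqr; ring.
apply: le_trans; rewrite /main_const /error_const.
by rewrite le_eqVlt; apply/orP; left; apply/eqP; rewrite /G; ring.
Qed.

(** Classes are summed through their members z0, each class being counted [cnt] times, its
    cardinality. Classes outside the cube contribute 0, and the cube is the fraction b^(-K0 s) of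
    all words. *)
Lemma avg_level_loss k m (j0 : 'I_s) : (\sum_j k j = m)%N ->
  (forall j, (K0 <= k j)%N) -> (m < K)%N ->
  4 * (b * d)%:R * cs K ^+ 2 <= 4^-1 * (ct * decay ^+ m) ->
  0 <= 2^-1 * main_const - 2 * error_const ->
  b%:R ^- K0 ^+ s * decay ^+ m * (2^-1 * main_const - 2 * error_const) <=
  avg (level_loss k).
Proof.
move=> km K0k mK csK Q0.
have kK j : (k j < K)%N.
  by apply: leq_ltn_trans mK; rewrite -km (bigD1 j)//= leq_addr.
have K0K : (K0 <= K)%N by apply: leq_trans (K0k j0) (ltnW (kK j0)).
set cnt := \prod_j (b%:R ^+ (K - k j) : R).
have cnt0 : 0 < cnt by apply: prodr_gt0 => j _; rewrite exprn_gt0.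
set Q := _ - _ in Q0 *.
have cls z : \sum_(z0 : Z) (same_class k z0 z)%:R = cnt.
  under eq_bigr do rewrite same_classE.
  rewrite -(bigA_distr_bigA (fun j (i : K.-tuple 'I_b) =>
    (in_class (take (k j) i) (z j))%:R)); apply: eq_bigr => j _.
  have sz : size (take (k j) (z j)) = k j by rewrite size_takel// size_tuple ltnW.
  rewrite -[in RHS]sz -class_card ?sz//; last exact: ltnW.
  rewrite -sum_indicator; apply: eq_bigr => i _; rewrite mulr1.
  by rewrite !in_class_takeE ?(ltnW (kK j))// eq_sym.
have tot : cnt * \sum_z level_loss k z =
    \sum_z0 \sum_(z | same_class k z0 z) level_loss k z.
  under [RHS]eq_bigr do rewrite -sum_indicator.
  rewrite exchange_big/= mulr_sumr; apply: eq_bigr => z _.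
  by rewrite -mulr_suml cls.
have cube : \sum_(z0 : Z) (in_cube z0)%:R = (b%:R ^+ (K - K0)) ^+ s :> R.
  have powE (x : R) : x ^+ s = \prod_(j < s) x by rewrite prodr_const card_ord.
  rewrite powE (eq_bigr (fun j => \sum_(i : K.-tuple 'I_b) (in_class (T j) i)%:R)).
    rewrite bigA_distr_bigA/=; apply: eq_bigr => z _; rewrite /in_cube.
    case: (boolP [forall j, _]) => [/forallP h|].
      by rewrite big1// => j _; rewrite /in_class T_size h.
    rewrite negb_forall => /existsP[j /negbTE hj].
    by rewrite (bigD1 j)//= /in_class T_size hj mul0r.
  move=> j _; rewrite -[in LHS](T_size j) -class_card ?T_size//.
  by rewrite -sum_indicator; apply: eq_bigr => i _; rewrite mulr1.
have low : (b%:R ^+ (K - K0)) ^+ s * (cnt * decay ^+ m * Q) <=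
    cnt * \sum_z level_loss k z.
  rewrite tot -cube mulr_suml; apply: ler_sum => z0 _.
  have [z0c|z0c] := boolP (in_cube z0); first by rewrite mul1r; exact: class_loss.
  rewrite mul0r sumr_ge0// => z /forallP zz0.
  rewrite /level_loss /level_test (_ : in_cube z = false) ?mulr0
    ?mul0r ?expr0n ?mulr0 ?subrr//.
  apply: contraNF z0c => /forallP zc; apply/forallP => j.
  have sz : size (take (k j) (z0 j)) = k j by rewrite size_takel// size_tuple ltnW.
  have /eqP := zz0 j; rewrite sz => E.
  by rewrite -[take K0 (z0 j)](take_takel _ (K0k j)) -E take_takel//; exact: zc.
have cardZ : #|{: Z}|%:R = (b%:R ^+ K0 * b%:R ^+ (K - K0)) ^+ s :> R.
  by rewrite card_ffun card_tuple !card_ord -exprD subnKC// !natrX.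
rewrite /avg cardZ exprMn invfM exprVn.
have p0 n : 0 < (b%:R ^+ n) ^+ s :> R by rewrite !exprn_gt0.
rewrite -!mulrA ler_pM2l ?invr_gt0// ler_pdivlMl// -(ler_pM2l cnt0).
apply: le_trans low; rewrite le_eqVlt; apply/orP; left; apply/eqP; ring.
Qed.

Lemma take_shift_word (z : Z) j j' k k' e : (k <= k')%N ->
  take k (shift_word hb z j k' e j') = take k (z j').
Proof.
move=> kk'; apply: (@eq_from_nth _ (digit0 hb)) => [|i].
  by rewrite !size_take !size_tuple.
rewrite size_take size_tuple => ik.
have ik1 : (i < k)%N by case: ifP ik => // /negbT; rewrite -leqNgt => h /leq_trans; apply.
have iK : (i < K)%N by case: ifP ik => // h /ltn_trans; apply.
rewrite !nth_take// -[i in LHS]/(val (Ordinal iK)) -[i in RHS]/(val (Ordinal iK)).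
rewrite -!tnth_nth ffunE tnth_mktuple /= (ltn_eqF (leq_trans ik1 kk')) andbF.
exact: rot_digit0.
Qed.

Lemma shift_word_other (z : Z) j j' k e : j' != j -> shift_word hb z j k e j' = z j'.
Proof.
move=> jj'; rewrite ffunE; apply: eq_from_tnth => i; rewrite tnth_mktuple.
by rewrite (negbTE jj') rot_digit0.
Qed.

Lemma takeS_shift_word (z : Z) j k (kK : (k < K)%N) e :
  take k.+1 (shift_word hb z j k e j) =
  rcons (take k (z j)) (rot_digit hb e (tnth (z j) (Ordinal kK))).
Proof.
rewrite (take_nth (digit0 hb)) ?size_tuple// take_shift_word//.
rewrite -[k in nth _ _ k]/(val (Ordinal kK)) -tnth_nth ffunE tnth_mktuple.
by rewrite /= !eqxx.
Qed.

Lemma in_cube_shift (z : Z) j k e : (K0 <= k)%N ->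
  in_cube (shift_word hb z j k e) = in_cube z.
Proof. by move=> K0k; apply: eq_forallb => j'; rewrite take_shift_word. Qed.

(** Shifting the digit of index k_j permutes the b subclasses, whose increments sum to 0; the
    factors of the other blocks do not move. *)
Lemma level_test_mean k j (z : Z) : (K0 <= k j)%N -> (k j < K)%N ->
  \sum_e level_test k (shift_word hb z j (k j) e) = 0.
Proof.
move=> K0k kK; rewrite /level_test.
have [zc|/negbTE zc] := boolP (in_cube z); last first.
  by rewrite big1// => e _; rewrite in_cube_shift// zc.
under eq_bigr do rewrite in_cube_shift// zc.
rewrite /contrast exchange_big/= big1// => a _; rewrite -mulr_sumr.
pose u := take (k j) (z j).
have E e : \prod_i increment (y i) (k i) (shift_word hb z j (k j) e i) (a i) =
    (mean (y j) (rcons u (rot_digit hb e (tnth (z j) (Ordinal kK)))) (a j) -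
      mean (y j) u (a j)) * \prod_(i | i != j) increment (y i) (k i) (z i) (a i).
  rewrite (bigD1 j)//=; congr (_ * _).
    by rewrite /increment (takeS_shift_word z j kK) take_shift_word.
  by apply: eq_bigr => i ij; rewrite shift_word_other.
under eq_bigr do rewrite E.
rewrite -mulr_suml.
have inj : injective (fun e => rot_digit hb e (tnth (z j) (Ordinal kK))).
  by move=> e e'; rewrite ![rot_digit hb _ (tnth _ _)]rot_digitC => /rot_digit_inj.
rewrite (_ : \sum_e _ = \sum_c (mean (y j) (rcons u c) (a j) - mean (y j) u (a j))).
  by rewrite (mean_split b0) ?mul0r ?mulr0.
by rewrite [RHS](reindex_inj inj).
Qed.

(** nu_k reads coordinate j only up to the digit of index k_j. *)
Lemma level_test_inv k k' j (z : Z) e : (K0 <= k j)%N -> (k j < k' j)%N ->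
  level_test k (shift_word hb z j (k' j) e) = level_test k z.
Proof.
move=> K0k kk'; rewrite /level_test in_cube_shift; last exact: leq_trans K0k (ltnW kk').
case: ifP => // _; apply: eq_bigr => a _; congr (_ * _); apply: eq_bigr => i _.
have [->|ij] := eqVneq i j; last by rewrite shift_word_other.
by rewrite /increment !take_shift_word// ltnW.
Qed.

End level_contribution.

(** * Number of level vectors *)

Definition admissible s K0 m (k : {ffun 'I_s -> 'I_m.+1}) :=
  (\sum_j k j == m)%N && [forall j, (K0 <= k j)%N].

(** The first s - 1 levels are free in [K0, K0 + q) and the last one is forced by the sum. It is at
    least K0 because the K0 terms and the q terms each use at most m / 2. *)
Lemma card_admissible s K0 m : (0 < s)%N -> (2 * s * K0 <= m)%N ->
  ((m %/ (2 * s)) ^ s.-1 <= #|{: {k : {ffun 'I_s -> 'I_m.+1} | admissible K0 k}}|)%N.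
Proof.
case: s => // s _ mK; set q := (m %/ _)%N.
have qm : (2 * s.+1 * q <= m)%N by rewrite mulnC leq_trunc_div.
pose tot (h : {ffun 'I_s -> 'I_q}) := (\sum_i (K0 + h i))%N.
have tot_le h : (tot h + K0 <= m)%N.
  have : (tot h <= \sum_(i < s) (K0 + q))%N.
    by apply: leq_sum => i _; rewrite leq_add2l ltnW.
  rewrite sum_nat_const card_ord; nia.
pose kf (h : {ffun 'I_s -> 'I_q}) : {ffun 'I_s.+1 -> 'I_m.+1} :=
  [ffun j => inord (if unlift ord_max j is Some i then (K0 + h i)%N else (m - tot h)%N)].
have kf_lift h i : kf h (lift ord_max i) = (K0 + h i)%N :> nat.
  rewrite ffunE liftK inordK// ltnS; apply: leq_trans (tot_le h).
  by rewrite /tot (bigD1 i)//= -!addnA leq_add2l leq_addr.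
have kf_max h : kf h ord_max = (m - tot h)%N :> nat.
  by rewrite ffunE unlift_none inordK// ltnS leq_subr.
have kfP h : admissible K0 (kf h).
  apply/andP; split; last first.
    apply/forallP => j; case: (unliftP ord_max j) => [i|] ->.
      by rewrite kf_lift leq_addr.
    by rewrite kf_max; have := tot_le h; lia.
  rewrite big_ord_recr /= kf_max (eq_bigr (fun i => K0 + h i)%N).
    by rewrite -/(tot h) subnKC//; have := tot_le h; lia.
  move=> i _; rewrite -kf_lift; congr (nat_of_ord (kf h _)).
  by apply: val_inj; rewrite /= /bump leqNgt ltn_ord.
have kf_inj : injective (fun h => exist (@admissible s.+1 K0 m) _ (kfP h)).
  move=> h h' /(congr1 val)/= /ffunP kk; apply/ffunP => i; apply: val_inj.
  by apply: (@addnI K0); rewrite -!kf_lift kk.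
by have := leq_card _ kf_inj; rewrite card_ffun !card_ord.
Qed.

(** * Variance bound at a fixed truncation level *)

Section variance_bound.
Context (R : realType) (s d b : nat) (hd : (0 < d)%N) (hb : (1 < b)%N) (j0 : 'I_s).
Local Notation M := 'M[R]_(s, d).
Context (X : 'I_s -> set 'rV[R]_d) (cell : 'I_s -> nat -> nat -> set 'rV[R]_d).
Hypothesis X_bounded : forall j, bounded_set (X j).
Hypothesis X_volume : forall j, mx_lebesgue (X j) = 1%E.
Hypothesis cell_split : forall j, recursive_split b (X j) (cell j).
Context (C : R) (C0 : 0 <= C).
Local Notation cs := (cell_size d b C).
Hypothesis cell_diam : forall j k t, (t < b ^ k)%N ->
  (diam (cell j k t) <= (cs k)%:E)%E.
Context (g : partial_index s d -> M -> R) (B beta : R) (c : M).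
Hypotheses (B0 : 0 <= B) (beta0 : 0 < beta).
Hypothesis X_closed : closed (prod_set X).
Hypothesis X_box : forall z : M, prod_set X z ->
  forall y : M, in_box c z y -> prod_set X y.
Hypothesis g_der : forall (a : partial_index s d) j l x, a j = None ->
  interior (prod_set X) x ->
  is_derive x (delta_mx j l) (g a) (g (add_partial a j l) x).
Hypothesis g_hoelder : forall a x y, prod_set X x -> prod_set X y ->
  `|g a x - g a y| <= B * enorm (x - y) `^ beta.
Context (ct : R) (ct0 : 0 < ct).
Hypothesis eigen : forall j k t, (t < b ^ k)%N ->
  ct * b%:R `^ (- (2 * k%:R / d%:R)) <=
    min_eigenvalue (split_matrix b (cell j) k t).
Context (xs : M) (Xxs : prod_set X xs) (K0 : nat) (T : 'I_s -> seq 'I_b).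
Hypotheses (T_size : forall j, size (T j) = K0)
  (T_cell : forall j, cell j K0 (idx (T j)) (row j xs)).
Context (f : M -> R).
Hypothesis gf : forall x, prod_set X x -> g [ffun=> None] x = f x.
Local Notation main := (main_const b g ct xs).
Local Notation error := (error_const b C g B beta xs K0).
Hypothesis Q0 : 0 <= 2^-1 * main - 2 * error.

Let b0 : (0 < b)%N. Proof. exact: ltnW. Qed.

Lemma cell_point j k t : (t < b ^ k)%N ->
  exists2 x, cell j k t x & forall l, x 0 l != c j l.
Proof.
move=> tk; have [x cx xc] := cell_generic b0 (X_bounded j) (X_volume j)
  (cell_split j) (row j c) tk.
by exists x => // l; have := xc l; rewrite mxE.
Qed.

Let cell_nonempty j k t : (t < b ^ k)%N -> cell j k t !=set0.
Proof. by move=> /(cell_point j)[x cx _]; exists x. Qed.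

(** Values of [phi] are limits of points of the cells and may lie outside them; closedness of the
    product set keeps them in it. *)
Lemma phi_prod_set (u : 'I_s -> R) :
  prod_set X (\matrix_(j < s) phi hb (cell j) (u j)).
Proof.
apply: X_closed => U /nbhs_ballP[e /= e0 eU].
have : \forall k \near \oo, cs k < e.
  have := @cell_size_cvg0 R d b hb hd C; move/cvgr_lt; exact.
move=> [K _ /(_ K (leqnn K)) /= Ke].
have /choice[x xP] j : exists x, cell j K (cell_index hb (u j) K) x.
  exact/cell_nonempty/cell_index_lt.
exists (\matrix_j x j); split.
  move=> j; have -> : row j (\matrix_j x j) = x j by rewrite rowK.
  exact: (cell_subX b0 (cell_split j) (cell_index_lt hb (u j) K) (xP j)).
apply: eU; split => // j l; rewrite !mxE.
rewrite /ball /= /ball_ /=; apply: le_lt_trans Ke.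
exact: (phi_near hd (cell_split j) C0 (@cell_diam j) (@cell_nonempty j) _ (xP j)).
Qed.

(** The subtracted square is the price of truncation: off a null set, each scrambled point is within
    [cs K], in every coordinate, of the representative of its word, and f is Hoelder. *)
Lemma variance_level m K (d0 : measure_display) (Omega : measurableType d0)
    (P : probability Omega R) (pi : 'I_s -> seq 'I_b -> Omega -> {perm 'I_b})
    (a : 'I_(b ^ m) -> 'rV[R]_s) :
  uniform_independent_perms P pi -> is_net a -> (m < K)%N ->
  4 * (b * d)%:R * cs K ^+ 2 <= 4^-1 * (ct * decay R d b ^+ m) ->
  (((b ^ m)%:R^-1 * (#|{: {k : {ffun 'I_s -> 'I_m.+1} | admissible K0 k}}|%:R *
     (b%:R ^- K0 ^+ s * decay R d b ^+ m * (2^-1 * main - 2 * error))) -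
   2 * (B * ((s * d)%:R * cs K) `^ beta) ^+ 2)%:E <= 'V_P[muhat hb f cell pi a])%E.
Proof.
move=> pi_law net mK csK.
have /choice[y' yP] (v : 'I_s * K.-tuple 'I_b) : exists x,
    cell v.1 K (idx v.2) x /\ forall l, x 0 l != c v.1 l.
  have [|x cx xc] := @cell_point v.1 K (idx v.2); last by exists x.
  by rewrite -[X in (_ < b ^ X)%N](size_tuple v.2) idx_lt.
pose y j z := y' (j, z).
have y_cell j (z : K.-tuple 'I_b) : cell j K (idx z) (y j z) := (yP (j, z)).1.
have y_generic j (z : K.-tuple 'I_b) l : y j z 0 l != c j l := (yP (j, z)).2 l.
pose J := {k : {ffun 'I_s -> 'I_m.+1} | admissible K0 k}.
pose level (k : J) (j : 'I_s) : nat := val k j.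
have level_sum k : (\sum_j level k j = m)%N by case/andP: (valP k) => /eqP H _; exact: H.
have level_ge k j : (K0 <= level k j)%N by case/andP: (valP k) => _ /forallP H; exact: H.
have level_lt k j : (level k j < K)%N by exact: leq_trans (ltn_ord (val k j)) mK.
pose nu (k : J) := level_test g xs K0 T y (level k).
pose fz (z : {ffun 'I_s -> K.-tuple 'I_b}) := g [ffun=> None] (row_mx_of y z).
pose A i j := digit hb (a i 0 j).
pose est := estimate A fz.
pose wit := witness A nu.
(* Union, over the finitely many points and coordinates, of the null events on which the first K
   digits may be misread. *)
pose N := \big[setU/set0]_(v : 'I_(b ^ m) * 'I_s) maximal_tail K pi v.2 (A v.1 v.2).
have [mN PN] : measurable N /\ P N = 0%E.
  rewrite /N; elim/big_ind: _ => [|U U' [mU U0] [mU' U'0]|v _].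
  - by rewrite measure0.
  - by split; [exact: measurableU|rewrite measureU0].
  - by split; [exact: maximal_tail_measurable pi_law _ _|exact: maximal_tail_null].
have happ w : ~ N w ->
    `|muhat hb f cell pi a w - est (state K pi w)| <= B * ((s * d)%:R * cs K) `^ beta.
  move=> Nw; rewrite /est /estimate /muhat -mulrBr -sumrB normrM ger0_norm ?invr_ge0//.
  rewrite ler_pdivrMl ?ltr0n ?expn_gt0 ?b0//.
  apply: le_trans (ler_norm_sum _ _ _) _.
  apply: (@le_trans _ _ (\sum_(i < b ^ m) B * ((s * d)%:R * cs K) `^ beta)); last first.
    by rewrite sumr_const card_ord [leRHS]mulr_natl.
  apply: ler_sum => i _.
  set z := scrambled_word K _ (A i); set x := geometric_point _ _ _ _.
  have Xx : prod_set X x by exact: phi_prod_set.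
  have Xz : prod_set X (row_mx_of y z).
    move=> j; have -> : row j (row_mx_of y z) = y j (z j).
      by apply/rowP => l; rewrite !mxE.
    apply: (cell_subX b0 (cell_split j) _ (y_cell j (z j))).
    by rewrite -[X in (_ < b ^ X)%N](size_tuple (z j)) idx_lt.
  rewrite -(gf Xx); apply: le_trans (g_hoelder _ Xx Xz) _.
  rewrite ler_wpM2l//; apply: ge0_ler_powR; rewrite ?nnegrE ?enorm_ge0//.
  - exact: ltW.
  - by rewrite mulr_ge0// cell_size_ge0.
  apply: enorm_le => [|j l]; first exact: cell_size_ge0.
  rewrite !mxE; set u := scramble _ _ _.
  pose q k := pi j (mkseq (A i j) k) w (A i j k).
  have zq : z j = mkseq q K :> seq _.
    apply: (@eq_from_nth _ (digit0 hb)) => [|k].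
      by rewrite size_tuple size_mkseq.
    rewrite size_tuple => kK; rewrite nth_mkseq//.
    rewrite -[k in LHS]/(val (Ordinal kK)) -tnth_nth ffunE tnth_mktuple /=.
    rewrite /perm_at (insubT (fun t => (size t <= K)%N)).
      by rewrite size_mkseq ltnW.
    by move=> kK'; rewrite ffunE.
  have [k0 Kk0 qk0] : exists2 k0, (K <= k0)%N & (q k0 < b.-1)%N.
    apply: contrapT => nex; apply: Nw; rewrite /N -bigcup_seq.
    exists (i, j); first by rewrite /= mem_index_enum.
    move=> k /= Kk; rewrite inE; apply/negP => qk; apply: nex; by exists k.
  have uK : cell_index hb u K = idx (z j).
    by rewrite zq -(digit_series_index R hb Kk0 qk0).
  have := y_cell j (z j); rewrite -uK.
  exact: (phi_near hd (cell_split j) C0 (@cell_diam j) (@cell_nonempty j)).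
have [e] := variance_lower pi_law wit mN PN happ.
apply: le_trans; rewrite lee_fin lerB//.
rewrite (@avg_bessel R s b K (b ^ m) hb _ A J level nu fz j0 level_lt); last first.
- move=> i i' k ii'; exact: (net_separation hb net (level_sum k) ii').
(* Both vectors sum to m, so if no coordinate of k' exceeded that of k, they would be equal; a
   coordinate where k' is larger gives the invariance. *)
- move=> k k' kk'; apply: contrapT => nex; move/eqP: kk'; apply.
  have le j : (level k' j <= level k j)%N.
    rewrite leqNgt; apply/negP => kj; apply: nex; exists j => z ee.
    exact: level_test_inv.
  apply: val_inj; apply/ffunP => j; apply: val_inj; apply/eqP.
  have : (\sum_j (level k j - level k' j) == 0)%N.
    by rewrite sumnB// !level_sum subnn.
  rewrite sum_nat_eq0 => /forallP/(_ j)/=; rewrite subn_eq0 => kj.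
  by rewrite eqn_leq kj; exact: le.
- by move=> k j z; exact: level_test_mean.
- by rewrite expn_gt0 b0.
rewrite ler_wpM2l ?invr_ge0//.
rewrite mulr_natl -sumr_const; apply: ler_sum => k _.
exact: (avg_level_loss hd hb X_bounded X_volume cell_split C0 cell_diam B0 beta0
  X_box g_der g_hoelder ct0 eigen Xxs T_size T_cell y_cell y_generic j0 (level_sum k)).
Qed.

End variance_bound.

(** * Choice of the parameters *)

Lemma cell_size_small (R : realType) (d b : nat) (C e : R) (m : nat) :
  (1 < b)%N -> (0 < d)%N -> 0 < e ->
  exists2 K, (m < K)%N & cell_size d b C K <= e.
Proof.
move=> hb hd e0.
have /cvgr_lt/(_ _ e0)[K _ Ke] := @cell_size_cvg0 R d b hb hd C.
exists (maxn K m.+1); first by rewrite leq_maxr.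
by apply/ltW/Ke; rewrite /= leq_maxl.
Qed.

Lemma rate_natE (R : realType) (d b m : nat) : (0 < b)%N ->
  ((b ^ m)%:R : R) `^ (1 + 2 / d%:R) = (b ^ m)%:R * (decay R d b ^+ m)^-1.
Proof.
move=> b0; have bR : b%:R != 0 :> R by rewrite pnatr_eq0 -lt0n.
have nz : (b ^ m)%:R != 0 :> R by rewrite natrX expf_neq0.
rewrite powRD; last by rewrite nz implybT.
rewrite powRr1; last exact: ler0n.
congr (_ * _); rewrite decayX powRN invrK natrX -powR_mulrn; last exact: ler0n.
rewrite -powRrM.
by congr (_ `^ _); ring.
Qed.

Theorem theorem1 (R : realType) (s d b : nat)
    (hs : (0 < s)%N) (hd : (0 < d)%N) (hb : (1 < b)%N)
    (X : 'I_s -> set 'rV[R]_d)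
    (X_bounded : forall j, bounded_set (X j))
    (X_volume : forall j, mx_lebesgue (X j) = 1%E)
    (cell : 'I_s -> nat -> nat -> set 'rV[R]_d)
    (cell_split : forall j, recursive_split b (X j) (cell j))
    (cell_spherical : spherical b cell)
    (X_sobol : sobol_extensible (prod_set X))
    (f : 'M[R]_(s, d) -> R)
    (f_smooth : smooth_nondegenerate (prod_set X) f)
    (eigen_bound : exists2 ct : R, 0 < ct &
       forall j k t, (t < b ^ k)%N ->
         ct * b%:R `^ (- (2 * k%:R / d%:R)) <=
           min_eigenvalue (split_matrix b (cell j) k t)) :
  exists2 c : R, 0 < c &
    \forall m \near \oo,
      forall (d0 : measure_display) (Omega : measurableType d0)
        (P : probability Omega R)
        (pi : 'I_s -> seq 'I_b -> Omega -> {perm 'I_b})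
        (a : 'I_(b ^ m) -> 'rV[R]_s),
        uniform_independent_perms P pi -> is_net a ->
        let n : R := (b ^ m)%:R in
        ((c * (ln n ^+ s.-1 / n `^ (1 + 2 / d%:R)))%:E
           <= 'V_P[muhat hb f cell pi a])%E.
Proof.
have [g [[gf g_der] [B [beta [B0 /andP[beta0 _] hoel]]] nondeg]] := f_smooth.
have [X_closed _ [c Xc X_box]] := X_sobol.
have [ct ct0 eigen] := eigen_bound.
have [C' C'diam] := cell_spherical.
pose C := `|C'|; have C0 : 0 <= C by exact: normr_ge0.
have cell_diam j k t : (t < b ^ k)%N -> (diam (cell j k t) <= (cell_size d b C k)%:E)%E.
  move=> tk; apply: le_trans (C'diam j k t tk) _.
  by rewrite lee_fin /cell_size ler_wpM2r ?powR_ge0// ler_norm.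
have b0 : (0 < b)%N by exact: ltnW.
have bR0 : 0 < b%:R :> R by rewrite ltr0n.
have g_hoelder a x y : prod_set X x -> prod_set X y ->
    `|g a x - g a y| <= B * enorm (x - y) `^ beta.
  move=> Xx Xy; apply: le_trans (hoel [set j | isSome (a j)]%SET x y Xx Xy).
  rewrite -sqrtr_sqr ler_wsqrtr// (bigD1 a)/= ?lerDl ?sumr_ge0// => [*|].
    exact: sqr_ge0.
  by apply/forallP => j; rewrite inE.
(* If all derivatives of order one in every block vanished on X, so would their integrals, against
   nondegeneracy for the full set of blocks. *)
have [xs Xxs [a0 ga0]] : exists2 x, prod_set X x &
    exists a : {ffun 'I_s -> 'I_d}, g (top_partial a) x != 0.
  apply: contrapT => nex; have := nondeg [set: 'I_s]%SET.
  rewrite big1 ?ltxx// => al /forallP alT.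
  have [a ->] : exists a, al = top_partial a.
    exists [ffun j => odflt (Ordinal hd) (al j)]; apply/ffunP => j.
    by rewrite !ffunE; have := alT j; rewrite inE; case: (al j).
  rewrite /Rintegral (eq_integral (fun=> 0%E)) ?integral0 ?expr0n// => x.
  rewrite inE => Xx; congr EFin; apply/eqP/negPn/negP => gx.
  by apply: nex; exists x => //; exists a.
pose main := main_const b g ct xs.
have main0 : 0 < main.
  rewrite mulr_gt0// ?exprn_gt0 ?divr_gt0 ?mulr_gt0//.
  rewrite (bigD1 a0)//= ltr_pwDl ?sumr_ge0// => [|a _]; last exact: sqr_ge0.
  by rewrite lt_def sqr_ge0 sqrf_eq0 ga0.
(* The error is W times the Hoelder factor of level K0. Making it at most main / 8 leaves main / 2 -
   main / 4. *)
have [K0 Qmain] : exists K0, main / 4 <=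
    2^-1 * main - 2 * error_const b C g B beta xs K0.
  pose W := (\sum_a `|g (top_partial a) xs|) * B * (8 * d%:R * C ^+ 2) ^+ s.
  have W0 : 0 <= W.
    by rewrite !mulr_ge0 ?sumr_ge0// exprn_ge0// mulr_ge0// ?mulr_ge0// sqr_ge0.
  have W1 : 0 < 8 * (W + 1) by rewrite mulr_gt0// ltr_wpDl.
  have [x0 x00 small] := powR_small beta0 (divr_gt0 main0 W1).
  have sd0 : 0 < (s * d)%:R :> R by rewrite ltr0n muln_gt0 hs.
  have [K0 _ K0x] := cell_size_small C 0 hb hd (divr_gt0 x00 sd0).
  exists K0; rewrite /error_const.
  have := small ((s * d)%:R * cell_size d b C K0).
  rewrite mulr_ge0 ?cell_size_ge0//= mulrC -ler_pdivlMr// => /(_ K0x).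
  rewrite [_ * (s * d)%:R]mulrC; move: (_ `^ beta) => p pW.
  have : W * p <= main / 8.
    apply: le_trans (ler_wpM2l W0 pW) _.
    rewrite mulrCA ler_pM2l// invfM mulrCA ger_pMr ?invr_gt0//.
    by rewrite ler_pdivrMr ?ltr_wpDl// mul1r lerDl.
  rewrite (_ : _ * (B * p) * _ = W * p); last by rewrite /W; ring.
  lra.
pose Q := 2^-1 * main - 2 * error_const b C g B beta xs K0.
have Q0 : 0 < Q by apply: lt_le_trans Qmain; rewrite divr_gt0.
have /choice[T TP] j : exists w : seq 'I_b, size w = K0 /\ cell j K0 (idx w) (row j xs).
  by have [w wK wc] := cell_cover (cell_split j) K0 (Xxs j); exists w.
have lnb : 0 < ln (b%:R : R) by rewrite ln_gt0// ltr1n.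
pose v := b%:R ^- K0 ^+ s * Q.
have v0 : 0 < v by rewrite mulr_gt0// !exprn_gt0// invr_gt0 exprn_gt0.
(* The factor 1/2 leaves room for the truncation error; ln n = m ln b and m <= 4 s q compare (ln
   n)^(s-1) with the count q^(s-1). *)
exists (2^-1 * v * ((4 * s%:R * ln b%:R) ^+ s.-1)^-1).
  have sR : 0 < s%:R :> R by rewrite ltr0n.
  have h4 : 0 < 4 * s%:R * ln b%:R :> R by rewrite mulr_gt0// mulr_gt0.
  by apply: mulr_gt0; [exact: mulr_gt0|rewrite invr_gt0 exprn_gt0].
near=> m; move=> d0 Omega P pi a pi_law net; pose n : R := (b ^ m)%:R.
(* 2 s K0 <= m is required by the count of level vectors; the extra 2 s gives q >= 1, hence m <= (q
   + 1) 2 s <= 4 s q. *)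
have hm : (2 * s * K0 + 2 * s <= m)%N by near: m; exact: nbhs_infty_ge.
have n0 : 0 < n by rewrite ltr0n expn_gt0 b0.
pose dm := decay R d b ^+ m.
have dm0 : 0 < dm by rewrite exprn_gt0// decay_gt0.
pose q := (m %/ (2 * s))%N.
pose cardJ := #|{: {k : {ffun 'I_s -> 'I_m.+1} | admissible K0 k}}|.
have qJ : (q ^ s.-1 <= cardJ)%N.
  by apply: card_admissible => //; apply: leq_trans hm; rewrite leq_addr.
have q1 : (0 < q)%N.
  by rewrite divn_gt0 ?muln_gt0 ?hs//; apply: leq_trans hm; rewrite leq_addl.
have mq : (m <= 4 * s * q)%N.
  have := ltn_ceil m (_ : 0 < 2 * s)%N; rewrite muln_gt0 hs => /(_ isT).
  rewrite -/q => /ltnW/leq_trans; apply.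
  have -> : (4 * s * q = (2 * q) * (2 * s))%N.
    by rewrite mulnACA -mulnA [(s * q)%N]mulnC.
  have q2 : (q.+1 <= 2 * q)%N by rewrite mul2n -addnn -[q.+1]addn1 leq_add2l.
  by rewrite leq_mul2r q2 orbT.
pose V := n^-1 * (cardJ%:R * (v * dm)).
have cardJ0 : 0 < cardJ%:R :> R.
  by rewrite ltr0n; apply: leq_trans qJ; rewrite expn_gt0 q1.
have V0 : 0 < V.
  by apply: mulr_gt0; [rewrite invr_gt0|apply: mulr_gt0 => //; exact: mulr_gt0].
have goalV : 2^-1 * v * ((4 * s%:R * ln b%:R) ^+ s.-1)^-1 *
    (ln n ^+ s.-1 / n `^ (1 + 2 / d%:R)) <= 2^-1 * V.
  have -> : ln n = m%:R * ln b%:R by rewrite /n natrX lnXn// mulr_natl.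
  rewrite rate_natE// -/n -/dm [(m%:R * _) ^+ _]exprMn.
  have L0 : 0 < ln (b%:R : R) ^+ s.-1 by rewrite exprn_gt0.
  have h : m%:R ^+ s.-1 <= (4 * s%:R) ^+ s.-1 * cardJ%:R :> R.
    apply: (@le_trans _ _ ((4 * s%:R) ^+ s.-1 * q%:R ^+ s.-1)).
      rewrite -exprMn; apply: lerXn2r; rewrite ?nnegrE ?ler0n//.
      by rewrite -!natrM ler_nat.
    by rewrite ler_wpM2l ?exprn_ge0 ?mulr_ge0// -natrX ler_nat.
  have S0 : 0 < (4 * s%:R) ^+ s.-1 :> R by rewrite exprn_gt0// mulr_gt0// ltr0n.
  rewrite (exprMn _ (4 * s%:R)); move: h S0 L0 dm0 v0.
  move: (m%:R ^+ s.-1 : R) ((4 * s%:R) ^+ s.-1 : R) (ln (b%:R : R) ^+ s.-1).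
  move=> mm ss ll h S0 L0 dm0 v0.
  rewrite /V.
  have -> : 2^-1 * v * (ss * ll)^-1 * (mm * ll / (n * dm^-1)) =
      (2^-1 * v * dm / (n * ss)) * mm by field; rewrite !gt_eqF.
  have -> : 2^-1 * (n^-1 * (cardJ%:R * (v * dm))) =
      (2^-1 * v * dm / (n * ss)) * (ss * cardJ%:R) by field; rewrite !gt_eqF.
  have c0 : 0 < 2^-1 * v * dm / (n * ss).
    apply: divr_gt0; last exact: mulr_gt0.
    by apply: mulr_gt0 => //; exact: mulr_gt0.
  by rewrite ler_pM2l.
have sd0 : 0 < (s * d)%:R :> R by rewrite ltr0n muln_gt0 hs.
have B1 : 0 < B + 1 by rewrite ltr_wpDl.
(* With p the Hoelder factor at level K, the minimum with 1 gives (B p)^2 <= B p, and B p <= V / 4;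
   the truncation loss 2 (B p)^2 is then at most V / 2. *)
have t0 : 0 < Num.min 1 (V / 4) / (B + 1) by rewrite divr_gt0// lt_min ltr01 divr_gt0.
have [x0 x00 small] := powR_small beta0 t0.
have bd0 : 0 < 4 * (b * d)%:R :> R by rewrite mulr_gt0// ltr0n muln_gt0 b0.
(* [cs K <= 1] gives (cs K)^2 <= cs K and reduces the quadratic condition on [cs K] to a linear
   one. *)
pose e1 := Num.min 1 (4^-1 * (ct * dm) / (4 * (b * d)%:R)).
have e10 : 0 < Num.min e1 (x0 / (s * d)%:R).
  by rewrite !lt_min ltr01 !divr_gt0// !mulr_gt0// invr_gt0.
have [K mK] := cell_size_small C m hb hd e10.
have csK0 : 0 <= cell_size d b C K by exact: cell_size_ge0.
rewrite !le_min -andbA => /and3P[csK1 csK2 csK3].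
have csK : 4 * (b * d)%:R * cell_size d b C K ^+ 2 <= 4^-1 * (ct * dm).
  rewrite mulrC -ler_pdivlMr//; apply: le_trans csK2.
  by rewrite expr2 ler_piMr.
have := variance_level hd hb (Ordinal hs) X_bounded X_volume cell_split C0 cell_diam
  B0 beta0 X_closed X_box g_der g_hoelder ct0 eigen Xxs (fun j => (TP j).1)
  (fun j => (TP j).2) gf (ltW Q0) pi_law net mK csK.
apply: le_trans; rewrite lee_fin; apply: le_trans goalV _.
have -> : n^-1 * (cardJ%:R * (b%:R ^- K0 ^+ s * dm * Q)) = V by rewrite /V /v; ring.
have : (B * ((s * d)%:R * cell_size d b C K) `^ beta) ^+ 2 <= V / 4.
  have := small ((s * d)%:R * cell_size d b C K).
  rewrite mulr_ge0//= mulrC -ler_pdivlMr// => /(_ csK3); rewrite [_ * (s * d)%:R]mulrC.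
  rewrite ler_pdivlMr// le_min; have : 0 <= ((s * d)%:R * cell_size d b C K) `^ beta.
    exact: powR_ge0.
  move: (_ `^ beta) => p p0 /andP[p1 p2].
  have Bp : 0 <= B * p by rewrite mulr_ge0.
  have Bp1 : B * p <= p * (B + 1) by rewrite mulrDr mulr1 mulrC lerDl.
  apply: le_trans p2; apply: le_trans Bp1.
  by rewrite expr2 ler_piMr// (le_trans _ p1)// mulrDr mulr1 mulrC lerDl.
lra.
Unshelve. all: by end_near. Qed.
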